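(* Let $p>1$ be an integer and let $(u_n)$ be a bounded sequence in $H^1_{rad}(\mathbb{R}^2)$ such that $$u_n\rightharpoonup0\ \text{ weakly in } H^1(\mathbb{R}^2)\qquad\text{and}\qquad \limsup_{n\to\infty}\|u_n\|_{L^{\phi_p}}=A_0>0 .$$ Then there exist a sequence of pairwise orthogonal scales $(\alpha_n^{(j)})_{j\ge1}$ and a sequence of profiles $(\psi^{(j)})_{j\ge1}$ such that, up to extraction of a subsequence in $n$, for all $\ell\ge1$, $$u_n(x)=\sum_{j=1}^{\ell}\sqrt{\frac{\alpha_n^{(j)}}{2\pi}}\;\psi^{(j)}\!\left(\frac{-\log|x|}{\alpha_n^{(j)}}\right)+r_n^{(\ell)}(x),\qquad \limsup_{n\to\infty}\|r_n^{(\ell)}\|_{L^{\phi_p}}\xrightarrow[\ell\to\infty]{}0 .$$ Moreover, for all $\ell\ge1$, $$\|\nabla u_n\|_{L^2}^2=\sum_{j=1}^{\ell}\|{\psi^{(j)}}'\|_{L^2(\mathbb{R})}^2+\|\nabla r_n^{(\ell)}\|_{L^2}^2+o(1),\qquad n\to\infty .$$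
   Context: $H^1_{rad}(\mathbb{R}^2)$ is the space of radially symmetric functions in $H^1(\mathbb{R}^2)$. For an integer $p\ge1$, $\phi_p(s):=e^{s^2}-\sum_{k=0}^{p-1}\frac{s^{2k}}{k!}$. Let $\kappa:=\sup_{\|u\|_{H^1}\le1}\int_{\mathbb{R}^2}\big(e^{4\pi|u|^2}-1\big)\,dx$, which is finite. The Orlicz norm is $$\|u\|_{L^{\phi_p}}=\inf\Big\{\lambda>0:\ \int_{\mathbb{R}^2}\phi_p\Big(\frac{|u(x)|}{\lambda}\Big)\,dx\le\kappa\Big\}.$$ A scale is a sequence $(\alpha_n)$ of positive real numbers going to infinity; two scales $(\alpha_n)$, $(\tilde\alpha_n)$ are orthogonal if $\big|\log(\tilde\alpha_n/\alpha_n)\big|\to\infty$ as $n\to\infty$. A profile is a function $\psi$ in $$\mathcal{P}:=\Big\{\psi\in L^2(\mathbb{R},e^{-2s}ds):\ \psi'\in L^2(\mathbb{R}),\ \psi_{|]-\infty,0]}=0\Big\}.$$ *)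

(* Defs.v *)
From HB Require Import structures.
From mathcomp Require Import all_boot all_order all_algebra.
From mathcomp Require Import all_classical all_reals all_analysis.
Import Order.TTheory GRing.Theory Num.Theory.
Import numFieldNormedType.Exports.

Set Implicit Arguments.
Unset Strict Implicit.
Unset Printing Implicit Defensive.

Local Open Scope classical_set_scope.
Local Open Scope ring_scope.

(* The plane is modelled by R * R.  Its library norm is the max norm, so the
   Euclidean norm is [enorm].  Elements of Lebesgue and Sobolev spaces are
   represented by Borel functions, with no quotient by a.e. equality. *)

Section Plane.
Context {R : realType}.

Definition leb1 : {measure set (measurableTypeR R) -> \bar R} := @lebesgue_measure R.

Definition leb2 : {measure set (measurableTypeR R * measurableTypeR R) -> \bar R} :=
  ((@lebesgue_measure R) \x (@lebesgue_measure R))%E.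

Definition enorm (x : R * R) : R := Num.sqrt (x.1 ^+ 2 + x.2 ^+ 2).

Definition e1 : R * R := (1, 0).
Definition e2 : R * R := (0, 1).

End Plane.

Section TestFunctions.
Context {R : realType}.

(* C^oo: every iterated directional derivative exists and is differentiable
   (hence continuous). *)
Definition smooth (V : normedModType R) (phi : V -> R) : Prop :=
  forall (s : seq V) (x : V),
    differentiable (foldr (fun v g => fun y : V => 'D_v g y) phi s) x.

Definition test_function (V : normedModType R) (phi : V -> R) : Prop :=
  smooth phi /\ compact (closure [set x | phi x != 0]).

End TestFunctions.

Section WeakDerivatives.
Context {R : realType}.

(* These are used only for u and g locally integrable, so that the real-valued
   integrals are those of integrable functions. *)
Definition is_weak_partial (v : R * R) (u g : R * R -> R) : Prop :=
  forall phi : R * R -> R, test_function phi ->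
    \int[leb2]_x (u x * 'D_v phi x) = - \int[leb2]_x (g x * phi x).

Definition is_weak_deriv (u g : R -> R) : Prop :=
  forall phi : R -> R, test_function phi ->
    \int[leb1]_x (u x * derive1 phi x) = - \int[leb1]_x (g x * phi x).

Definition weak_partial (v : R * R) (u : R * R -> R) : R * R -> R :=
  xget (cst 0) [set g | g \in Lfun leb2 2%:E /\ is_weak_partial v u g].

Definition weak_deriv (u : R -> R) : R -> R :=
  xget (cst 0) [set g | g \in Lfun leb1 2%:E /\ is_weak_deriv u g].

Definition gradient (u : R * R -> R) (x : R * R) : R * R :=
  (weak_partial e1 u x, weak_partial e2 u x).

End WeakDerivatives.

Definition L2norm d (T : measurableType d) (R : realType)
    (mu : {measure set T -> \bar R}) (f : T -> R) : R :=
  fine ('N[mu]_2%:E[EFin \o f])%E.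

Section Sobolev.
Context {R : realType}.
Implicit Types u v : R * R -> R.

Definition H1 u : Prop :=
  u \in Lfun leb2 2%:E /\
  (forall e : R * R, e = e1 \/ e = e2 ->
     exists g, g \in Lfun leb2 2%:E /\ is_weak_partial e u g).

Definition grad_norm u : R := L2norm leb2 (fun x => enorm (gradient u x)).

Definition H1norm u : R := Num.sqrt (L2norm leb2 u ^+ 2 + grad_norm u ^+ 2).

Definition radial u : Prop :=
  exists f : R -> R, {ae leb2, forall x, u x = f (enorm x)}.

Definition H1rad u : Prop := H1 u /\ radial u.

Definition H1_functional (L : (R * R -> R) -> R) : Prop :=
  (forall (a : R) u v, H1 u -> H1 v ->
     L (fun x => a * u x + v x) = a * L u + L v) /\
  (exists C : R, forall u, H1 u -> `|L u| <= C * H1norm u).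

Definition H1_weakly_cvg (u_ : nat -> R * R -> R) u : Prop :=
  forall L, H1_functional L -> (fun n => L (u_ n)) @ \oo --> L u.

End Sobolev.

Section Orlicz.
Context {R : realType}.

Definition phi_ (p : nat) (s : R) : R :=
  expR (s ^+ 2) - \sum_(k < p) s ^+ (2 * k) / k`!%:R.

Definition kappa : \bar R :=
  ereal_sup [set (\int[leb2]_x (expR (4 * pi * `|u x| ^+ 2) - 1)%:E)%E
            | u in [set u : R * R -> R | H1 u /\ H1norm u <= 1]].

(* +oo when no admissible lambda exists. *)
Definition orlicz_norm (p : nat) (u : R * R -> R) : \bar R :=
  ereal_inf [set lambda%:E | lambda in [set lambda : R | 0 < lambda /\
    (\int[leb2]_x (phi_ p (`|u x| / lambda))%:E <= kappa)%E]].

End Orlicz.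

Section Profiles.
Context {R : realType}.

Definition scale (a : nat -> R) : Prop :=
  (forall n, 0 < a n) /\ a @ \oo --> +oo.

Definition orthogonal_scales (a b : nat -> R) : Prop :=
  (fun n => `|ln (b n / a n)|) @ \oo --> +oo.

Definition profile (psi : R -> R) : Prop :=
  [/\ measurable_fun [set: measurableTypeR R] psi,
      (\int[leb1]_s (psi s ^+ 2 * expR (- 2 * s))%:E < +oo)%E,
      exists g, g \in Lfun leb1 2%:E /\ is_weak_deriv psi g &
      forall s, s <= 0 -> psi s = 0].

Definition concentration (a : R) (psi : R -> R) (x : R * R) : R :=
  Num.sqrt (a / (2 * pi)) * psi (- ln (enorm x) / a).

End Profiles.

(* Main.v *)
Require Import Defs.
From HB Require Import structures.
From mathcomp Require Import all_boot all_order all_algebra.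
From mathcomp Require Import all_classical all_reals all_analysis.
From mathcomp Require Import measurable_realfun lebesgue_integral_under.
From mathcomp Require Import ring lra.
Import Order.TTheory GRing.Theory Num.Theory.
Import numFieldNormedType.Exports.

Set Implicit Arguments.
Unset Strict Implicit.
Unset Printing Implicit Defensive.

Local Open Scope classical_set_scope.
Local Open Scope ring_scope.

(* In the variable s = - ln |x|, a radial H^1 function is u(x) = v(s) with v
   absolutely continuous, |grad u|_2^2 = 2 pi |v'|_2^2 and
   |u|_2^2 = 2 pi int v(s)^2 e^(-2s) ds.  A concentration of scale a becomes, on
   derivatives, the unitary dilation g |-> a^(-1/2) g(./a), so profiles can be
   extracted in the Hilbert space L^2(0,+oo) of derivatives.  Along an
   ultrafilter, choose scales a_n that nearly maximise
   |<sqrt(a) g_n(a .), 1_[0,1]>| = |v_n(a) - v_n(0)| / sqrt a, subtract the weak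
   limit of the rescaled sequence, and repeat.  Dilations with orthogonal scales
   are asymptotically orthogonal, so the energies split; their sum is finite,
   hence the maximised quantities tend to 0 and the remainder w satisfies
   |w(s) - w(0)| <= eps sqrt s for large s.  For such s the exponential in
   phi_p(w / (2 eps)) is beaten by e^(-2s); on bounded ranges of s dominated
   convergence applies, since weak convergence and the Hoelder bound on v_n give
   v_n -> 0 pointwise; as s -> -oo, Strauss' decay estimate and
   phi_p(y) <= y^4 e^(y^2), valid for p > 1, make the integral small. *)

(** * Extraction of profiles in a Hilbert space with dilations *)

(** Every profile would cost a further extraction in [n]; along an ultrafilter all bounded real
    sequences converge at once, so the filter never changes and one subsequence is drawn at the very
    end. Concentration is tested against the single indicator of [[0, 1]], because its dilations
    measure the increments [(v b - v 0) / sqrt b] on which the exponential integral depends: when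
    these are at most [eps], [(w / (2 * eps)) ^ 2] grows no faster than [s / 2], and
    [expR (s / 2 - 2 * s)] is integrable. Only the restriction of [v'] to [s >= 0] is decomposed,
    since profiles vanish for [s <= 0]; the other half goes unchanged into the remainder. The main
    obstacle precedes the extraction: [u] has only weak partial derivatives and equals almost
    everywhere a function of [|x|] that is not known to be measurable. A measurable [v] is read off
    horizontal lines approaching the axis, and its derivative is found by testing the gradient with
    radial vector fields. Conversely, integration by parts along lines parallel to the axes gives
    the weak gradient of [v (- ln |x|)], as the origin meets only one line in each direction. *)

Section Ultrafilters.
Context {R : realType}.

Lemma ultra_fmap (T S : Type) (f : T -> S) (U : set_system T) :
  UltraFilter U -> UltraFilter (f @ U).
Proof.
move=> UU; split=> [|G GG sG]; first exact: fmap_proper_filter.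
rewrite eqEsubset; split=> // A GA.
have [//|UA] := in_ultra_setVsetC (f @^-1` A) UU.
have /sG GnA : (f @ U) (~` A) by [].
by exfalso; apply: (@filter_not_empty _ _ GG); rewrite -(setICr A); exact: filterI.
Qed.

(** Takes the place of Bolzano-Weierstrass: no filter is refined, so all the limits of the
    construction coexist along one [U]. *)
Lemma ultra_cvg_bounded (U : set_system nat) (a : nat -> R) (M : R) :
  UltraFilter U -> (\forall n \near U, `|a n| <= M) ->
  exists l : R, a n @[n --> U] --> l.
Proof.
move=> UU aM.
have := @segment_compact R (- M) M; rewrite compact_ultra => /(_ (a @ U)).
case; first exact: ultra_fmap.
  by apply: filterS aM => n; rewrite /= in_itv/= ler_norml.
by move=> l [_ al]; exists l.
Qed.

(** Finite intersections of the [A i] lie in [U] and, since [U] contains all cofinite sets, have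
    arbitrarily large elements; [s n] is picked in the intersection of the first [n + 1] sets. *)
Lemma ultra_subsequence (U : set_system nat) (A : nat -> set nat) :
  ProperFilter U -> \oo `<=` U -> (forall i, U (A i)) ->
  exists s : nat -> nat, {homo s : m n / (m < n)%N} /\
    forall i n, (i <= n)%N -> A i (s n).
Proof.
move=> UU oU UA.
have UA' n : U [set m | forall i, (i <= n)%N -> A i m].
  elim: n => [|n IH].
    by apply: filterS (UA 0%N) => m Am i; rewrite leqn0 => /eqP ->.
  apply: filterS (filterI IH (UA n.+1)) => m [Am Am'] i.
  by rewrite leq_eqVlt ltnS => /predU1P[->|/Am].
have ex n k : exists m, (k < m)%N /\ forall i, (i <= n)%N -> A i m.
  have /oU Uk : \oo [set m | (k < m)%N] by exists k.+1.
  by have [m [? ?]] := filter_ex (filterI Uk (UA' n)); exists m.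
pose nxt n k := projT1 (cid (ex n k)).
pose s := fix s n := if n is n'.+1 then nxt n (s n') else nxt 0 0.
exists s; split.
  apply: homo_ltn => [m n p|n]; first exact: ltn_trans.
  by rewrite /= /nxt; case: cid => m [].
have sP n : exists k, s n = nxt n k by case: n => [|n]; [exists 0%N|exists (s n)].
move=> i n; have [k ->] := sP n; rewrite /nxt; case: (cid _) => m /= [_].
by apply.
Qed.

End Ultrafilters.

(** * Riesz representation and weak limits for a semidefinite inner product *)

Section DilatedSpace.
Context {R : realType} {V : lmodType R}.
Variables (P : set V) (B : V -> V -> R).

(* [B] is only semidefinite: in the application the vectors are functions, not
   classes modulo a.e. equality, and [P] singles out the square-integrable ones. *)
Record preHilbert : Prop := PreHilbert {
  ph0 : P 0;
  phL : forall a x y, P x -> P y -> P (a *: x + y);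
  phC : forall x y, P x -> P y -> B x y = B y x;
  phB : forall a x y z, P x -> P y -> P z -> B (a *: x + y) z = a * B x z + B y z;
  ph_ge0 : forall x, P x -> 0 <= B x x;
  ph_complete : forall h : nat -> V, (forall n, P (h n)) ->
    (forall eps : R, 0 < eps -> exists N, forall m n, (N <= m)%N -> (N <= n)%N ->
       B (h m - h n) (h m - h n) <= eps) ->
    exists2 g, P g & forall eps : R, 0 < eps -> exists N, forall n, (N <= n)%N ->
       B (h n - g) (h n - g) <= eps }.

Hypothesis PB : preHilbert.

Let P0 := ph0 PB.
Let BC := phC PB.

Lemma phZ a x : P x -> P (a *: x).
Proof. by move=> Px; have := phL PB a Px P0; rewrite addr0. Qed.

Lemma phD x y : P x -> P y -> P (x + y).
Proof. by move=> Px Py; have := phL PB 1 Px Py; rewrite scale1r. Qed.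

Lemma phN x : P x -> P (- x).
Proof. by move=> Px; rewrite -scaleN1r; exact: phZ. Qed.

Lemma phS x y : P x -> P y -> P (x - y).
Proof. by move=> Px Py; apply: phD => //; exact: phN. Qed.

Lemma phDl x y z : P x -> P y -> P z -> B (x + y) z = B x z + B y z.
Proof. by move=> Px Py Pz; have := phB PB 1 Px Py Pz; rewrite scale1r mul1r. Qed.

Lemma ph0l z : P z -> B 0 z = 0.
Proof.
by move=> Pz; have := phDl P0 P0 Pz; rewrite addr0 -{1}[B 0 z]addr0 => /addrI/esym.
Qed.

Lemma phZl a x z : P x -> P z -> B (a *: x) z = a * B x z.
Proof. by move=> Px Pz; have := phB PB a Px P0 Pz; rewrite addr0 ph0l// addr0. Qed.

Lemma phNl x z : P x -> P z -> B (- x) z = - B x z.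
Proof. by move=> Px Pz; rewrite -scaleN1r phZl// mulN1r. Qed.

Lemma phSl x y z : P x -> P y -> P z -> B (x - y) z = B x z - B y z.
Proof. by move=> Px Py Pz; rewrite phDl ?phNl//; exact: phN. Qed.

Lemma phDr x y z : P x -> P y -> P z -> B z (x + y) = B z x + B z y.
Proof. by move=> Px Py Pz; rewrite BC ?phDl ?(BC Pz)//; exact: phD. Qed.

Lemma phSr x y z : P x -> P y -> P z -> B z (x - y) = B z x - B z y.
Proof. by move=> Px Py Pz; rewrite BC ?phSl ?(BC Pz)//; exact: phS. Qed.

Lemma phZr a x z : P x -> P z -> B z (a *: x) = a * B z x.
Proof. by move=> Px Pz; rewrite BC ?phZl ?(BC Pz)//; exact: phZ. Qed.

Lemma ph_sqrB x y : P x -> P y -> B (x - y) (x - y) = B x x - 2 * B x y + B y y.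
Proof.
move=> Px Py; have PN := phS Px Py.
by rewrite phSl// !phSr// (BC Py Px); ring.
Qed.

Lemma ph_sqrDZ t x y : P x -> P y ->
  B (x + t *: y) (x + t *: y) = B x x + 2 * t * B x y + t ^+ 2 * B y y.
Proof.
move=> Px Py; have Pt := phZ t Py; have PD := phD Px Pt.
by rewrite phDl// !phDr// !phZl// !phZr// (BC Py Px); ring.
Qed.

Lemma ph_CS x y : P x -> P y -> B x y ^+ 2 <= B x x * B y y.
Proof.
move=> Px Py.
have K t : 0 <= B x x + 2 * t * B x y + t ^+ 2 * B y y.
  by rewrite -ph_sqrDZ//; apply: (ph_ge0 PB); apply: phD => //; exact: phZ.
(* Semidefinite case: the polynomial in [t] is affine, and a nonzero slope would let it take the
   value [- 1]. *)
have [y0|y0] := eqVneq (B y y) 0.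
  have [xy0|xy0] := eqVneq (B x y) 0; first by rewrite xy0 y0 expr0n mulr0.
  have := K (- (B x x + 1) / (2 * B x y)).
  rewrite y0 mulr0 addr0.
  have -> : 2 * (- (B x x + 1) / (2 * B x y)) * B x y = - (B x x + 1) by field.
  by rewrite opprD addNKr oppr_ge0 ler10.
have yp : 0 < B y y by rewrite lt_def y0 (ph_ge0 PB).
have := K (- B x y / B y y).
have -> : B x x + 2 * (- B x y / B y y) * B x y + (- B x y / B y y) ^+ 2 * B y y =
  (B x x * B y y - B x y ^+ 2) / B y y by field.
by rewrite pmulr_lge0 ?invr_gt0// subr_ge0.
Qed.

(** The representative minimises [J h = B h h - 2 * l h]: the parallelogram identity makes
    minimising sequences Cauchy, and stationarity of the minimum in the direction [y] reads
    [l y = B g y]. *)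
Lemma ph_riesz (l : V -> R) (M : R) : 0 <= M ->
  (forall a x y, P x -> P y -> l (a *: x + y) = a * l x + l y) ->
  (forall x, P x -> l x ^+ 2 <= M * B x x) ->
  exists2 g, P g & forall y, P y -> l y = B g y.
Proof.
move=> M0 ll lM.
pose J h := B h h - 2 * l h.
have lD x y t : P x -> P y -> l (x + t *: y) = l x + t * l y.
  by move=> Px Py; rewrite addrC ll// addrC.
pose S := [set J h | h in P].
have JM h : P h -> - M <= J h.
  move=> Ph; rewrite /J.
  have b0 := ph_ge0 PB Ph; have lb := lM _ Ph.
  suff : `|2 * l h| <= M + B h h by rewrite ler_norml => /andP[_]; lra.
  rewrite -(@ler_pXn2r _ 2) ?nnegrE ?addr_ge0// real_normK ?num_real//.
  have := sqr_ge0 (M - B h h).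
  have -> : (M + B h h) ^+ 2 = (M - B h h) ^+ 2 + 4 * (M * B h h) by ring.
  have -> : (2 * l h) ^+ 2 = 4 * l h ^+ 2 by ring.
  by lra.
have Sinf : has_inf S.
  by split; [exists (J 0), 0|exists (- M) => _ [h Ph <-]; exact: JM].
pose m := inf S.
have mJ h : P h -> m <= J h by move=> Ph; apply: ge_inf; [case: Sinf|exists h].
have /choice[h hP] : forall n : nat, exists h, P h /\ J h < m + n.+1%:R^-1.
  move=> n; have n0 : 0 < n.+1%:R^-1 :> R by rewrite invr_gt0.
  have [_ [h Ph <-] hm] := inf_adherent n0 Sinf.
  by exists h.
have Ph n := (hP n).1.
(* [J] at the midpoint of [h i] and [h j] is at least [m]. *)
have Cau i j : B (h i - h j) (h i - h j) <= 2 * (i.+1%:R^-1 + j.+1%:R^-1).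
  have := mJ (2^-1 *: (h i + h j)) (phZ _ (phD (Ph i) (Ph j))).
  have := (hP i).2; have := (hP j).2; rewrite /J.
  have Pij := phD (Ph i) (Ph j).
  have PZ := phZ 2^-1 Pij.
  rewrite ph_sqrB// (phZl _ Pij PZ) (phZr _ Pij Pij).
  rewrite phDl// !phDr// (BC (Ph j) (Ph i)).
  have -> : l (2^-1 *: (h i + h j)) = 2^-1 * (l (h i) + l (h j)).
    have l0 : l 0 = 0.
      by have := ll 1 _ _ P0 P0; rewrite scale1r addr0 mul1r; lra.
    have := ll 2^-1 _ _ Pij P0; rewrite addr0 l0 addr0 => ->.
    by have := lD (h i) (h j) 1; rewrite scale1r mul1r => ->.
  move: (i.+1%:R^-1) (j.+1%:R^-1) (B (h i) (h i)) (B (h j) (h j)) (B (h i) (h j)) => ? ? ? ? ?.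
  by lra.
have inv_small (eps : R) : 0 < eps -> exists N : nat, forall n, (N <= n)%N -> n.+1%:R^-1 <= eps.
  move=> e0; have /cvgrPdist_le /(_ _ e0)[N _ HN] := cvg_harmonic (R := R).
  by exists N => n /HN; rewrite sub0r normrN /= ger0_norm// invr_ge0.
have [|g Pg gP] := ph_complete PB Ph.
  move=> eps e0; have [|N HN] := inv_small (eps / 4); first by rewrite divr_gt0.
  exists N => i j /HN iN /HN jN; apply: le_trans (Cau i j) _.
  by move: iN jN; move: (i.+1%:R^-1) (j.+1%:R^-1) => ? ?; lra.
exists g => // y Py; apply/eqP; rewrite -subr_eq0; apply/eqP.
(* The variation is made at [h n], where [J] is within [eps / 2] of its infimum, rather than at [g];
   [q] keeps the error of replacing [h n] by [g] in the linear term below [eps / 2]. *)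
have K t : 0 <= t ^+ 2 * B y y + 2 * t * (B g y - l y).
  apply/ler_addgt0Pl => eps e0.
  have [|N1 HN1] := inv_small (eps / 2); first by rewrite divr_gt0.
  set q := (eps / 2) / (2 * `|t| + 1).
  have q0 : 0 < q by rewrite divr_gt0 ?divr_gt0// ltr_wpDl// mulr_ge0.
  have By0 := ph_ge0 PB Py.
  have [|N2 HN2] := gP (q ^+ 2 / (B y y + 1)).
    by rewrite divr_gt0 ?exprn_gt0// ltr_wpDl.
  pose n := maxn N1 N2.
  have := mJ (h n + t *: y) (phD (Ph n) (phZ _ Py)).
  rewrite /J ph_sqrDZ// lD// => mJn.
  have : J (h n) <= m + eps / 2.
    by apply: ltW; apply: lt_le_trans (hP n).2 _; rewrite lerD2l HN1 ?leq_maxl.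
  rewrite /J => Jn.
  have hgq : `|B (h n - g) y| <= q.
    rewrite -(@ler_pXn2r _ 2) ?nnegrE ?(ltW q0)// real_normK ?num_real//.
    apply: le_trans (ph_CS (phS (Ph n) Pg) Py) _.
    apply: le_trans (ler_wpM2r By0 (HN2 n (leq_maxr _ _))) _.
    rewrite mulrAC ler_pdivrMr ?ltr_wpDl// ler_wpM2l ?sqr_ge0//.
    by rewrite lerDl.
  have : `|2 * t * B (h n - g) y| <= eps / 2.
    rewrite !normrM (ger0_norm (ler0n _ 2)).
    apply: le_trans (ler_wpM2l _ hgq) _; first by rewrite mulr_ge0.
    rewrite /q mulrCA ler_piMr ?divr_ge0 ?(ltW e0)//.
    by rewrite ler_pdivrMr ?ltr_wpDl ?mulr_ge0// mul1r lerDl.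
  rewrite phSl// ler_norml => /andP[_ ?].
  by lra.
set c := _ - l y in K *.
have {}K t : 0 <= t ^+ 2 * B y y + 2 * t * c by exact: K.
have By0 := ph_ge0 PB Py.
(* The [+ 1] keeps the denominator positive when [B y y = 0]. *)
have := K (- c / (B y y + 1)).
have y1 : B y y + 1 != 0 by rewrite gt_eqF// ltr_wpDl.
have -> : (- c / (B y y + 1)) ^+ 2 * B y y + 2 * (- c / (B y y + 1)) * c =
  - (c ^+ 2 * (B y y + 2) / (B y y + 1) ^+ 2) by field.
rewrite oppr_ge0 pmulr_lle0 ?invr_gt0 ?exprn_gt0 ?ltr_wpDl// pmulr_lle0 ?ltr_wpDl//.
move=> c2; have /eqP : c ^+ 2 = 0 by apply/eqP; rewrite eq_le c2 sqr_ge0.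
by rewrite sqrf_eq0 => /eqP c0; rewrite /c in c0; lra.
Qed.

Definition weakly_to (U : set_system nat) (x : nat -> V) (g : V) :=
  forall y, P y -> B (x n) y @[n --> U] --> B g y.

Lemma ph_CS_norm x y M : P x -> P y -> 0 <= M -> B x x * B y y <= M ^+ 2 ->
  `|B x y| <= M.
Proof.
move=> Px Py M0 H.
by rewrite -(@ler_pXn2r _ 2) ?nnegrE// real_normK ?num_real// (le_trans (ph_CS Px Py)).
Qed.

(** Along an ultrafilter the limits of [B (x n) y] exist for all [y] simultaneously; being linear
    and bounded in [y], they are represented by a vector. *)
Lemma ph_weak_limit (U : set_system nat) (x : nat -> V) (M : R) : UltraFilter U ->
  (forall n, P (x n)) -> (\forall n \near U, B (x n) (x n) <= M) ->
  exists2 g, P g & weakly_to U x g.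
Proof.
move=> UU Px xM.
have cv y : P y -> cvg (B (x n) y @[n --> U]).
  move=> Py; have [|l ?] := @ultra_cvg_bounded R U (fun n => B (x n) y) (M * B y y + 1) UU.
    apply: filterS xM => n xnM.
    have By0 := ph_ge0 PB Py; have Bx0 := ph_ge0 PB (Px n).
    have MB0 : 0 <= M * B y y by rewrite mulr_ge0// (le_trans Bx0).
    apply: ph_CS_norm => //; first by rewrite addr_ge0.
    apply: (@le_trans _ _ (M * B y y)); first by rewrite ler_wpM2r.
    by nra.
  by apply/cvg_ex; exists l.
pose l y := lim (B (x n) y @[n --> U]).
have M0 : 0 <= M.
  by have [n] := filter_ex xM; apply: le_trans; exact: (ph_ge0 PB).
have [a y z Py Pz|y Py|g Pg lg] := @ph_riesz l M M0.
- apply/cvg_lim => //.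
  rewrite (_ : (fun n => _) = (fun n => a * B (x n) y + B (x n) z)).
    apply: cvgD; last exact: cv.
    by apply: cvgM; [exact: cvg_cst|exact: cv].
  apply/funext => n; rewrite BC ?phB// ?(BC (Px n))//; exact: (phL PB).
- have By0 := ph_ge0 PB Py.
  have : B (x n) y ^+ 2 @[n --> U] --> l y ^+ 2.
    rewrite expr2 (_ : (fun n => _) = (fun n => B (x n) y * B (x n) y)).
      by apply: cvgM; exact: cv.
    by apply/funext => n; rewrite expr2.
  move=> sq; rewrite -(cvg_lim _ sq)//.
  apply: limr_le; first by apply/cvg_ex; eexists; exact: sq.
  apply: filterS xM => n xnM; apply: le_trans (ph_CS (Px n) Py) _.
  by rewrite ler_wpM2r.
- by exists g => // y Py; rewrite -lg//; exact: cv.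
Qed.

Variables (D : R -> V -> V) (e : V).

(** Abstracts [f |-> sqrt a * f (a y)] on square-integrable functions of the half line. [dl_asym]
    decouples profiles at orthogonal scales; continuity in the scale is asked at [e] only, the one
    vector against which concentration is measured. *)
Record dilation : Prop := Dilation {
  dlP : forall a x, 0 < a -> P x -> P (D a x);
  dlL : forall a c x y, 0 < a -> P x -> P y -> D a (c *: x + y) = c *: D a x + D a y;
  dlB : forall a x y, 0 < a -> P x -> P y -> B (D a x) (D a y) = B x y;
  dlM : forall a b x, 0 < a -> 0 < b -> P x -> D a (D b x) = D (a * b) x;
  dl1 : forall x, P x -> D 1 x = x;
  dl_asym : forall f h (eps : R), P f -> P h -> 0 < eps -> exists K : R, forall a, 0 < a ->
    K <= `|ln a| -> `|B (D a f) h| <= eps;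
  dl_cont : forall (eps : R), 0 < eps -> exists2 del : R, 0 < del & forall a, 0 < a ->
    `|ln a| <= del -> B (D a e - e) (D a e - e) <= eps;
  dl_e : P e;
  dl_e1 : B e e <= 1 }.

Hypothesis DP : dilation.

Let Pe := dl_e DP.

Lemma dlS a x y : 0 < a -> P x -> P y -> D a (x - y) = D a x - D a y.
Proof.
move=> a0 Px Py; rewrite addrC -scaleN1r (dlL DP)// scaleN1r addrC.
by [].
Qed.

Lemma dl_adj a x y : 0 < a -> P x -> P y -> B x (D a^-1 y) = B (D a x) y.
Proof.
move=> a0 Px Py; have a'0 : 0 < a^-1 by rewrite invr_gt0.
rewrite -[LHS](dlB DP a0)//; last exact: (dlP DP).
by rewrite (dlM DP)// divff ?gt_eqF// (dl1 DP).
Qed.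

Definition scale_along (U : set_system nat) (a : nat -> R) :=
  (forall n, 0 < a n) /\ a n @[n --> U] --> +oo.

Definition concentrates (U : set_system nat) (rho : nat -> V) (eps : R) :=
  exists2 a, scale_along U a &
    \forall n \near U, eps <= `|B (D (a n) (rho n)) e|.

(** * Greedy extraction of scales and profiles along an ultrafilter *)

Section Greedy.
Variables (U : set_system nat) (UU : UltraFilter U) (oU : \oo `<=` U).

(** Invariant of the extraction: [rho] is the current remainder, [E] its limiting energy, and [S]
    the set of scales already used, at which nothing is left in the weak limit. The common bound
    [dom] of these scales allows a new orthogonal one to be written down. *)
Record admissible (rho : nat -> V) (S : set (nat -> R)) (dom : nat -> R) (E : R) :
    Prop := Admissible {
  admP : forall n, P (rho n);
  admE : B (rho n) (rho n) @[n --> U] --> E;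
  adm_scale : forall a, S a -> scale_along U a;
  adm_weak : forall a, S a -> weakly_to U (fun n => D (a n) (rho n)) 0;
  adm_dom : forall a, S a -> forall n, a n <= dom n }.

Lemma adm_bounded rho S dom E : admissible rho S dom E ->
  \forall n \near U, B (rho n) (rho n) <= E + 1.
Proof.
move=> H; have := admE H; move/cvgrPdist_le => /(_ 1 ltr01).
by apply: filterS => n; rewrite ler_norml => /andP[]; lra.
Qed.

Lemma adm_ge0 rho S dom E : admissible rho S dom E -> 0 <= E.
Proof.
move=> H; rewrite -(cvg_lim _ (admE H))//; apply: limr_ge.
  by apply/cvg_ex; exists E; exact: admE H.
by apply: nearW => n; apply: (ph_ge0 PB); exact: (admP H).
Qed.

(** If [ln (a n / b n)] did not escape to infinity, it would be bounded along [U] and converge to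
    some [lam]. Then [D (b n / a n) e] is close to the fixed vector [D (expR lam)^-1 e], against
    which [D (b n) (rho n)] tends to 0, contrary to the lower bound [c]. *)
Lemma adm_orthogonal rho S dom E a b c : admissible rho S dom E -> S b ->
  scale_along U a -> 0 < c -> (\forall n \near U, c <= `|B (D (a n) (rho n)) e|) ->
  `|ln (a n / b n)| @[n --> U] --> +oo.
Proof.
move=> H Sb [a0 _] c0 ca; have [b0 _] := adm_scale H Sb.
have Prho := admP H; have E0 := adm_ge0 H.
apply/cvgryPge => K; apply: contrapT => nK.
have {}nK : \forall n \near U, `|ln (a n / b n)| <= K.
  have [//|] := in_ultra_setVsetC [set n | K <= `|ln (a n / b n)|] UU.
  by apply: filterS => n /= /negP; rewrite -ltNge => /ltW.
have [lam clam] := ultra_cvg_bounded UU nK.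
(* With the energy at most [E + 1], Cauchy-Schwarz turns [eta] into an error of at most [c / 4]; the
   weak limit costs another [c / 4]. *)
pose eta := (c / 4) ^+ 2 / (E + 1).
have c40 : 0 < c / 4 by rewrite divr_gt0.
have eta0 : 0 < eta by rewrite divr_gt0 ?exprn_gt0// ltr_wpDl.
have [del del0 delP] := dl_cont DP eta0.
have bet0 : 0 < (expR lam)^-1 by rewrite invr_gt0 expR_gt0.
have Pbe : P (D (expR lam)^-1 e) by exact: (dlP DP).
have F1 : \forall n \near U, `|B (D (b n) (rho n)) (D (expR lam)^-1 e)| <= c / 4.
  have := adm_weak H Sb Pbe; rewrite ph0l// => /cvgrPdist_le /(_ _ c40).
  by apply: filterS => n; rewrite sub0r normrN.
have F2 : \forall n \near U, `|lam - ln (a n / b n)| <= del.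
  by move/cvgrPdist_le : clam => /(_ _ del0).
have : \forall n \near U, False; last by move=> /filter_ex[].
near=> n.
have ba0 : 0 < b n / a n by rewrite divr_gt0.
have K1 : B (D (a n) (rho n)) e = B (D (b n) (rho n)) (D (b n / a n) e).
  rewrite -(dlB DP ba0)//; last exact: (dlP DP).
  by rewrite (dlM DP)// divfK// gt_eqF.
have Pba : P (D (b n / a n) e) by exact: (dlP DP).
have Pbr : P (D (b n) (rho n)) by exact: (dlP DP).
have K2 : B (D (b n / a n) e - D (expR lam)^-1 e)
            (D (b n / a n) e - D (expR lam)^-1 e) <= eta.
  have l0 : 0 < expR lam by rewrite expR_gt0.
  rewrite -(dlB DP l0) ?dlS//; [|exact: phS..].
  rewrite !(dlM DP)// divff ?gt_eqF// (dl1 DP)//.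
  apply: delP; first by rewrite mulr_gt0.
  rewrite lnM ?posrE// expRK -(invrK (b n / a n)) invf_div lnV ?posrE ?divr_gt0//.
  by near: n.
have K3 : `|B (D (b n) (rho n)) (D (b n / a n) e - D (expR lam)^-1 e)| <= c / 4.
  apply: ph_CS_norm => //; [exact: phS|exact: ltW|].
  rewrite (dlB DP)//; apply: (@le_trans _ _ ((E + 1) * eta)); last first.
    by rewrite /eta mulrC divfK// gt_eqF// ltr_wpDl.
  apply: ler_pM => //; [exact: (ph_ge0 PB)|by apply: (ph_ge0 PB); exact: phS|].
  by near: n; exact: adm_bounded H.
have : c <= `|B (D (a n) (rho n)) e| by near: n.
have : `|B (D (b n) (rho n)) (D (expR lam)^-1 e)| <= c / 4 by near: n.
rewrite K1; move: K3; rewrite phSr// => K3 K4.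
have := ler_normD (B (D (b n) (rho n)) (D (b n / a n) e) -
  B (D (b n) (rho n)) (D (expR lam)^-1 e)) (B (D (b n) (rho n)) (D (expR lam)^-1 e)).
by rewrite subrK; lra.
Unshelve. all: by end_near. Qed.

(** The levels at which [rho] concentrates are bounded by Cauchy-Schwarz. If some level is positive,
    the chosen [c] exceeds half their supremum, so that [2 * c] bounds all of them. *)
Lemma adm_choice rho S dom E : admissible rho S dom E ->
  exists (a : nat -> R) (c : R), [/\ scale_along U a,
    forall b, S b -> `|ln (a n / b n)| @[n --> U] --> +oo, 0 <= c,
    \forall n \near U, c <= `|B (D (a n) (rho n)) e| &
    forall eps, concentrates U rho eps -> eps <= 2 * c].
Proof.
move=> H; have Prho := admP H; have E0 := adm_ge0 H.
have [[eps0 [eps00 Heps0]]|nH] := pselect (exists eps, 0 < eps /\ concentrates U rho eps).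
  have hs : has_sup [set eps | concentrates U rho eps].
    split; first by exists eps0.
    exists (E + 1) => eps [a [a0 _] Ha].
    have [n [n1 n2]] := filter_ex (filterI Ha (adm_bounded H)).
    apply: le_trans n1 _; apply: ph_CS_norm => //; [exact: (dlP DP)|by rewrite addr_ge0|].
    rewrite (dlB DP)//; apply: (@le_trans _ _ ((E + 1) * 1)); last by nra.
    by apply: ler_pM => //; [exact: (ph_ge0 PB)|exact: (ph_ge0 PB)|exact: dl_e1 DP].
  have A0 : 0 < sup [set eps | concentrates U rho eps].
    by apply: lt_le_trans eps00 _; apply: ub_le_sup => //; case: hs.
  have [c [a sa Ha] hc] := sup_adherent (divr_gt0 A0 (ltr0n _ 2)) hs.
  have c0 : 0 < c by move: hc; set A := sup _ in A0 *; lra.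
  exists a, c; split => //.
  - by move=> b Sb; exact: (adm_orthogonal H Sb sa c0).
  - exact: ltW.
  - move=> eps Heps; have := ub_le_sup (proj2 hs) Heps.
    by move: hc; set A := sup _; lra.
(* Nothing concentrates, yet the list of scales must go on: this one outruns every used scale [b],
   as [a n / b n] is at least [n.+1]. *)
pose a n := n.+1%:R * (1 + `|dom n|).
have d0 n : 0 < 1 + `|dom n| by rewrite ltr_pwDl.
have a0 n : 0 < a n by rewrite mulr_gt0.
have an n : n.+1%:R <= a n by rewrite ler_peMr// lerDl.
have natU : n.+1%:R @[n --> U] --> (+oo : set_system R).
  apply/cvgryPge => K; apply: oU.
  near do (rewrite -natr1 ler_wpDr//).
  exact: nbhs_infty_ger.
exists a, 0; split => //.
- split=> //; apply/cvgryPge => K.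
  by move/cvgryPge : natU => /(_ K); apply: filterS => n /le_trans; exact.
- move=> b Sb; have [b0 _] := adm_scale H Sb.
  apply/cvgryPge => K.
  move/cvgryPge : natU => /(_ (expR K)); apply: filterS => n Kn.
  apply: le_trans (ler_norm _).
  rewrite -[K]expRK ler_ln ?posrE ?expR_gt0 ?divr_gt0//.
  apply: le_trans Kn _; rewrite ler_pdivlMr// ler_wpM2l//.
  by apply: le_trans (adm_dom H Sb n) _; rewrite (le_trans (ler_norm _))// lerDr.
- by apply: nearW => n; exact: normr_ge0.
- move=> eps Heps; rewrite mulr0 leNgt; apply/negP => eps0.
  by apply: nH; exists eps.
Unshelve. all: by end_near. Qed.

(** The limiting energy drops by [B G G], because the cross term converges to [2 * B G G]. Since
    [B e e <= 1], [B G G] is at least the square of [B G e], hence at least [c ^ 2], which by the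
    choice of [c] bounds the concentration of the remainder before the subtraction. *)
Lemma greedy_step rho S dom E : admissible rho S dom E ->
  exists a G, [/\ P G, scale_along U a,
    forall b, S b -> `|ln (a n / b n)| @[n --> U] --> +oo,
    admissible (fun n => rho n - D (a n)^-1 G) (S `|` [set a])
      (fun n => `|dom n| + a n) (E - B G G) &
    forall eps : R, 0 <= eps -> concentrates U rho eps -> eps ^+ 2 <= 4 * B G G].
Proof.
move=> H; have Prho := admP H.
have [a [c [sa oa c0 ca Hc]]] := adm_choice H.
have [a0 aoo] := sa; have a'0 n : 0 < (a n)^-1 by rewrite invr_gt0.
have PDr n : P (D (a n) (rho n)) by exact: (dlP DP).
have [|G PG GP] := @ph_weak_limit U (fun n => D (a n) (rho n)) (E + 1) UU PDr.
  by apply: filterS (adm_bounded H) => n; rewrite (dlB DP).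
exists a, G; split => //.
- split.
  + by move=> n; apply: phS => //; exact: (dlP DP).
  + rewrite (_ : (fun n => _) = fun n => B (rho n) (rho n)
      - 2 * B (D (a n) (rho n)) G + B G G); last first.
      apply/funext => n; rewrite ph_sqrB//; last exact: (dlP DP).
      by rewrite dl_adj// (dlB DP).
    have -> : E - B G G = E - 2 * B G G + B G G by ring.
    apply: cvgD; last exact: cvg_cst.
    apply: cvgB; first exact: admE H.
    by apply: cvgM; [exact: cvg_cst|exact: GP].
  + by move=> b [/(adm_scale H)//|->].
  + move=> b Sb y Py; rewrite ph0l//.
    have b0 n : 0 < b n by case: Sb => [/(adm_scale H)[]//|->].
    rewrite (_ : (fun n => _) = fun n => B (D (b n) (rho n)) y - B (D (b n / a n) G) y).
      (* At the new scale the subtracted term is exactly the weak limit [G]; at an old scale both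
         terms vanish separately, the second by [dl_asym]. *)
      have [->|{}Sb] : b = a \/ S b by case: Sb; [right|left].
        rewrite -(subrr (B G y)); apply: cvgB; first exact: GP.
        rewrite (_ : (fun n => _) = cst (B G y)); first exact: cvg_cst.
        by apply/funext => n; rewrite divff ?gt_eqF// (dl1 DP).
      rewrite -[0](subrr 0); apply: cvgB.
        by rewrite -(ph0l Py); exact: (adm_weak H Sb).
      apply/cvgrPdist_le => eps eps0.
      have [K KP] := dl_asym DP PG Py eps0.
      move/cvgryPge : (oa _ Sb) => /(_ K); apply: filterS => n Kn.
      rewrite sub0r normrN; apply: KP; first exact: divr_gt0.
      by rewrite -invf_div lnV ?posrE ?divr_gt0// normrN.
    apply/funext => n; rewrite dlS//; last exact: (dlP DP).
    by rewrite (dlM DP)// phSl//; apply: (dlP DP) => //; exact: divr_gt0.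
  + move=> b [Sb|->] n; last by rewrite lerDr.
    by apply: le_trans (adm_dom H Sb n) _; rewrite (le_trans (ler_norm _))// lerDl ltW.
- move=> eps eps0 /Hc he.
  have cG : c ^+ 2 <= B G G.
    apply: (@le_trans _ _ (B G e ^+ 2)); last first.
      apply: le_trans (ph_CS PG Pe) _; apply: ler_piMr; first exact: (ph_ge0 PB).
      exact: dl_e1 DP.
    rewrite -[leRHS]real_normK ?num_real// ler_pXn2r ?nnegrE//.
    have cv : `|B (D (a n) (rho n)) e| @[n --> U] --> `|B G e| by apply: cvg_norm; exact: GP.
    by rewrite -(cvg_lim _ cv)//; apply: limr_ge => //; apply/cvg_ex; eexists; exact: cv.
  apply: (@le_trans _ _ ((2 * c) ^+ 2)).
    by rewrite ler_pXn2r ?nnegrE// mulr_ge0.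
  have -> : (2 * c) ^+ 2 = 4 * c ^+ 2 by ring.
  by rewrite ler_pM2l.
Qed.

(* The scale is chosen by a diagonal argument: [a n] realises the largest [k <= n]
   for which some [b >= k] violates the bound. *)
Lemma not_concentrates rho eps :
  ~ concentrates U rho eps -> exists S : R, \forall n \near U,
    forall a, 0 < a -> S <= a -> `|B (D a (rho n)) e| <= eps.
Proof.
move=> nc; apply: contrapT => nS; apply: nc.
pose T n := [set a : R | 0 < a /\ eps <= `|B (D a (rho n)) e|].
have ex n : exists a : R, 0 < a /\ forall k : nat, (k <= n)%N ->
    (exists2 b, T n b & k%:R <= b) -> T n a /\ k%:R <= a.
  suff K N : exists a : R, 0 < a /\ forall k : nat, (k <= N)%N ->
    (exists2 b, T n b & k%:R <= b) -> T n a /\ k%:R <= a by exact: K.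
  elim: N => [|N [a [a0 IH]]].
    have [[b [b0 Tb]]|nT] := pselect (exists b, T n b).
      by exists b; split=> // k; rewrite leqn0 => /eqP -> _; split=> //; exact: ltW.
    by exists 1; split=> // k _ [b Tb _]; exfalso; apply: nT; exists b.
  have [[b Tb Nb]|nT] := pselect (exists2 b, T n b & N.+1%:R <= b).
    exists b; split; first by case: Tb.
    move=> k kN _; split=> //; apply: le_trans Nb; by rewrite ler_nat.
  exists a; split=> // k; rewrite leq_eqVlt => /predU1P[-> //|]; exact: IH.
have /choice[a aP] := ex.
(* If this failed for some [k], then [k] itself would be the threshold [S]. *)
have UT (k : nat) : \forall n \near U, exists2 b, T n b & k%:R <= b.
  have [//|nT] := in_ultra_setVsetC [set n | exists2 b, T n b & k%:R <= b] UU.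
  exfalso; apply: nS; exists k%:R; apply: filterS nT => n /= nT b b0 kb.
  by rewrite leNgt; apply/negP => /ltW ?; apply: nT; exists b.
have Uk (k : nat) : \forall n \near U, T n (a n) /\ k%:R <= a n.
  have Ukn : \forall n \near U, (k <= n)%N by apply: oU; exists k.
  by apply: filterS (filterI Ukn (UT k)) => n [kn] /((aP n).2 _ kn).
exists a; last by apply: filterS (Uk 0%N) => n [[]].
split; first by move=> n; case: (aP n).
apply/cvgryPge => K; have [k Kk] : exists k : nat, K <= k%:R.
  by exists (Num.truncn `|K|).+1; rewrite (le_trans (ler_norm _))// ltW// truncnS_gt.
by apply: filterS (Uk k) => n [_]; apply: le_trans.
Qed.

End Greedy.

(** The greedy step is iterated on states that carry the whole invariant, along one ultrafilter
    fixed beforehand. *)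
Lemma admissible_profiles (x : nat -> V) (M : R) :
  (forall n, P (x n)) -> (forall n, B (x n) (x n) <= M) ->
  exists (U : set_system nat) (a : nat -> nat -> R) (G : nat -> V) (E : R),
    let rho l n := x n - \sum_(j < l) D (a j n)^-1 (G j) in
    [/\ UltraFilter U /\ \oo `<=` U, forall j, P (G j), forall j, scale_along U (a j),
      forall j k, (j < k)%N -> `|ln (a k n / a j n)| @[n --> U] --> +oo &
      [/\ B (x n) (x n) @[n --> U] --> E,
      forall l, B (rho l n) (rho l n) @[n --> U] --> E - \sum_(j < l) B (G j) (G j),
      forall l, 0 <= E - \sum_(j < l) B (G j) (G j) &
      forall l (eps : R), 0 <= eps -> concentrates U (rho l) eps ->
        eps ^+ 2 <= 4 * B (G l) (G l)]].
Proof.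
move=> Px xM.
have [U [UU oU]] := ultraFilterLemma (fmap_proper_filter id eventually_filter).
have [|E cvE] := @ultra_cvg_bounded R U (fun n => B (x n) (x n)) M UU.
  by apply: nearW => n; rewrite ger0_norm//; exact: (ph_ge0 PB).
pose st := ((nat -> V) * set (nat -> R) * (nat -> R) * R)%type.
pose ok (s : st) := let: (rho, Sc, dom, F) := s in admissible U rho Sc dom F.
have ok0 : ok (x, set0, (fun=> 0), E) by split.
pose nxt (s : st) (aG : (nat -> R) * V) : st := let: (rho, Sc, dom, F) := s in
  (fun n => rho n - D (aG.1 n)^-1 aG.2, Sc `|` [set aG.1],
   fun n => `|dom n| + aG.1 n, F - B aG.2 aG.2).
pose good (s : st) (aG : (nat -> R) * V) : Prop := let: (rho, Sc, dom, F) := s in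
  [/\ P aG.2, scale_along U aG.1,
    forall b, Sc b -> `|ln (aG.1 n / b n)| @[n --> U] --> +oo,
    ok (nxt s aG) &
    forall eps : R, 0 <= eps -> concentrates U rho eps -> eps ^+ 2 <= 4 * B aG.2 aG.2].
(* Choice needs a value at every state; the one at states that are not [ok] is never reached. *)
have step (s : st) : exists aG, ok s -> good s aG.
  have [oks|nok] := pselect (ok s); last by exists ((fun=> 0), 0) => /nok.
  move: s oks => [[[rho Sc] dom] F] oks.
  by have [a [G H]] := greedy_step UU oU oks; exists (a, G) => _.
have /choice[f fP] := step.
pose s := fix s n := if n is n'.+1 then nxt (s n') (f (s n')) else (x, set0, (fun=> 0), E).
have oks n : ok (s n).
  elim: n => [//|n IH]; rewrite [s n.+1]/=.
  by have := fP _ IH; case: (s n) IH => [[[rho Sc] dom] F] _ [].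
pose a j := (f (s j)).1; pose G j := (f (s j)).2.
have gd j : good (s j) (a j, G j).
  by rewrite /a /G -surjective_pairing; exact: fP.
have rhoE l : (s l).1.1.1 = (fun n => x n - \sum_(j < l) D (a j n)^-1 (G j)).
  elim: l => [|l IH]; first by apply/funext => n; rewrite big_ord0 subr0.
  have : (s l.+1).1.1.1 = fun n => (s l).1.1.1 n - D (a l n)^-1 (G l).
    by rewrite /a /G [s l.+1]/=; case: (s l) => [[[rho Sc] dom] F].
  rewrite IH => ->.
  by apply/funext => n; rewrite big_ord_recr/= opprD addrA.
have EE l : (s l).2 = E - \sum_(j < l) B (G j) (G j).
  elim: l => [|l IH]; first by rewrite big_ord0 subr0.
  have : (s l.+1).2 = (s l).2 - B (G l) (G l).
    by rewrite /G [s l.+1]/=; case: (s l) => [[[rho Sc] dom] F].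
  by rewrite IH => ->; rewrite big_ord_recr/= opprD addrA.
have SE j k : (j < k)%N -> (s k).1.1.2 (a j).
  elim: k => [//|k IH].
  have -> : (s k.+1).1.1.2 = (s k).1.1.2 `|` [set a k].
    by rewrite /a [s k.+1]/=; case: (s k) => [[[rho Sc] dom] F].
  by rewrite ltnS leq_eqVlt => /predU1P[->|/IH]; [right|left].
exists U, a, G, E; split => //.
- by move=> j; have := gd j; case: (s j) => [[[rho Sc] dom] F] [].
- by move=> j; have := gd j; case: (s j) => [[[rho Sc] dom] F] [].
- move=> j k jk; have := gd k; have := SE _ _ jk.
  by case: (s k) => [[[rho Sc] dom] F] /= Sj [_ _ + _ _]; exact.
split => //.
- move=> l; rewrite -EE; have := oks l; have := rhoE l.
  by case: (s l) => [[[rho Sc] dom] F] /= -> /admE.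
- move=> l; rewrite -EE; have := oks l.
  by case: (s l) => [[[rho Sc] dom] F] /adm_ge0; exact.
- move=> l eps eps0; have := rhoE l; have := gd l.
  by case: (s l) => [[[rho Sc] dom] F] /= [_ _ _ _ H] <-; exact: H.
Qed.

(* The properties hold along an ultrafilter; being countably many, encoded by
   [pickle], they hold along one subsequence. *)
Theorem profile_decomposition (x : nat -> V) (M : R) :
  (forall n, P (x n)) -> (forall n, B (x n) (x n) <= M) ->
  exists (a : nat -> nat -> R) (G : nat -> V) (s : nat -> nat),
    let rho l n := x n - \sum_(j < l) D (a j n)^-1 (G j) in
    [/\ {homo s : m n / (m < n)%N}, forall j, P (G j),
      (forall j n, 0 < a j n) /\ forall j, a j (s n) @[n --> \oo] --> +oo,
      forall j k, (j < k)%N -> `|ln (a k (s n) / a j (s n))| @[n --> \oo] --> +oo &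
      (forall l, B (x (s n)) (x (s n)) - \sum_(j < l) B (G j) (G j) -
        B (rho l (s n)) (rho l (s n)) @[n --> \oo] --> 0) /\
      forall eps : R, 0 < eps -> exists L, forall l, (L <= l)%N -> exists (S : R) N,
        forall n b, (N <= n)%N -> 0 < b -> S <= b ->
          `|B (D b (rho l (s n))) e| <= eps].
Proof.
move=> Px xM.
have [U [a [G [E]]]] := admissible_profiles Px xM.
set rho := fun l n => _; move=> /= [[UU oU] PG sa oa [cvE cvr Bess conc]].
have nearnat (f : nat -> R) : f n @[n --> U] --> +oo ->
  forall k : nat, U [set n | k%:R <= f n].
  by move=> /cvgryPge fU k; exact: fU.
have A1 (p : nat * nat) := nearnat _ (sa p.1).2 p.2.
have A2 (p : nat * nat * nat) :
    U [set n | (p.1.1 < p.1.2)%N -> p.2%:R <= `|ln (a p.1.2 n / a p.1.1 n)|].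
  have [jk|jk] := ltnP p.1.1 p.1.2; last by apply: filterS filterT => n.
  by apply: filterS (nearnat _ (oa _ _ jk) p.2) => n ? _.
have A3 (p : nat * nat) : U [set n | `|B (x n) (x n) - \sum_(j < p.1) B (G j) (G j) -
    B (rho p.1 n) (rho p.1 n)| <= p.2.+1%:R^-1].
  have : B (x n) (x n) - \sum_(j < p.1) B (G j) (G j) - B (rho p.1 n) (rho p.1 n)
      @[n --> U] --> (0 : R).
    rewrite -[in X in _ --> X](subrr (E - \sum_(j < p.1) B (G j) (G j))).
    by apply: cvgB => //; apply: cvgB => //; exact: cvg_cst.
  move=> /cvgrPdist_le /(_ p.2.+1%:R^-1); rewrite invr_gt0 ltr0Sn => /(_ isT).
  by apply: filterS => n; rewrite sub0r normrN.
(* Written as an implication, so that the set belongs to [U] for every pair, whether or not the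
   remainder concentrates; the threshold [S] depends on the pair only. *)
have A4 (p : nat * nat) : exists S : R, U [set n |
    ~ concentrates U (rho p.1) p.2.+1%:R^-1 -> forall b : R, 0 < b -> S <= b ->
    `|B (D b (rho p.1 n)) e| <= p.2.+1%:R^-1].
  have [c|nc] := pselect (concentrates U (rho p.1) p.2.+1%:R^-1).
    by exists 0; apply: filterS filterT => n _ /(_ c).
  have [S SP] := not_concentrates UU oU nc.
  by exists S; apply: filterS SP => n ? _.
have /choice[S A4'] := A4.
pose fam (i : nat) : set nat := if unpickle i is Some q then
  match q : ((nat * nat) + (nat * nat * nat)) + ((nat * nat) + (nat * nat)) with
  | inl (inl p) => [set n | p.2%:R <= a p.1 n]
  | inl (inr p) => [set n | (p.1.1 < p.1.2)%N -> p.2%:R <= `|ln (a p.1.2 n / a p.1.1 n)|]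
  | inr (inl p) => [set n | `|B (x n) (x n) - \sum_(j < p.1) B (G j) (G j) -
      B (rho p.1 n) (rho p.1 n)| <= p.2.+1%:R^-1]
  | inr (inr p) => [set n | ~ concentrates U (rho p.1) p.2.+1%:R^-1 ->
      forall b : R, 0 < b -> S p <= b -> `|B (D b (rho p.1 n)) e| <= p.2.+1%:R^-1]
  end else setT.
have famU i : U (fam i).
  rewrite /fam; case: (unpickle i) => [[[p|p]|[p|p]]|]; last exact: filterT.
  - exact: A1.
  - exact: A2.
  - exact: A3.
  - exact: A4'.
have [s [s_mono sP]] := ultra_subsequence _ oU famU.
have famE q n : (pickle q <= n)%N -> fam (pickle q) (s n) by exact: sP.
have big_nat (K : R) : exists k : nat, K <= k%:R.
  by exists (Num.truncn `|K|).+1; rewrite (le_trans (ler_norm _))// ltW// truncnS_gt.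
have small_inv (eps : R) : 0 < eps -> exists k : nat, k.+1%:R^-1 <= eps.
  move=> e0; have [k Kk] := big_nat eps^-1; exists k.
  rewrite -[eps]invrK lef_pV2 ?posrE ?invr_gt0// (le_trans Kk)// ler_nat.
  by rewrite leqnSn.
exists a, G, s; split => //.
- split=> [j n|j]; first by case: (sa j).
  apply/cvgryPge => K; have [k Kk] := big_nat K.
  exists (pickle (inl (inl (j, k)) :
    ((nat * nat) + (nat * nat * nat)) + ((nat * nat) + (nat * nat)))) => // n /= /famE.
  by rewrite /fam pickleK /=; exact: le_trans.
- move=> j i ji; apply/cvgryPge => K; have [k Kk] := big_nat K.
  exists (pickle (inl (inr (j, i, k)) :
    ((nat * nat) + (nat * nat * nat)) + ((nat * nat) + (nat * nat)))) => // n /= /famE.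
  by rewrite /fam pickleK /= => /(_ ji); exact: le_trans.
split.
- move=> l; apply/cvgrPdist_le => eps eps0; have [k Kk] := small_inv _ eps0.
  exists (pickle (inr (inl (l, k)) :
    ((nat * nat) + (nat * nat * nat)) + ((nat * nat) + (nat * nat)))) => // n /= /famE.
  by rewrite /fam pickleK /= sub0r normrN => /le_trans; exact.
move=> eps eps0; have [k Kk] := small_inv _ eps0.
(* The remaining energy is nonnegative, so the [B (G l) (G l)] are summable and tend to 0; once
   below [(k.+1%:R^-1) ^ 2 / 4] they exclude concentration at level [k.+1%:R^-1]. *)
have sumU n : \sum_(j < n) B (G j) (G j) <= E by have := Bess n; rewrite subr_ge0.
have cvs : cvgn (series (fun j => B (G j) (G j))).
  apply: nondecreasing_is_cvgn.
    by apply: nondecreasing_series => i _ _; apply: (ph_ge0 PB); exact: PG.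
  by exists E => _ [n _ <-]; rewrite /series /= big_mkord.
have := cvg_series_cvg_0 cvs.
move=> /cvgrPdist_lt /(_ ((k.+1%:R^-1) ^+ 2 / 4)).
rewrite divr_gt0 ?exprn_gt0 ?invr_gt0// => /(_ isT)[L _ HL].
exists L => l Ll; exists (S (l, k)), (pickle (inr (inr (l, k)) :
    ((nat * nat) + (nat * nat * nat)) + ((nat * nat) + (nat * nat)))) => n b nk b0 Sb.
apply: le_trans Kk.
have := famE _ _ _ nk; rewrite /fam pickleK /=; apply => //.
move=> /conc; rewrite invr_ge0 ler0n => /(_ isT); apply/negP; rewrite -ltNge.
have := HL _ Ll; rewrite sub0r normrN ger0_norm; last by apply: (ph_ge0 PB); exact: PG.
by rewrite ltr_pdivlMr// mulrC.
Qed.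

End DilatedSpace.

(** * Square-integrable functions and dilations *)

Section Nonnegative.
Context d (T : measurableType d) (R : realType) (mu : {measure set T -> \bar R}).
Implicit Types f g : T -> R.

Lemma intZ (k : R) f : 0 <= k -> measurable_fun setT f -> (forall x, 0 <= f x) ->
  (\int[mu]_x (k * f x)%:E = k%:E * \int[mu]_x (f x)%:E)%E.
Proof.
move=> k0 mf f0; under eq_integral do rewrite EFinM.
by apply: ge0_integralZl_EFin => //; [move=> x _; rewrite lee_fin|exact/measurable_EFinP].
Qed.

Lemma intD f g : measurable_fun setT f -> measurable_fun setT g ->
  (forall x, 0 <= f x) -> (forall x, 0 <= g x) ->
  (\int[mu]_x (f x + g x)%:E = \int[mu]_x (f x)%:E + \int[mu]_x (g x)%:E)%E.
Proof.
move=> mf mg f0 g0; under eq_integral do rewrite EFinD.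
apply: ge0_integralD => //; try exact/measurable_EFinP;
  by move=> x _; rewrite lee_fin.
Qed.

Lemma int_le f g : measurable_fun setT f -> measurable_fun setT g ->
  (forall x, 0 <= f x) -> (forall x, f x <= g x) ->
  (\int[mu]_x (f x)%:E <= \int[mu]_x (g x)%:E)%E.
Proof.
move=> mf mg f0 fg; apply: ge0_le_integral => //; try exact/measurable_EFinP;
  by move=> x _; rewrite lee_fin.
Qed.

Lemma int_ae f g : measurable_fun setT f -> measurable_fun setT g ->
  (forall x, 0 <= f x) -> (forall x, 0 <= g x) -> {ae mu, forall x, f x = g x} ->
  (\int[mu]_x (f x)%:E = \int[mu]_x (g x)%:E)%E.
Proof.
move=> mf mg f0 g0 fg; apply: ge0_ae_eq_integral => //; try exact/measurable_EFinP;
  try by move=> x _; rewrite lee_fin.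
by apply: filterS fg => x ->.
Qed.

End Nonnegative.

Section L2.
Context d (T : measurableType d) (R : realType) (mu : {measure set T -> \bar R}).
Implicit Types f g h : T -> R.

Definition ip f g : R := \int[mu]_x (f x * g x).

Lemma Lfun2P f : f \in Lfun mu 2%:E <->
  measurable_fun setT f /\ (\int[mu]_x (f x ^+ 2)%:E < +oo)%E.
Proof.
split=> [f2|[mf f2]].
  split; first by move: f2; rewrite inE => /andP[]; rewrite inE.
  exact: (integrable_lty measurableT (Lfun2_integrable_sqr f2)).
rewrite inE; apply/andP; split; rewrite inE//= /finite_norm.
apply: (@lty_poweRy _ _ 2) => //; rewrite powR_Lnorm//.
apply: le_lt_trans f2; rewrite le_eqVlt; apply/orP; left; apply/eqP.
apply: eq_integral => x _ /=; congr EFin.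
by rewrite powR_mulrn// real_normK ?num_real.
Qed.

Lemma Lfun2_measurable f : f \in Lfun mu 2%:E -> measurable_fun setT f.
Proof. by move/Lfun2P => []. Qed.

Lemma L2_integrable_prod f g : f \in Lfun mu 2%:E -> g \in Lfun mu 2%:E ->
  mu.-integrable setT (fun x => (f x * g x)%:E).
Proof. by move=> f2 g2; apply/Lfun1_integrable; exact: Lfun2_mul_Lfun1. Qed.

Lemma L2_integral_sqr f : f \in Lfun mu 2%:E ->
  (\int[mu]_x (f x ^+ 2)%:E)%E = (ip f f)%:E.
Proof.
move=> f2; rewrite /ip /Rintegral fineK//.
by apply: integrable_fin_num => //; exact: L2_integrable_prod.
Qed.

Lemma L2norm_sqr f : f \in Lfun mu 2%:E -> L2norm mu f ^+ 2 = ip f f.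
Proof.
move=> f2; rewrite /L2norm -powR_mulrn ?fine_ge0 ?Lnorm_ge0//.
have : (('N[mu]_2%:E[EFin \o f]) `^ 2)%E = (ip f f)%:E.
  rewrite powR_Lnorm// -L2_integral_sqr//; apply: eq_integral => x _ /=; congr EFin.
  by rewrite powR_mulrn// real_normK ?num_real.
have : ('N[mu]_2%:E[EFin \o f] < +oo)%E.
  by move: f2; rewrite inE => /andP[_]; rewrite inE.
have := Lnorm_ge0 mu 2%:E (EFin \o f).
by case: ('N[mu]_2%:E[EFin \o f])%E => [r|//|//] _ _ /= [].
Qed.

Lemma L2_lin a f g : f \in Lfun mu 2%:E -> g \in Lfun mu 2%:E ->
  (fun x => a * f x + g x) \in Lfun mu 2%:E.
Proof.
move=> /Lfun2P[mf f2] /Lfun2P[mg g2]; apply/Lfun2P; split.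
  by apply: measurable_funD => //; exact: measurable_funM.
have mf2 := measurable_funX 2 mf; have mg2 := measurable_funX 2 mg.
apply: (@le_lt_trans _ _ (\int[mu]_x (2 * a ^+ 2 * (f x ^+ 2) + 2 * (g x ^+ 2))%:E)%E).
  apply: int_le => //.
  - by apply: measurable_funX; apply: measurable_funD => //; exact: measurable_funM.
  - by apply: measurable_funD; exact: measurable_funM.
  - by move=> x; exact: sqr_ge0.
  - by move=> x; have := sqr_ge0 (a * f x - g x); nra.
rewrite intD//; first last.
- by move=> x; rewrite mulr_ge0 ?sqr_ge0.
- by move=> x; apply: mulr_ge0; [apply: mulr_ge0 => //|]; exact: sqr_ge0.
- exact: measurable_funM.
- exact: measurable_funM.
have a2 : 0 <= 2 * a ^+ 2 by apply: mulr_ge0 => //; exact: sqr_ge0.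
rewrite !intZ//; try (by move=> x; exact: sqr_ge0).
by rewrite lte_add_pinfty// lte_mul_pinfty// lee_fin mulr_ge0 ?sqr_ge0.
Qed.

Lemma L2_0 : (fun=> 0) \in Lfun mu 2%:E.
Proof.
apply/Lfun2P; split; first exact: measurable_cst.
by under eq_integral do rewrite expr0n/=; rewrite integral0 ltry.
Qed.

Lemma L2_restrict (A : set T) f : measurable A -> f \in Lfun mu 2%:E ->
  (f \_ A) \in Lfun mu 2%:E.
Proof.
move=> mA /Lfun2P[mf f2]; apply/Lfun2P; split.
  by apply/measurable_restrict => //; rewrite setTI; exact: measurable_funTS.
apply: le_lt_trans f2; apply: int_le => //.
- apply: measurable_funX.
  by apply/measurable_restrict => //; rewrite setTI; exact: measurable_funTS.
- exact: measurable_funX.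
- by move=> x; exact: sqr_ge0.
- by move=> x; rewrite patchE; case: ifPn => // _; rewrite expr0n/= sqr_ge0.
Qed.

Lemma ipC f g : ip f g = ip g f.
Proof. by rewrite /ip; apply: eq_Rintegral => x _; rewrite mulrC. Qed.

Lemma ipl a f g h : f \in Lfun mu 2%:E -> g \in Lfun mu 2%:E -> h \in Lfun mu 2%:E ->
  ip (fun x => a * f x + g x) h = a * ip f h + ip g h.
Proof.
move=> f2 g2 h2; rewrite /ip.
under eq_Rintegral do rewrite mulrDl -mulrA.
have fh := L2_integrable_prod f2 h2.
rewrite RintegralD//; last exact: L2_integrable_prod.
  by rewrite RintegralZl.
by apply: eq_integrable (integrableZl measurableT a fh) => // x _; rewrite EFinM.
Qed.

Lemma ip_ge0 f : 0 <= ip f f.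
Proof. by apply: Rintegral_ge0 => x _; rewrite -expr2 sqr_ge0. Qed.

Lemma limn_einf_le (u : (\bar R)^nat) (l : \bar R) (N : nat) :
  (forall n, (N <= n)%N -> u n <= l)%E -> (limn_einf u <= l)%E.
Proof.
move=> ul; rewrite limn_einf_lim; apply: lime_le; first exact: is_cvg_einfs.
exists N => // n /= Nn; apply: (@le_trans _ _ (u n)); [apply: ereal_inf_lbound|exact: ul].
by exists n => /=.
Qed.

(** Riesz-Fischer. Along a subsequence the weighted squares of the increments have an integrable sum
    [F]; where it is finite the increments are at most [sqrt F / 2 ^ k], so the subsequence
    converges, and Fatou's lemma controls the distance to its limit. *)
Lemma L2_complete (h_ : nat -> T -> R) : (forall n, h_ n \in Lfun mu 2%:E) ->
  (forall eps : R, 0 < eps -> exists N, forall m n, (N <= m)%N -> (N <= n)%N ->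
     ip (fun x => h_ m x - h_ n x) (fun x => h_ m x - h_ n x) <= eps) ->
  exists2 g, g \in Lfun mu 2%:E & forall eps : R, 0 < eps -> exists N, forall n,
    (N <= n)%N -> ip (fun x => h_ n x - g x) (fun x => h_ n x - g x) <= eps.
Proof.
move=> h2 Cau.
have mh n : measurable_fun setT (h_ n) by exact: Lfun2_measurable.
have L2B f g : f \in Lfun mu 2%:E -> g \in Lfun mu 2%:E ->
    (fun x => f x - g x) \in Lfun mu 2%:E.
  move=> f2 g2; have := L2_lin (-1) g2 f2.
  by rewrite (_ : (fun x => _) = (fun x => f x - g x))//; apply/funext => x; ring.
(* With this tolerance [4 ^ k] times the squared increment has integral at most [2 ^ - (k + 1)]. *)
pose del k : R := (4 ^+ k * 2 ^+ k.+1)^-1.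
have del0 k : 0 < del k by rewrite invr_gt0 mulr_gt0// exprn_gt0.
have /choice[N NP] := fun k => Cau _ (del0 k).
pose s := fix s k := if k is k'.+1 then maxn (s k').+1 (N k) else N 0%N.
have sN k : (N k <= s k)%N by case: k => [//|k] /=; rewrite leq_maxr.
have ss k : (s k < s k.+1)%N by rewrite /= leq_maxl.
have sk k : (k <= s k)%N by elim: k => [//|k IH]; exact: leq_ltn_trans (ss k).
pose f k := h_ (s k).
pose w k x : \bar R := (4 ^+ k * (f k.+1 x - f k x) ^+ 2)%:E.
have mw k : measurable_fun setT (w k).
  apply/measurable_EFinP; apply: measurable_funM => //.
  by apply: measurable_funX; apply: measurable_funB; exact: mh.
have w0 k x : (0 <= w k x)%E by rewrite lee_fin mulr_ge0 ?sqr_ge0// exprn_ge0.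
pose F x := (\sum_(0 <= k <oo) w k x)%E.
have iF : (\int[mu]_x F x < +oo)%E.
  rewrite integral_nneseries//.
  apply: (@le_lt_trans _ _ (\sum_(0 <= k <oo) (1 / (2 ^ (k + 1))%:R)%:E)%E).
    apply: lee_nneseries => k _; first by move=> _; exact: integral_ge0.
    rewrite /w intZ ?exprn_ge0//; last first.
    - by move=> x; exact: sqr_ge0.
    - by apply: measurable_funX; apply: measurable_funB; exact: mh.
    rewrite L2_integral_sqr; last by apply: L2B; exact: h2.
    rewrite -EFinM lee_fin.
    have := NP k (s k.+1) (s k) (leq_trans (sN k) (ltnW (ss k))) (sN k).
    have p4 : 0 < 4 ^+ k :> R by rewrite exprn_gt0.
    move=> /(ler_wpM2l (ltW p4))/le_trans; apply.
    rewrite /del invfM mulrA divff ?gt_eqF// mul1r addn1 natrX.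
    by rewrite div1r.
  by rewrite (cvg_lim _ (@cvg_geometric_eseries_half R 1 0))// ltry.
have mF : measurable_fun setT F by apply: ge0_emeasurable_sum.
have F0 x : (0 <= F x)%E by apply: nneseries_ge0.
pose A := [set x | (F x < +oo)%E].
have mA : measurable A.
  by rewrite -[A]setTI; apply: emeasurable_fun_infty_o.
have aeA : {ae mu, forall x, A x}.
  have : mu.-integrable setT F.
    apply/integrableP; split=> //; apply: le_lt_trans iF.
    by under eq_integral do rewrite gee0_abs//.
  move=> /(integrable_ae measurableT); apply: filterS => x /(_ I).
  by rewrite ge0_fin_numE.
(* Cut to the set where [F] is finite, the subsequence converges at every point, which gives a
   measurable limit. *)
pose fA k x : R := (f k \_ A) x.
have mfA k : measurable_fun setT (fA k).
  by apply/measurable_restrict => //; rewrite setTI; apply: measurable_funTS; exact: mh.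
have cvA x : cvgn (fA ^~ x).
  rewrite /fA; have [Ax|nAx] := pselect (A x); last first.
    rewrite (_ : (fun _ => _) = fun=> 0); first exact: is_cvg_cst.
    by apply/funext => k; rewrite patchE memNset.
  rewrite (_ : (fun _ => _) = fun k => f k x); last first.
    by apply/funext => k; rewrite patchE mem_set.
  have Fx : F x = (fine (F x))%:E by rewrite fineK// ge0_fin_numE.
  set c := fine (F x) in Fx.
  have c0 : 0 <= c by rewrite fine_ge0.
  have dle k : `|f k.+1 x - f k x| <= geometric (Num.sqrt c) 2^-1 k.
    rewrite /geometric /= -(@ler_pXn2r _ 2) ?nnegrE// ?mulr_ge0 ?sqrtr_ge0 ?exprn_ge0//.
    rewrite real_normK ?num_real// exprMn sqr_sqrtr//.
    have : (w k x <= F x)%E.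
      have := nneseries_lim_ge k.+1 (fun n (_ : (0 <= n)%N) (_ : true) => w0 n x).
      rewrite big_nat_recr//=; apply: le_trans; rewrite leeDr//.
      by apply: sume_ge0.
    rewrite Fx lee_fin mulrC -ler_pdivlMr ?exprn_gt0// => /le_trans; apply.
    rewrite ler_wpM2l// -exprM mulnC exprM -exprVn.
    by have -> : (2^-1 ^+ 2 : R) = 4^-1 by [field].
  have : cvgn (series (fun k => f k.+1 x - f k x)).
    apply: normed_cvg.
    apply: (@series_le_cvg _ _ (geometric (Num.sqrt c) 2^-1)).
    - by move=> k; exact: normr_ge0.
    - by move=> k; rewrite /geometric /= mulr_ge0 ?sqrtr_ge0// exprn_ge0.
    - exact: dle.
    - by apply: is_cvg_geometric_series; rewrite ger0_norm// invf_lt1// ltr1n.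
  rewrite (_ : series _ = fun n => f n x - f 0%N x).
    move=> cv; rewrite (_ : (fun k => f k x) = fun k => (f k x - f 0%N x) + f 0%N x).
      by apply: is_cvgD => //; exact: is_cvg_cst.
    by apply/funext => k; rewrite subrK.
  by apply/funext => n; rewrite /series /= telescope_sumr.
pose g x := limn (fA ^~ x).
have cvg_g x : fA ^~ x @ \oo --> g x by exact: cvA.
have mg : measurable_fun setT g.
  by apply: (@measurable_fun_cvg _ _ _ _ fA) => // x _; exact: cvg_g.
have fAE k : ae_eq mu setT (fA k) (f k).
  by apply: filterS aeA => x Ax _; rewrite /fA patchE mem_set.
have key n (eps : R) (M : nat) :
    (forall m, (M <= m)%N -> ip (fun x => h_ n x - h_ m x) (fun x => h_ n x - h_ m x) <= eps) ->
    (\int[mu]_x ((h_ n x - g x) ^+ 2)%:E <= eps%:E)%E.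
  move=> H.
  pose q k x : \bar R := ((h_ n x - fA k x) ^+ 2)%:E.
  have mq k : measurable_fun setT (q k).
    apply/measurable_EFinP; apply: measurable_funX.
    by apply: measurable_funB => //; exact: mh.
  have qE : (\int[mu]_x ((h_ n x - g x) ^+ 2)%:E = \int[mu]_x limn_einf (q ^~ x))%E.
    apply: eq_integral => x _; apply/esym.
    have cq : q ^~ x @ \oo --> ((h_ n x - g x) ^+ 2)%:E.
      apply/fine_cvgP; split; first by apply: nearW.
      rewrite /comp /= expr2 (_ : (fun _ => _) = fun k => (h_ n x - fA k x) * (h_ n x - fA k x)).
        by apply: cvgM; apply: cvgB => //; exact: cvg_cst.
      by apply/funext => k; rewrite /= expr2.
    by have [-> _] := cvg_limn_einf_sup cq.
  have q0 k x : setT x -> (0 <= q k x)%E by rewrite lee_fin sqr_ge0.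
  rewrite qE; apply: le_trans (fatou mu measurableT mq q0) _.
  apply: (@limn_einf_le _ _ M) => k Mk.
  rewrite (_ : integral _ _ _ = \int[mu]_x ((h_ n x - f k x) ^+ 2)%:E)%E; last first.
    apply: int_ae.
    - by apply: measurable_funX; apply: measurable_funB => //; exact: mh.
    - by apply: measurable_funX; apply: measurable_funB; exact: mh.
    - by move=> x; exact: sqr_ge0.
    - by move=> x; exact: sqr_ge0.
    - by apply: filterS (fAE k) => x ->.
  rewrite L2_integral_sqr; last by apply: L2B; exact: h2.
  by rewrite lee_fin; apply: H; rewrite (leq_trans Mk).
have g2 : g \in Lfun mu 2%:E.
  have [M MP] := Cau 1 ltr01.
  have hg : (fun x => h_ M x - g x) \in Lfun mu 2%:E.
    apply/Lfun2P; split; first by apply: measurable_funB => //; exact: mh.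
    by apply: le_lt_trans (key M 1 M _) (ltry _) => m Mm; exact: MP.
  have := L2B _ _ (h2 M) hg.
  by rewrite (_ : (fun x => _ - _) = g)//; apply/funext => x; ring.
exists g => // eps eps0; have [M MP] := Cau eps eps0.
exists M => n Mn; rewrite -lee_fin -L2_integral_sqr; last exact: L2B.
by apply: (key _ _ M) => m Mm; exact: MP.
Qed.

(** The vanishing outside [A] is required at every point, not almost everywhere; [R^o] supplies the
    module structure expected by [preHilbert]. *)
Definition L2on (A : set T) : set (T -> R^o) :=
  [set f | f \in Lfun mu 2%:E /\ forall x, ~ A x -> f x = 0].

Lemma L2on_preHilbert (A : set T) : measurable A -> preHilbert (L2on A) ip.
Proof.
move=> mA; split.
- by split; [exact: L2_0|].
- move=> a f g [f2 f0] [g2 g0]; split; first exact: L2_lin.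
  move=> x nAx; change (a * f x + g x = 0).
  by rewrite f0// g0// mulr0 addr0.
- by move=> f g _ _; exact: ipC.
- by move=> a f g h [f2 _] [g2 _] [h2 _]; exact: ipl.
- by move=> f _; exact: ip_ge0.
- move=> h_ Ph Cau.
  have [|g g2 gP] := @L2_complete h_ _ Cau; first by move=> n; case: (Ph n).
  (* The limit is cut to [A], outside which every [h_ n] vanishes; this does not increase the
     distances. *)
  exists (g \_ A : T -> R^o).
    split; first exact: L2_restrict.
    by move=> x nAx; rewrite patchE memNset.
  move=> eps /gP[N NP]; exists N => n /NP; apply: le_trans.
  have [h2 h0] := Ph n.
  have L2B f : f \in Lfun mu 2%:E -> (fun x => h_ n x - f x) \in Lfun mu 2%:E.
    move=> f2; have := L2_lin (-1) f2 h2.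
    by rewrite (_ : (fun x => _) = (fun x => h_ n x - f x))//; apply/funext => x; ring.
  rewrite -lee_fin -!L2_integral_sqr; [|exact: L2B|by apply: L2B; exact: L2_restrict].
  apply: int_le => //.
  - by apply: measurable_funX; apply: Lfun2_measurable; apply: L2B; exact: L2_restrict.
  - by apply: measurable_funX; apply: Lfun2_measurable; exact: L2B.
  - by move=> x; exact: sqr_ge0.
  - move=> x; rewrite [(h_ n - _) x]/(h_ n x - (g \_ A) x) patchE.
    case: ifPn => // /negP nAx.
    change ((h_ n x - (0 : R)) ^+ 2 <= (h_ n x - g x) ^+ 2).
    by rewrite h0 ?subrr ?expr0n/= ?sqr_ge0// => Ax; apply: nAx; rewrite inE.
Qed.

End L2.

(** * Change of variables in integrals *)

Section RealIntegrals.
Context d (T : measurableType d) {R : realType} (mu : {measure set T -> \bar R}).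

Lemma RintE (f : T -> R) : mu.-integrable setT (EFin \o f) ->
  \int[mu]_x f x = fine (\int[mu]_x ((f^\+ x)%R)%:E) - fine (\int[mu]_x ((f^\- x)%R)%:E).
Proof.
move=> intf; rewrite /Rintegral integralE fineB.
- congr (fine _ - fine _); apply: eq_integral => x _.
  + by have -> := congr1 (@^~ x) (funerpos f).
  + by have -> := congr1 (@^~ x) (funerneg f).
- by apply: integrable_pos_fin_num.
- by apply: integrable_neg_fin_num.
Qed.
End RealIntegrals.

Section ChangeOfVariables.
Context d1 d2 (X : measurableType d1) (Y : measurableType d2) {R : realType}.
Variables (mu : {measure set X -> \bar R}) (nu : {measure set Y -> \bar R}).
Variables (phi : X -> Y) (k : R).
Hypotheses (mphi : measurable_fun setT phi) (k0 : 0 < k).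
Hypothesis nuE : forall A, measurable A -> nu A = (k%:E * mu (phi @^-1` A))%E.

Lemma ge0_integral_map (f : Y -> R) :
  measurable_fun setT f -> (forall x, 0 <= f x) ->
  (\int[nu]_y (f y)%:E = k%:E * \int[mu]_x (f (phi x))%:E)%E.
Proof.
move=> mf f0.
pose pf := measure_function_pushforward__canonical__measure_function_Measure mu mphi.
transitivity (\int[mscale (NngNum (ltW k0)) pf]_x (f x)%:E)%E.
  by apply: eq_measure_integral => A mA _; rewrite nuE.
rewrite ge0_integral_mscale//=; [|exact/measurable_EFinP|by move=> x _; rewrite lee_fin].
rewrite ge0_integral_pushforward//; [exact/measurable_EFinP|].
by move=> x _; rewrite lee_fin.
Qed.

Lemma integrable_map (f : Y -> R) : measurable_fun setT f ->
  nu.-integrable setT (EFin \o f) <-> mu.-integrable setT (EFin \o (f \o phi)).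
Proof.
move=> mf; have mfp : measurable_fun setT (f \o phi) by exact: measurableT_comp.
have mn : measurable_fun setT (fun x => `|f x|) by exact: measurableT_comp.
have E : (\int[nu]_y (`|f y|)%:E = k%:E * \int[mu]_x (`|f (phi x)|)%:E)%E.
  by apply: (ge0_integral_map mn) => x; exact: normr_ge0.
split=> /integrableP[_ i]; apply/integrableP; split; try exact/measurable_EFinP.
  move: i; rewrite /= E; apply: contraPT; rewrite -leNgt leye_eq => /eqP ->.
  by rewrite gt0_muley// ?lte_fin// ltxx.
by rewrite /= E lte_mul_pinfty// lee_fin ltW.
Qed.

Lemma Rintegral_map (f : Y -> R) : measurable_fun setT f ->
  nu.-integrable setT (EFin \o f) -> \int[nu]_y f y = k * \int[mu]_x f (phi x).
Proof.
move=> mf i; have i' := (integrable_map mf).1 i.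
have mp : measurable_fun [set: Y] (f^\+)%R by exact: measurable_funrpos.
have mn : measurable_fun [set: Y] (f^\-)%R by exact: measurable_funrneg.
rewrite RintE// [in RHS]RintE// (ge0_integral_map mp (funrpos_ge0 f)).
rewrite (ge0_integral_map mn (funrneg_ge0 f)) mulrBr !fineM//.
- rewrite (_ : integral _ _ _ = (\int[mu]_x (EFin \o (f \o phi))^\- x)%E).
    exact: integrable_neg_fin_num.
  by apply: eq_integral => x _; rewrite funerneg.
- rewrite (_ : integral _ _ _ = (\int[mu]_x (EFin \o (f \o phi))^\+ x)%E).
    exact: integrable_pos_fin_num.
  by apply: eq_integral => x _; rewrite funerpos.
Qed.

End ChangeOfVariables.

Section Affine.
Context {R : realType}.
Notation mu := (@leb1 R).

Lemma leb1E (A : set R) : mu A = lebesgue_measure A.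
Proof. by []. Qed.

Definition affine (a c : R) (x : measurableTypeR R) : measurableTypeR R := a * x + c.

Lemma measurable_affine a c : measurable_fun setT (affine a c).
Proof. by apply: measurable_funD => //; exact: measurable_funM. Qed.

Lemma lebesgue_affine (a c : R) (A : set (measurableTypeR R)) : 0 < a -> measurable A ->
  mu A = (a%:E * mu (affine a c @^-1` A))%E.
Proof.
move=> a0 mA.
pose pf := measure_function_pushforward__canonical__measure_function_Measure
  mu (measurable_affine a c).
pose nu : {measure set (measurableTypeR R) -> \bar R} := mscale (NngNum (ltW a0)) pf.
have := @lebesgue_measure_unique R nu; apply => // _ [[p q] _ <-] /=.
rewrite /nu /mscale /= /pushforward /=.
rewrite (_ : _ @^-1` _ = `](p - c) / a, (q - c) / a]%classic); last first.
  apply/seteqP; split => x /=; rewrite /affine !in_itv/= ltr_pdivrMr// ler_pdivlMr//;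
    by move=> /andP[? ?]; apply/andP; split; lra.
rewrite /leb1 !lebesgue_measure_itv/= !lte_fin ltr_pM2r ?invr_gt0// ltrD2r.
case: ifP => _; last by rewrite mule0.
by rewrite -!EFinD -EFinM; congr EFin; field; rewrite gt_eqF.
Qed.

Lemma ge0_integral_affine (a c : R) (f : R -> R) : 0 < a ->
  measurable_fun [set: measurableTypeR R] f -> (forall x, 0 <= f x) ->
  (\int[mu]_x (f x)%:E = a%:E * \int[mu]_x (f (a * x + c))%:E)%E.
Proof.
move=> a0; apply: (ge0_integral_map (measurable_affine a c) a0).
by move=> A; exact: lebesgue_affine.
Qed.

Lemma Rintegral_affine (a c : R) (f : R -> R) : 0 < a ->
  measurable_fun [set: measurableTypeR R] f -> mu.-integrable setT (EFin \o f) ->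
  \int[mu]_x f x = a * \int[mu]_x f (a * x + c).
Proof.
move=> a0; apply: (Rintegral_map (measurable_affine a c) a0).
by move=> A; exact: lebesgue_affine.
Qed.

End Affine.

(** * Unitary dilations of square-integrable functions on the line *)

Section Dilations.
Context {R : realType}.
Notation mu := (@leb1 R).
Notation L2 := (Lfun mu 2%:E).
Local Notation ip := (ip mu).

Definition dil (a : R) (f : R -> R^o) : R -> R^o := fun y => Num.sqrt a * f (a * y).

Lemma measurable_dil a (f : measurableTypeR R -> R) :
  measurable_fun setT f -> measurable_fun [set: measurableTypeR R] (dil a f).
Proof.
move=> mf; apply: measurable_funM => //.
rewrite (_ : (fun y => _) = f \o (affine a 0)).
  by apply: measurableT_comp => //; exact: measurable_affine.
by apply/funext => x; rewrite /affine /= addr0.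
Qed.

Lemma dil_L2 a (f : R -> R) : 0 < a -> f \in L2 -> dil a f \in L2.
Proof.
move=> a0 /Lfun2P[mf f2]; apply/Lfun2P; split; first exact: measurable_dil.
rewrite (_ : integral _ _ _ = (\int[mu]_x (f x ^+ 2)%:E)%E)//.
rewrite [RHS](ge0_integral_affine 0 a0).
- rewrite -intZ ?(ltW a0)//.
  + apply: eq_integral => x _; congr EFin.
    by rewrite /dil exprMn sqr_sqrtr ?ltW// addr0.
  + apply: measurable_funX; apply: (@measurableT_comp _ _ _ _ _ _ f) => //.
    exact: (measurable_affine a 0).
  + by move=> x; exact: sqr_ge0.
- exact: measurable_funX.
- by move=> x; exact: sqr_ge0.
Qed.

Lemma ip_dil a (f g : R -> R) : 0 < a -> f \in L2 -> g \in L2 ->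
  ip (dil a f) (dil a g) = ip f g.
Proof.
move=> a0 f2 g2; rewrite /ip.
have i := L2_integrable_prod f2 g2.
rewrite [RHS](Rintegral_affine 0 a0)//; last first.
  by apply: measurable_funM; [exact: Lfun2_measurable f2|exact: Lfun2_measurable g2].
rewrite -RintegralZl//.
  apply: eq_Rintegral => x _; rewrite /dil addr0.
  by rewrite mulrACA -expr2 sqr_sqrtr// ltW.
have mfg : measurable_fun [set: measurableTypeR R] (fun x => f x * g x).
  by apply: measurable_funM; [exact: Lfun2_measurable f2|exact: Lfun2_measurable g2].
have := integrable_map (measurable_affine a 0) a0 (fun A => @lebesgue_affine R a 0 A a0) mfg.
by move=> [+ _]; apply.
Qed.

(** Dominated convergence with bound [f ^ 2]. The point 0 is exempted, being null, so that the [A n]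
    may shrink to the origin as well as escape to infinity. *)
Lemma L2_shrink (A : nat -> set R) (f : R -> R) (eps : R) :
  f \in L2 -> (forall n, measurable (A n : set (measurableTypeR R))) ->
  (forall x, x != 0 -> exists N, forall n, (N <= n)%N -> ~ A n x) -> 0 < eps ->
  exists n, ip (f \_ (A n)) (f \_ (A n)) <= eps.
Proof.
move=> f2 mA Ax eps0.
pose F n x : \bar R := (((f \_ (A n)) x) ^+ 2)%:E.
have fA n : (f \_ (A n)) \in L2 by exact: L2_restrict.
have mF n : measurable_fun [set: measurableTypeR R] (F n).
  by apply/measurable_EFinP; apply: measurable_funX; exact: (Lfun2_measurable (fA n)).
have F0 : {ae mu, forall x, setT x -> F ^~ x @ \oo --> (cst 0%E : R -> \bar R) x}.
  have H : mu.-negligible [set 0 : measurableTypeR R].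
    by apply/negligibleP; [exact: measurable_set1|exact: lebesgue_measure_set1].
  apply: negligibleS H => x /= H; apply: contrapT => x0; apply: H => _.
  have [N NP] := Ax x (introN eqP x0).
  apply: cvg_near_cst; exists N => // n /= Nn.
  rewrite /F patchE memNset; last exact: NP.
  by change (((0 : R) ^+ 2)%:E = 0%E); rewrite expr0n.
have Ff : {ae mu, forall x n, setT x -> (`|F n x| <= (f x ^+ 2)%:E)%E}.
  apply: aeW => x n _; rewrite /F gee0_abs ?lee_fin ?sqr_ge0// patchE.
  by case: ifP => // _; change ((0 : R) ^+ 2 <= f x ^+ 2); rewrite expr0n sqr_ge0.
have [_ _] := @dominated_convergence _ _ _ mu _ measurableT F (cst 0%E)
  (fun x => (f x ^+ 2)%:E) mF (measurable_cst _) F0 (Lfun2_integrable_sqr f2) Ff.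
rewrite integral0 /F.
under eq_fun do rewrite L2_integral_sqr//.
move=> /fine_cvgP[_] /cvgrPdist_le /(_ _ eps0)[N _ /(_ N (leqnn N))].
by rewrite /= sub0r normrN ger0_norm ?ip_ge0//; exists N.
Qed.

Lemma ip_restrict_le (A : set (measurableTypeR R)) (f : R -> R) : measurable A ->
  f \in L2 -> ip (f \_ A) (f \_ A) <= ip f f.
Proof.
move=> mA f2; have fA : (f \_ A) \in L2 by exact: L2_restrict.
rewrite -lee_fin -!L2_integral_sqr//; apply: int_le.
- by apply: measurable_funX; exact: (Lfun2_measurable fA).
- by apply: measurable_funX; exact: (Lfun2_measurable f2).
- by move=> x; exact: sqr_ge0.
- move=> x; rewrite patchE; case: ifP => // _.
  by change ((0 : R) ^+ 2 <= f x ^+ 2); rewrite expr0n sqr_ge0.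
Qed.

Definition halfline : set R := [set x | 0 <= x].

Lemma measurable_halfline : measurable (halfline : set (measurableTypeR R)).
Proof.
rewrite (_ : halfline = `[0, +oo[%classic); first exact: measurable_itv.
by apply/seteqP; split => x /=; rewrite in_itv/= andbT.
Qed.

Lemma ip_CS_norm (f g : R -> R) M N : f \in L2 -> g \in L2 -> 0 <= M -> 0 <= N ->
  ip f f <= M ^+ 2 -> ip g g <= N ^+ 2 -> `|ip f g| <= M * N.
Proof.
move=> f2 g2 M0 N0 fM gN.
apply: (ph_CS_norm (L2on_preHilbert mu measurableT)) => //.
- by split=> // x /(_ I).
- by split=> // x /(_ I).
- exact: mulr_ge0.
- by rewrite exprMn ler_pM// ip_ge0.
Qed.

(** For large [a] the function [dil a f] lives near the origin. The part of [h] on a small interval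
    around 0 has small norm, and away from it only the tail of [f] is seen. *)
Lemma dil_large (f h : R -> R) (eps : R) : f \in L2 -> h \in L2 -> 0 < eps ->
  (forall x, ~ halfline x -> h x = 0) ->
  exists K, forall a, 0 < a -> K <= ln a -> `|ip (dil a f) h| <= eps.
Proof.
move=> f2 h2 eps0 hpos.
pose M := Num.sqrt (ip f f) + 1; pose N := Num.sqrt (ip h h) + 1.
have M0 : 0 < M by rewrite ltr_wpDl// sqrtr_ge0.
have N0 : 0 < N by rewrite ltr_wpDl// sqrtr_ge0.
have fM : ip f f <= M ^+ 2.
  by rewrite -[leLHS]sqr_sqrtr ?ip_ge0// ler_pXn2r ?nnegrE ?sqrtr_ge0 ?ltW// ltrDl.
have hN : ip h h <= N ^+ 2.
  by rewrite -[leLHS]sqr_sqrtr ?ip_ge0// ler_pXn2r ?nnegrE ?sqrtr_ge0 ?ltW// ltrDl.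
have [|||n1 Hn1] := @L2_shrink (fun n => `[- n.+1%:R^-1, n.+1%:R^-1]%classic) h
  ((eps / 2 / M) ^+ 2) h2.
- by move=> n; exact: measurable_itv.
- move=> x x0.
  have xp : 0 < `|x| by rewrite normr_gt0.
  have /cvgrPdist_lt /(_ _ xp)[k _ kP] := @cvg_harmonic R.
  exists k => n /kP /=; rewrite sub0r normrN ger0_norm ?invr_ge0// in_itv/= => H.
  by apply/negP; rewrite -ler_norml -ltNge.
- by rewrite exprn_gt0// !divr_gt0.
have [|||n2 Hn2] := @L2_shrink (fun n => `]n%:R, +oo[%classic) f
  ((eps / 2 / N) ^+ 2) f2.
- by move=> n; exact: measurable_itv.
- move=> x _; exists (Num.truncn `|x|).+1 => n xn /=; rewrite in_itv/= andbT.
  apply/negP; rewrite -leNgt; apply: le_trans (ler_norm _) _.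
  by apply: le_trans (ltW (truncnS_gt _)) _; rewrite ler_nat.
- by rewrite exprn_gt0// !divr_gt0.
set A1 := [set` _] in Hn1; set A2 := [set` _] in Hn2.
have mA1 : measurable (A1 : set (measurableTypeR R)) by exact: measurable_itv.
have mA2 : measurable (A2 : set (measurableTypeR R)) by exact: measurable_itv.
pose d1 : R := n1.+1%:R^-1; have d10 : 0 < d1 by rewrite invr_gt0.
(* Beyond this scale [a * d1 >= n2 + 1], hence [a * x] lies in the tail [A2] for every [x > d1]. *)
exists (ln ((n2%:R + 1) / d1)) => a a0.
have n20 : 0 < n2%:R + 1 :> R by rewrite ltr_wpDl.
rewrite ler_ln ?posrE ?divr_gt0// ler_pdivrMr// => na.
have Da2 : dil a f \in L2 by exact: dil_L2.
have hE : h = (fun x => 1 * (h \_ A1) x + (h \_ (~` A1)) x).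
  apply/funext => x; rewrite mul1r !patchE in_setC; case: ifP => _ /=.
    by change (h x = h x + 0); rewrite addr0.
  by change (h x = 0 + h x); rewrite add0r.
have hA1 : (h \_ A1) \in L2 by exact: L2_restrict.
have hA1c : (h \_ (~` A1)) \in L2 by apply: L2_restrict => //; exact: measurableC.
rewrite ipC {1}hE ipl// mul1r.
apply: le_trans (ler_normD _ _) _; rewrite [leRHS]splitr; apply: lerD.
  apply: (@le_trans _ _ ((eps / 2 / M) * M)); last by rewrite divfK// gt_eqF.
  apply: ip_CS_norm => //; [by rewrite !divr_ge0 ?ltW|exact: ltW|].
  by rewrite ip_dil.
have fA2 : (f \_ A2) \in L2 by exact: L2_restrict.
have -> : ip (h \_ (~` A1)) (dil a f) = ip (h \_ (~` A1)) (dil a (f \_ A2)).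
  apply: eq_Rintegral => x _; rewrite patchE in_setC.
  case: ifPn => [xA|_]; last by change (0 * dil a f x = 0 * dil a (f \_ A2) x); rewrite !mul0r.
  have [x0|x0] := pselect (halfline x); last by rewrite hpos// !mul0r.
  congr (_ * _); rewrite /dil patchE mem_set// /A2 /= in_itv/= andbT.
  move: xA => /negP; rewrite inE /A1 /= in_itv/= => /negP.
  rewrite negb_and -!ltNge => /orP[xn|xn].
    by have := lt_le_trans (le_lt_trans x0 xn) (_ : - n1.+1%:R^-1 <= 0);
      rewrite oppr_le0 invr_ge0 ler0n ltxx => /(_ isT).
  apply: (@lt_le_trans _ _ (n2%:R + 1)); first by rewrite ltrDl.
  by apply: le_trans na _; rewrite ler_wpM2l// ltW.
apply: (@le_trans _ _ (N * (eps / 2 / N))); last by rewrite mulrC divfK// gt_eqF.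
apply: ip_CS_norm => //; [exact: dil_L2|exact: ltW|by rewrite !divr_ge0 ?ltW| |].
  by apply: le_trans hN; apply: ip_restrict_le => //; exact: measurableC.
by rewrite ip_dil.
Qed.

Lemma dil_dil a b (f : R -> R) : 0 < a -> 0 < b -> dil a (dil b f) = dil (a * b) f.
Proof.
move=> a0 b0; apply/funext => x; rewrite /dil mulrA -sqrtrM ?ltW//.
by congr (_ * f _); ring.
Qed.

Lemma dil1 (f : R -> R) : dil 1 f = f.
Proof. by apply/funext => x; rewrite /dil sqrtr1 !mul1r. Qed.

(** By unitarity, replacing [a] by its inverse exchanges [f] and [h], so that small scales reduce to
    large ones. *)
Lemma dil_asymptotic (f h : R -> R) (eps : R) : f \in L2 -> h \in L2 -> 0 < eps ->
  (forall x, ~ halfline x -> f x = 0) -> (forall x, ~ halfline x -> h x = 0) ->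
  exists K, forall a, 0 < a -> K <= `|ln a| -> `|ip (dil a f) h| <= eps.
Proof.
move=> f2 h2 eps0 f0 h0.
have [K1 H1] := dil_large f2 h2 eps0 h0.
have [K2 H2] := dil_large h2 f2 eps0 f0.
exists (Num.max K1 K2) => a a0; rewrite ge_max => /andP[k1 k2].
have [l0|l0] := leP 0 (ln a).
  by apply: H1 => //; move: k1; rewrite ger0_norm.
have a'0 : 0 < a^-1 by rewrite invr_gt0.
rewrite ipC -[X in `|X|](ip_dil a'0)//; last exact: dil_L2.
rewrite dil_dil// mulVf ?gt_eqF// dil1.
by apply: H2 => //; move: k2; rewrite ltr0_norm// lnV.
Qed.

Definition unit_step : R -> R^o := \1_(`[0, 1]%classic : set R).

Lemma unit_step_L2 : unit_step \in L2.
Proof.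
apply/Lfun2P; split; first exact: measurable_indic.
rewrite (_ : integral _ _ _ = (\int[mu]_x (\1_(`[0, 1]%classic : set R) x)%:E)%E).
  by rewrite integral_indic// setIT leb1E lebesgue_measure_itv/= lte01 oppr0 adde0 ltry.
by apply: eq_integral => x _; rewrite /unit_step indicE; case: (_ \in _); rewrite ?expr1n ?expr0n.
Qed.

Lemma ip_unit_step a : 1 <= a -> ip (dil a unit_step) unit_step = (Num.sqrt a)^-1.
Proof.
move=> a1; have a0 : 0 < a by apply: lt_le_trans a1.
have sa0 : 0 < Num.sqrt a by rewrite sqrtr_gt0.
rewrite /ip (_ : (fun x => _) = fun x => Num.sqrt a * \1_(`[0, a^-1]%classic : set R) x).
  rewrite RintegralZl//; last exact: integrable_indic_itv.
  rewrite /Rintegral integral_indic//.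
  rewrite setIT leb1E lebesgue_measure_itv/= lte_fin invr_gt0 a0 oppr0 adde0/=.
  rewrite -[a in _ * a^-1](sqr_sqrtr (ltW a0)).
  by field; rewrite gt_eqF.
apply/funext => x; rewrite /dil /unit_step !indicE -mulrA; congr (_ * _).
rewrite -natrM mulnb; congr (_%:R); congr nat_of_bool.
have -> : (a * x \in `[0, 1]%classic) = (0 <= a * x <= 1) by apply/idP/idP; rewrite inE/= in_itv.
have -> : (x \in `[0, 1]%classic) = (0 <= x <= 1) by apply/idP/idP; rewrite inE/= in_itv.
have -> : (x \in `[0, a^-1]%classic) = (0 <= x <= a^-1) by apply/idP/idP; rewrite inE/= in_itv.
rewrite pmulr_rge0//.
have [x0/=|//] := leP 0 x.
rewrite -[a^-1]mul1r ler_pdivlMr// mulrC.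
have [ax|//] := leP (x * a) 1.
by apply: le_trans ax; rewrite ler_peMr.
Qed.

Lemma ip_unit_step1 : ip unit_step unit_step = 1.
Proof. by have := ip_unit_step (lexx 1); rewrite dil1 sqrtr1 invr1. Qed.

(** For [b >= 1] the squared distance is [2 - 2 / sqrt b], where [1 / sqrt b = expR (- (ln b / 2))]
    is at least [1 - ln b / 2]; unitarity reduces [a < 1] to [a^-1]. *)
Lemma dil_unit_step a : 0 < a ->
  ip (dil a unit_step - unit_step) (dil a unit_step - unit_step) <= `|ln a|.
Proof.
have PH := L2on_preHilbert mu measurableT.
have Pf (f : R -> R) : f \in L2 -> L2on mu setT f by split=> // x /(_ I).
suff main b : 1 <= b ->
    ip (dil b unit_step - unit_step) (dil b unit_step - unit_step) <= `|ln b|.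
  move=> a0; have [a1|a1] := leP 1 a; first exact: main.
  have a'0 : 0 < a^-1 by rewrite invr_gt0.
  have De2 := dil_L2 a0 unit_step_L2; have De2' := dil_L2 a'0 unit_step_L2.
  have -> : ip (dil a unit_step - unit_step) (dil a unit_step - unit_step) =
      ip (dil a^-1 unit_step - unit_step) (dil a^-1 unit_step - unit_step).
    rewrite !(ph_sqrB PH); try (apply: Pf => //; exact: unit_step_L2).
    rewrite !ip_dil//; try exact: unit_step_L2.
    rewrite -(ip_dil a0 De2' unit_step_L2) dil_dil// divff ?gt_eqF// dil1.
    by rewrite [ip unit_step (dil a _)]ipC.
  have -> : `|ln a| = `|ln a^-1| by rewrite lnV// normrN.
  by apply: main; rewrite invf_ge1// ltW.
move=> b1; have b0 : 0 < b by apply: lt_le_trans b1.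
have Db2 := dil_L2 b0 unit_step_L2.
rewrite (ph_sqrB PH); try (apply: Pf => //; exact: unit_step_L2).
rewrite ip_dil//; try exact: unit_step_L2.
rewrite ip_unit_step// ip_unit_step1.
have lb0 : 0 <= ln b by rewrite ln_ge0.
rewrite ger0_norm//.
have -> : (Num.sqrt b)^-1 = expR (- (ln b / 2)).
  rewrite expRN; congr (_^-1).
  rewrite -[b in LHS]lnK ?posrE// [in LHS](splitr (ln b)) expRD -expr2.
  by rewrite sqrtr_sqr ger0_norm ?expR_ge0.
have := expR_ge1Dx (- (ln b / 2)); lra.
Qed.

Definition L2half : set (R -> R^o) := L2on mu halfline.

Lemma L2half_preHilbert : preHilbert L2half ip.
Proof. exact: L2on_preHilbert measurable_halfline. Qed.

Lemma L2half_dilation : dilation L2half ip dil unit_step.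
Proof.
split.
- move=> a f a0 [f2 f0]; split; first exact: dil_L2.
  by move=> x x0; rewrite /dil f0 ?mulr0// /halfline /= pmulr_rge0.
- move=> a c f g a0 _ _; apply/funext => x.
  by change (Num.sqrt a * (c * f (a * x) + g (a * x)) =
    c * (Num.sqrt a * f (a * x)) + Num.sqrt a * g (a * x)); ring.
- by move=> a f g a0 [f2 _] [g2 _]; exact: ip_dil.
- by move=> a b f a0 b0 _; exact: dil_dil.
- by move=> f _; exact: dil1.
- by move=> f h eps [f2 f0] [h2 h0] eps0; exact: dil_asymptotic.
- move=> eps eps0; exists eps => // a a0; apply: le_trans; exact: dil_unit_step.
- split; first exact: unit_step_L2.
  move=> x x0; rewrite /unit_step indicE memNset// => /=; rewrite in_itv/=.
  by move=> /andP[+ _]; exact: x0.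
- by rewrite ip_unit_step1.
Qed.

End Dilations.

(** * Smooth functions and the fundamental lemma of the calculus of variations *)

Section Smoothness.
Context {R : realType}.

(* Smoothness on the line as a coinductive predicate: [C] is any class of
   derivable functions that is closed under derivation. *)
Definition cinf (k : R -> R) : Prop := exists C : set (R -> R),
  C k /\ forall f, C f -> (forall x, derivable f x 1) /\ C (f^`())%classic.

Lemma cinf_derivable k x : cinf k -> derivable k x 1.
Proof. by move=> [C [Ck /(_ _ Ck)[]]]. Qed.

Lemma cinf_derive k : cinf k -> cinf (k^`())%classic.
Proof. by move=> [C [Ck H]]; exists C; split=> //; case: (H _ Ck). Qed.

Lemma cinf_primitive (k K : R -> R) :
  cinf k -> (forall x : R, is_derive x (1 : R) K (k x)) -> cinf K.
Proof.
move=> [C [Ck H]] HK; exists (C `|` [set K]); split; first by right.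
move=> f [/H[? ?]|->]; first by split => //; left.
split; first by move=> x; case: (HK x).
left; rewrite (_ : (K^`())%classic = k)//; apply/funext => x.
by rewrite derive1E; have [_ ->] := HK x.
Qed.

Lemma derive_comp (V : normedModType R) (k : R -> R) (f : V -> R) (x v : V) :
  derivable k (f x) 1 -> differentiable f x ->
  'D_v (k \o f) x = (k^`())%classic (f x) * 'D_v f x.
Proof.
move=> /derivable1_diffP dk df.
rewrite deriveE; last exact: differentiable_comp.
rewrite diff_comp//= [in RHS]deriveE// derive1E'//.
have {1}-> : 'd f x v = 'd f x v *: (1 : R) by rewrite /GRing.scale /= mulr1.
by rewrite linearZ mulrC.
Qed.

(* A class closed under directional derivatives by construction, so that [smooth]
   follows by induction on the list of directions. *)
Inductive smooth_alg (V : normedModType R) : (V -> R) -> Prop :=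
 | SAcst c : smooth_alg (cst c)
 | SAlin f : (forall x, differentiable f x) ->
     (forall v, exists c, forall x, 'D_v f x = c) -> smooth_alg f
 | SAadd f g : smooth_alg f -> smooth_alg g -> smooth_alg (f + g)
 | SAmul f g : smooth_alg f -> smooth_alg g -> smooth_alg (f * g)
 | SAcomp k f : cinf k -> smooth_alg f -> smooth_alg (k \o f).

Lemma smooth_alg_differentiable (V : normedModType R) (f : V -> R) x :
  smooth_alg f -> differentiable f x.
Proof.
elim=> [c|//|f' g _ df _ dg|f' g _ df _ dg|k f' kC _ df].
- exact: differentiable_cst.
- exact: differentiableD.
- exact: differentiableM.
- by apply: differentiable_comp => //; apply/derivable1_diffP; exact: cinf_derivable.
Qed.

Lemma smooth_alg_derive (V : normedModType R) (f : V -> R) v :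
  smooth_alg f -> smooth_alg (fun x => 'D_v f x).
Proof.
have der g x : smooth_alg g -> derivable g x v.
  by move=> Sg; apply: diff_derivable; exact: smooth_alg_differentiable.
elim=> [c|g dg cg|f' g Sf Sf' Sg Sg'|f' g Sf Sf' Sg Sg'|k f' kC Sf Sf'].
- rewrite (_ : (fun _ => _) = cst 0); first exact: SAcst.
  by apply/funext => x; exact: derive_cst.
- have [c gc] := cg v; rewrite (_ : (fun _ => _) = cst c); first exact: SAcst.
  by apply/funext => x; exact: gc.
- rewrite (_ : (fun _ => _) = (fun x => 'D_v f' x) + (fun x => 'D_v g x)).
    exact: SAadd.
  by apply/funext => x; rewrite deriveD//; exact: der.
- rewrite (_ : (fun _ => _) = f' * (fun x => 'D_v g x) + g * (fun x => 'D_v f' x)).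
    by apply: SAadd; exact: SAmul.
  by apply/funext => x; rewrite deriveM//; exact: der.
- rewrite (_ : (fun _ => _) = ((k^`())%classic \o f') * (fun x => 'D_v f' x)).
    by apply: SAmul => //; apply: SAcomp => //; exact: cinf_derive.
  apply/funext => x; rewrite derive_comp//; first exact: cinf_derivable.
  exact: smooth_alg_differentiable.
Qed.

Lemma smooth_alg_smooth (V : normedModType R) (f : V -> R) : smooth_alg f -> smooth f.
Proof.
move=> Sf s x; apply: smooth_alg_differentiable.
by elim: s => [//|v s IH] /=; exact: smooth_alg_derive.
Qed.

Lemma cinf_smooth_alg (k : R -> R) : cinf k -> smooth_alg k.
Proof.
move=> kC; rewrite (_ : k = k \o id)//; apply: SAcomp => //; apply: SAlin.
  by move=> x; apply: ex_diff.
by move=> v; exists v => x; rewrite derive_id.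
Qed.

Lemma cinfD f g : cinf f -> cinf g -> cinf (fun x => f x + g x).
Proof.
move=> [C [Cf HC]] [D [Dg HD]].
exists [set h | exists f g, [/\ C f, D g & h = (fun x => f x + g x)]]; split.
  by exists f, g.
move=> _ [f1 [g1 [Cf1 Dg1 ->]]]; have [df Cf'] := HC _ Cf1; have [dg Dg'] := HD _ Dg1.
split; first by move=> x; exact: derivableD.
exists (f1^`())%classic, (g1^`())%classic; split => //; apply/funext => x.
by rewrite !derive1E deriveD.
Qed.

Lemma cinf_affine a c : cinf (fun x => a * x + c).
Proof.
exists [set f | exists a c, f = fun x => a * x + c]; split; first by exists a, c.
move=> _ [b [d ->]]; have H (x : R) : is_derive x (1 : R) (fun x : R => b * x + d) b.
  by apply: is_derive_eq; rewrite addr0 /GRing.scale /= mulr1.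
split; first by move=> x; case: (H x).
exists 0, b; apply/funext => x; rewrite derive1E; have [_ ->] := H x.
by rewrite mul0r add0r.
Qed.

End Smoothness.

(** * Flat functions and bumps *)

Section CinfProducts.
Context {R : realType}.

Lemma smooth_alg_cinf (k : R -> R) : smooth_alg k -> cinf k.
Proof.
move=> Sk; exists [set f | smooth_alg f]; split => // f Sf; split.
  by move=> x; apply/derivable1_diffP; exact: smooth_alg_differentiable.
rewrite (_ : (f^`())%classic = fun x => 'D_1 f x); first exact: smooth_alg_derive.
by apply/funext => x; rewrite derive1E.
Qed.

Lemma cinfM (f g : R -> R) : cinf f -> cinf g -> cinf (fun x => f x * g x).
Proof.
move=> /cinf_smooth_alg Sf /cinf_smooth_alg Sg.
by apply: smooth_alg_cinf; exact: SAmul.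
Qed.

Lemma cinf_comp (f g : R -> R) : cinf f -> cinf g -> cinf (fun x => f (g x)).
Proof.
move=> Cf /cinf_smooth_alg Sg.
by apply: smooth_alg_cinf; exact: (SAcomp Cf Sg).
Qed.

Lemma cinfZ (a : R) (f : R -> R) : cinf f -> cinf (fun x => a * f x).
Proof.
move=> Cf; apply: cinfM => //.
by have := cinf_affine 0 a; rewrite (_ : (fun x => _) = fun=> a)//; apply/funext => x; rewrite mul0r add0r.
Qed.

Lemma cinf_expR : cinf (@expR R).
Proof.
exists [set expR]; split=> // _ ->; split; first by move=> x; exact: derivable_expR.
by apply/funext => x; rewrite derive1E; exact: derive_val.
Qed.

(** Serves [flat] at the points [t <= 0], where the difference quotient itself is estimated. *)
Lemma is_derive_quadratic (f : R -> R) (x C : R) :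
  (\forall h \near 0, `|f (h + x) - f x| <= C * h ^+ 2) -> is_derive x 1 f 0.
Proof.
move=> H.
have cv : h^-1 *: (f (h *: 1 + x) - f x) @[h --> 0^'] --> (0 : R).
  apply/cvgrPdist_le => eps eps0.
  have : \forall h \near (0:R), `|h| <= eps / (`|C| + 1).
    have e0 : 0 < eps / (`|C| + 1) by rewrite divr_gt0// ltr_wpDl.
    near=> h; rewrite -[h]subr0 -normrN opprB; near: h.
    exact: cvgr_dist_le.
  move=> H2; near=> h.
  have h0 : h != 0 by near: h; exact: nbhs_dnbhs_neq.
  have Hh : `|f (h + x) - f x| <= C * h ^+ 2 by near: h; apply: nbhs_dnbhs.
  have hs : `|h| <= eps / (`|C| + 1) by near: h; apply: nbhs_dnbhs.
  rewrite sub0r normrN normrZ normfV [h *: 1]mulr1.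
  rewrite ler_pdivrMl ?normr_gt0//.
  apply: le_trans Hh _; rewrite -real_normK ?num_real// expr2 mulrCA ler_wpM2l//.
  have C1 : C <= `|C| + 1 by apply: le_trans (ler_norm _) _; rewrite lerDl.
  apply: le_trans (ler_wpM2r (normr_ge0 _) C1) _.
  by rewrite mulrC -ler_pdivlMr// ltr_wpDl.
apply: DeriveDef; first by apply/cvg_ex; exists 0.
exact/cvg_lim.
Unshelve. all: by end_near. Qed.

(* The derivative of [flat P] is again of the form [flat Q]. *)
Definition flat (P : {poly R}) (t : R) : R :=
  if 0 < t then P.[t^-1] * expR (- t^-1) else 0.

(** With [y = t^-1] this bounds [flat P t] by a multiple of [t ^ m]. The power [m] is free because
    each step of the induction on [P] moves one factor [y] into it. *)
Lemma poly_expR_bounded (P : {poly R}) (m : nat) :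
  exists C, forall y, 0 < y -> `|P.[y]| * y ^+ m * expR (- y) <= C.
Proof.
elim/poly_ind: P m => [|P c IH] m.
  by exists 0 => y y0; rewrite horner0 normr0 !mul0r.
have [C HC] := IH m.+1.
exists (C + `|c| * m`!%:R) => y y0.
rewrite hornerMXaddC.
have e0 := expR_gt0 (- y).
apply: (@le_trans _ _ ((`|P.[y]| * y + `|c|) * y ^+ m * expR (- y))).
  apply: ler_wpM2r; first exact: ltW.
  apply: ler_wpM2r; first by rewrite exprn_ge0// ltW.
  by apply: le_trans (ler_normD _ _) _; rewrite lerD2r normrM (gtr0_norm y0).
rewrite !mulrDl lerD//.
  by apply: le_trans (HC _ y0); rewrite exprS mulrA.
rewrite -mulrA ler_wpM2l// expRN ler_pdivrMr ?expR_gt0//.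
rewrite mulrC -ler_pdivrMr ?ltr0n ?fact_gt0//.
case: m {IH HC} => [|m].
  by rewrite expr0 fact0 divr1; have := expR_ge1Dx y; lra.
by apply: le_trans (expR_ge1Dxn m (ltW y0)); rewrite lerDr.
Qed.

Lemma is_derive_inv (t : R) : t != 0 -> is_derive t (1 : R) (fun t : R => t^-1) (- t ^- 2).
Proof.
move=> t0; have := @is_deriveV _ id t 1 1 t0 (is_derive_id _ _).
by rewrite /GRing.scale /= mulr1.
Qed.

Lemma is_derive_flat P (t : R) : is_derive t (1 : R) (flat P) (flat ('X^2 * (P - P^`())) t).
Proof.
have [t0|t0] := ltP 0 t.
  have tn0 : t != 0 by rewrite gt_eqF.
  have dV := is_derive_inv tn0.
  have dP : is_derive t (1 : R) (horner P \o (fun t : R => t^-1)) (P^`().[t^-1] * (- t ^- 2)).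
    exact: is_derive1_comp.
  have dE : is_derive t (1 : R) (expR \o (fun t : R => - t^-1)) (expR (- t^-1) * (t ^- 2)).
    apply: is_derive1_comp; rewrite -[t ^- 2]opprK; exact: is_deriveN.
  have dM := is_deriveM dP dE.
  apply: (near_eq_is_derive (f := (horner P \o (fun t : R => t^-1)) * (expR \o (fun t : R => - t^-1)))).
    near=> y; rewrite /flat ifT//; near: y; exact: lt_nbhsr.
  apply: is_derive_eq; rewrite /flat t0 hornerM hornerXn hornerD hornerN /=.
  rewrite /GRing.scale /= -exprVn; ring.
have fx : flat P t = 0 by rewrite /flat ltNge t0.
have -> : flat ('X^2 * (P - P^`())) t = 0 by rewrite /flat ltNge t0.
(* A quadratic bound on [flat P] makes its derivative at 0 vanish. *)
have [C HC] := poly_expR_bounded P 2.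
apply: (@is_derive_quadratic _ _ `|C|).
have [t0'|t0'] := ltP t 0.
  near=> h; rewrite fx subr0 /flat ltNge.
  have -> : h + t <= 0.
    rewrite -lerBrDr sub0r; apply: le_trans (ler_norm _) _.
    by near: h; exists (- t); rewrite /= ?oppr_gt0// => h /=; rewrite sub0r normrN => /ltW.
  by rewrite normr0 mulr_ge0// sqr_ge0.
have -> : t = 0 by apply/eqP; rewrite eq_le t0 t0'.
near=> h; rewrite addr0 /flat ltxx subr0.
case: ifP => [h0|_]; last by rewrite normr0 mulr_ge0// sqr_ge0.
have hi0 : 0 < h^-1 by rewrite invr_gt0.
rewrite normrM [`|expR _|]ger0_norm ?expR_ge0//.
have := HC _ hi0 => /le_trans - /(_ _ (ler_norm _)).
rewrite exprVn mulrAC ler_pdivrMr ?exprn_gt0//.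
Unshelve. all: by end_near. Qed.

Lemma cinf_flat P : cinf (flat P).
Proof.
exists [set flat P | P in setT]; split; first by exists P.
move=> _ [Q _ <-]; split; first by move=> x; case: (is_derive_flat Q x).
exists ('X^2 * (Q - Q^`())) => //; apply/funext => x.
by rewrite derive1E; have [_ ->] := is_derive_flat Q x.
Qed.

Lemma flat1 (t : R) : flat 1 t = if 0 < t then expR (- t^-1) else 0.
Proof. by rewrite /flat hornerC mul1r. Qed.

(** Inside []a, b[] the exponents tend to 0 as [n] grows: the bumps stay between 0 and 1 and
    converge at every point to the indicator of the open interval. *)
Definition bump (a b : R) (n : nat) (x : R) : R :=
  flat 1 (n.+1%:R * (x - a)) * flat 1 (n.+1%:R * (b - x)).

Lemma cinf_bump a b n : cinf (bump a b n).
Proof.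
apply: cinfM.
  rewrite (_ : (fun x => _) = fun x => flat 1 (n.+1%:R * x + - (n.+1%:R * a))).
    by apply: cinf_comp; [exact: cinf_flat|exact: cinf_affine].
  by apply/funext => x; congr flat; ring.
rewrite (_ : (fun x => _) = fun x => flat 1 (- n.+1%:R * x + n.+1%:R * b)).
  by apply: cinf_comp; [exact: cinf_flat|exact: cinf_affine].
by apply/funext => x; congr flat; ring.
Qed.

Lemma bump_out a b n x : ~ (a < x < b) -> bump a b n x = 0.
Proof.
move=> /negP; rewrite /bump !flat1 !pmulr_rgt0// !subr_gt0 negb_and.
by case/orP => /negbTE ->; rewrite ?mul0r ?mulr0.
Qed.

Lemma bump_ge0 a b n x : 0 <= bump a b n x.
Proof. by rewrite /bump !flat1 mulr_ge0//; case: ifP => _ //; exact: expR_ge0. Qed.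

Lemma bump_le1 a b n x : bump a b n x <= 1.
Proof.
have H (t : R) : 0 <= flat 1 t <= 1.
  rewrite flat1; case: ifP => [t0|_]; last by rewrite lexx ler01.
  by rewrite expR_ge0 -expR0 ler_expR oppr_le0 invr_ge0 ltW.
have /andP[? ?] := H (n.+1%:R * (x - a)); have /andP[? ?] := H (n.+1%:R * (b - x)).
by rewrite /bump mulr_ile1.
Qed.

Lemma bump_cvg a b x : bump a b n x @[n --> \oo] --> (\1_(`]a, b[%classic : set R) x : R).
Proof.
rewrite indicE; have [/andP[ax xb]|nx] := pselect (a < x < b); last first.
  rewrite memNset /= ?in_itv//=.
  rewrite (_ : (fun n => _) = cst 0); first exact: cvg_cst.
  by apply/funext => n; exact: bump_out.
rewrite mem_set /= ?in_itv/= ?ax//.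
have H (c : R) : 0 < c -> flat 1 (n.+1%:R * c) @[n --> \oo] --> (1 : R).
  move=> c0.
  rewrite (_ : (fun n => _) = fun n : nat => expR (- (n.+1%:R^-1 * c^-1))).
    apply: (@cvg_comp _ _ _ (fun n : nat => - (n.+1%:R^-1 * c^-1)) expR _ (nbhs (0 : R))); last first.
      by have := @continuous_expR R 0; rewrite /continuous_at expR0.
    have -> : nbhs (0 : R) = nbhs (- (0 * c^-1)) by rewrite mul0r oppr0.
    apply: cvgN.
    by apply: cvgM; [exact: cvg_harmonic|exact: cvg_cst].
  by apply/funext => n; rewrite flat1 mulr_gt0// invfM.
rewrite -[X in _ --> X](mulr1 (1 : R)); apply: cvgM; apply: H; rewrite subr_gt0//.
Qed.

End CinfProducts.

(** * Measures with a density, and functions with vanishing integrals *)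

Section Density.
Context d (T : measurableType d) {R : realType} (mu : {measure set T -> \bar R}).
Import HBNNSimple.

Definition density (f : T -> R) (A : set T) : \bar R := (\int[mu]_(x in A) (f x)%:E)%E.

Section DensityMeasure.
Variable f : T -> R.
Hypotheses (mf : measurable_fun setT f) (f0 : forall x, 0 <= f x).

Let density0 : density f set0 = 0%E. Proof. exact: integral_set0. Qed.
Let density_ge0 A : (0 <= density f A)%E.
Proof. by apply: integral_ge0 => x _; rewrite lee_fin. Qed.
Let density_additive : semi_sigma_additive (density f).
Proof.
apply: semi_sigma_additive_nng_induced; first exact/measurable_EFinP.
by move=> x; rewrite lee_fin.
Qed.

HB.instance Definition _ := isMeasure.Build _ _ _
  (density f) density0 density_ge0 density_additive.

Definition density_measure : {measure set T -> \bar R} := density f.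

Lemma ge0_integral_density (g : T -> R) : measurable_fun setT g -> (forall x, 0 <= g x) ->
  (\int[density_measure]_x (g x)%:E = \int[mu]_x (g x * f x)%:E)%E.
Proof.
move=> mg g0.
have mg' : measurable_fun setT (EFin \o g) by exact/measurable_EFinP.
pose h := nnsfun_approx measurableT mg'.
have hg x : (h n x)%:E @[n --> \oo] --> (g x)%:E.
  by apply: cvg_nnsfun_approx => // y _; rewrite lee_fin.
have mh n : measurable_fun setT (h n) by exact: measurable_funP.
transitivity (limn (fun n => \int[density_measure]_x (h n x)%:E)%E).
  rewrite -monotone_convergence//.
  - by apply: eq_integral => x _; apply/esym/cvg_lim.
  - by move=> n; exact/measurable_EFinP.
  - by move=> n x _; rewrite lee_fin.
  - by move=> x _ m n mn; rewrite lee_fin; exact/lefP/nd_nnsfun_approx.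
transitivity (limn (fun n => \int[mu]_x (h n x * f x)%:E)%E); last first.
  rewrite -monotone_convergence//.
  - apply: eq_integral => x _; apply/cvg_lim => //.
    under eq_fun do rewrite EFinM.
    by rewrite EFinM; apply: cvgeZr.
  - by move=> n; apply/measurable_EFinP; exact: measurable_funM.
  - by move=> n x _; rewrite lee_fin mulr_ge0.
  - by move=> x _ m n mn; rewrite lee_fin ler_wpM2r//; exact/lefP/nd_nnsfun_approx.
congr (limn _); apply/funext => n.
have ind r x : (r * \1_(h n @^-1` [set r]) x * f x)%:E =
    (r%:E * ((EFin \o f) \_ (h n @^-1` [set r])) x)%E.
  by rewrite -mulrA EFinM; congr (_ * _)%E; rewrite epatch_indic/= -EFinM mulrC.
transitivity (\sum_(r \in range (h n)) r%:E * density f (h n @^-1` [set r]))%E.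
  transitivity (\int[density_measure]_x
      (\sum_(r \in range (h n)) (r * \1_(h n @^-1` [set r]) x)%:E))%E.
    by apply: eq_integral => x _; rewrite fimfunE -fsumEFin.
  rewrite ge0_integral_fsum//.
  - apply: eq_fsbigr => r _.
    by rewrite integralZl_indic_nnsfun// integral_indic// setIT.
  - by move=> r; apply/measurable_EFinP; exact: measurable_funM.
  - by move=> r x _; rewrite nnfun_muleindic_ge0.
transitivity (\int[mu]_x
    (\sum_(r \in range (h n)) (r * \1_(h n @^-1` [set r]) x * f x)%:E))%E; last first.
  apply: eq_integral => x _; rewrite [in RHS]EFinM [in RHS]fimfunE -[in RHS]fsumEFin//.
  rewrite ge0_mule_fsuml => [|r]; last exact: nnfun_muleindic_ge0.
  by apply: eq_fsbigr => r _; rewrite EFinM.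
rewrite ge0_integral_fsum//; first last.
- by move=> r x _; rewrite EFinM mule_ge0 ?lee_fin// -lee_fin nnfun_muleindic_ge0.
- move=> r; apply/measurable_EFinP; apply: measurable_funM => //; exact: measurable_funM.
apply: eq_fsbigr => r; rewrite inE => -[x _ <-].
under eq_integral do rewrite ind.
rewrite ge0_integralZl//.
- by congr (_ * _)%E; rewrite /density integral_mkcond.
- apply/measurable_restrict => //; rewrite setTI; apply: measurable_funTS.
  exact/measurable_EFinP.
- by move=> y _; rewrite patchE; case: ifP => // _; rewrite lee_fin.
- by rewrite lee_fin.
Qed.

End DensityMeasure.

(** The positive and negative parts of [f] are densities of two finite measures; agreeing on a
    generating family stable under intersection, they agree on all measurable sets. *)
Lemma ae0_of_generator (f : T -> R) (G : set (set T)) (g : (set T)^nat) :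
  mu.-integrable setT (EFin \o f) -> @measurable _ T = <<s G >> -> setI_closed G ->
  (forall k, G (g k)) -> \bigcup_k g k = setT ->
  (forall A, G A -> (\int[mu]_(x in A) (f x)%:E = 0)%E) -> {ae mu, forall x, f x = 0}.
Proof.
move=> intf GE GI Gg gT G0.
have mf : measurable_fun setT f by apply/measurable_EFinP; exact: measurable_int intf.
have mp : measurable_fun setT (f^\+)%R by exact: measurable_funrpos.
have mn : measurable_fun setT (f^\-)%R by exact: measurable_funrneg.
have GM : G `<=` measurable by rewrite GE; exact: sub_sigma_algebra.
have split_int A : measurable A -> (\int[mu]_(x in A) (f x)%:E =
    density (f^\+)%R A - density (f^\-)%R A)%E.
  move=> mA; rewrite integralE /density; congr (_ - _)%E; apply: eq_integral => x _.
  - by have -> := congr1 (@^~ x) (funerpos f).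
  - by have -> := congr1 (@^~ x) (funerneg f).
have fin A : measurable A -> density (f^\+)%R A \is a fin_num /\
    density (f^\-)%R A \is a fin_num.
  move=> mA; have iA : mu.-integrable A (EFin \o f).
    exact: (integrableS measurableT mA (@subsetT _ _) intf).
  split; rewrite /density.
  - rewrite (_ : integral _ _ _ = (\int[mu]_(x in A) (EFin \o f)^\+ x)%E).
      exact: integrable_pos_fin_num.
    by apply: eq_integral => x _; rewrite funerpos.
  - rewrite (_ : integral _ _ _ = (\int[mu]_(x in A) (EFin \o f)^\- x)%E).
      exact: integrable_neg_fin_num.
    by apply: eq_integral => x _; rewrite funerneg.
have E A : measurable A -> density (f^\+)%R A = density (f^\-)%R A.
  have mm B : G B -> density_measure mp (funrpos_ge0 f) B =
      density_measure mn (funrneg_ge0 f) B.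
    move=> GB; have := G0 B GB; rewrite split_int; last exact: GM.
    have [f1 f2] := fin B (GM _ GB).
    change ((density (f^\+)%R B - density (f^\-)%R B = 0)%E ->
      density (f^\+)%R B = density (f^\-)%R B).
    rewrite -(fineK f1) -(fineK f2) -EFinB => -[] /eqP.
    by rewrite subr_eq0 => /eqP ->.
  rewrite GE => mA.
  apply: (@g_sigma_algebra_measure_unique _ _ _ G GM g Gg gT
    (density_measure mp (funrpos_ge0 f)) (density_measure mn (funrneg_ge0 f))) => // k.
  by have [+ _] := fin (g k) (GM _ (Gg k)); rewrite ge0_fin_numE// measure_ge0.
have : ae_eq mu setT (EFin \o f) (cst 0%E).
  apply: integral_ae_eq => // A _ mA.
  rewrite integral0 split_int// E//; apply: subee.
  by case: (fin A mA).
by apply: filterS => x /(_ I) [].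
Qed.

End Density.

Section Restriction.
Context d (T : measurableType d) {R : realType} (mu : {measure set T -> \bar R}).

Lemma integral_restrict (A B : set T) (w : T -> R) :
  (\int[mu]_(x in A) ((w \_ B) x)%:E = \int[mu]_(x in A `&` B) (w x)%:E)%E.
Proof.
rewrite integral_mkcondr; apply: eq_integral => x _.
by rewrite !patchE; case: ifP.
Qed.

End Restriction.

Section TestFunctions.
Context {R : realType}.
Notation mu := (@leb1 R).
Local Notation RR := (measurableTypeR R).

(** Test functions on the line, with smoothness in the coinductive form [cinf] that products,
    derivatives and primitives preserve. *)
Definition test1 (f : R -> R) : Prop :=
  cinf f /\ exists S : R, forall x, S < `|x| -> f x = 0.

Lemma test1_bump (a b : R) n : test1 (bump a b n).
Proof.
split; first exact: cinf_bump.
exists (`|a| + `|b|) => x xS; apply: bump_out => /andP[ax xb].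
move: xS; rewrite ltNge => /negP; apply.
rewrite ler_norml; apply/andP; split.
  by have := ler_norm (- a); rewrite normrN; have := normr_ge0 b; lra.
by have := ler_norm b; have := normr_ge0 a; lra.
Qed.

Lemma supported_compact (V : normedModType R) (f : V -> R) (K : set V) :
  compact K -> (forall x, ~ K x -> f x = 0) -> compact (closure [set x | f x != 0]).
Proof.
move=> cK fK; have clK : closed K by apply: compact_closed => //; exact: norm_hausdorff.
apply: (@subclosed_compact _ _ K) => //; first exact: closed_closure.
rewrite [X in _ `<=` X](closure_id _).1//; apply: closureS => x /= /eqP fx.
by apply: contrapT => /fK.
Qed.

Lemma test1_test (f : R -> R) : test1 f -> test_function f.
Proof.
move=> [fC [S Sf]]; split; first exact/smooth_alg_smooth/cinf_smooth_alg.
apply: (supported_compact (segment_compact (a := - S) (b := S))) => x /=.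
rewrite in_itv/= -ler_norml => /negP; rewrite -ltNge; exact: Sf.
Qed.

Lemma smooth_alg_test2 (f : R * R -> R) (S : R) : smooth_alg f ->
  (forall x, S < `|x.1| \/ S < `|x.2| -> f x = 0) -> test_function f.
Proof.
move=> fC Sf; split; first exact: smooth_alg_smooth.
apply: (supported_compact (compact_setX (segment_compact (a := - S) (b := S))
  (segment_compact (a := - S) (b := S)))) => x nx; apply: Sf.
apply: contrapT => /not_orP[/negP n1 /negP n2]; apply: nx; split => /=;
  by rewrite in_itv/= -ler_norml leNgt.
Qed.

Lemma smooth_alg_fst : smooth_alg (fst : R * R -> R).
Proof.
have cf : continuous (fst : R * R -> R) by move=> x; exact: cvg_fst.
apply: SAlin => [x|v]; first exact: linear_differentiable.
exists v.1 => x; rewrite deriveE; last exact: linear_differentiable.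
by rewrite diff_lin.
Qed.

Lemma smooth_alg_snd : smooth_alg (snd : R * R -> R).
Proof.
have cf : continuous (snd : R * R -> R) by move=> x; exact: cvg_snd.
apply: SAlin => [x|v]; first exact: linear_differentiable.
exists v.2 => x; rewrite deriveE; last exact: linear_differentiable.
by rewrite diff_lin.
Qed.

Lemma test2_prod (f g : R -> R) : test1 f -> test1 g ->
  test_function (fun x : R * R => f x.1 * g x.2).
Proof.
move=> [fC [S Sf]] [gC [S' Sg]]; apply: (@smooth_alg_test2 _ (Num.max S S')).
  apply: (@SAmul _ _ (f \o fst) (g \o snd)); apply: SAcomp => //.
    exact: smooth_alg_fst.
  exact: smooth_alg_snd.
by move=> x; rewrite !gt_max => -[/andP[/Sf -> _]|/andP[_ /Sg ->]]; rewrite ?mul0r ?mulr0.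
Qed.

End TestFunctions.

Section Fundamental.
Context d (T : measurableType d) {R : realType} (mu : {measure set T -> \bar R}).

(** Passage from smooth test functions to indicators: the [h n] are at most [\1_A], so dominated
    convergence applies with the bound [|w| * \1_A]. *)
Lemma int0_limit (w : T -> R) (A : set T) (h : nat -> T -> R) : measurable A ->
  measurable_fun setT w -> mu.-integrable A (EFin \o w) ->
  (forall n, measurable_fun setT (h n)) -> (forall n x, ~ A x -> h n x = 0) ->
  (forall n x, 0 <= h n x <= 1) -> (forall x, h n x @[n --> \oo] --> (\1_A x : R)) ->
  (forall n, \int[mu]_x (w x * h n x) = 0) -> (\int[mu]_(x in A) (w x)%:E = 0)%E.
Proof.
move=> mA mw iw mh hA h01 hc h0.
pose F n x : \bar R := (w x * h n x)%:E.
have mF n : measurable_fun setT (F n) by apply/measurable_EFinP; exact: measurable_funM.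
pose G x : \bar R := (`|w x| * \1_A x)%:E.
have iG : mu.-integrable setT G.
  have : mu.-integrable A (EFin \o (fun x => `|w x|)) by exact: integrable_norm.
  rewrite integrable_mkcond//; apply: eq_integrable => // x _.
  rewrite /G /= patchE indicE; case: ifP => _; first by rewrite mulr1.
  by rewrite mulr0.
have Fc : {ae mu, forall x, setT x -> F ^~ x @ \oo --> (w x * \1_A x)%:E}.
  apply: aeW => x _; apply: cvg_EFin; first exact: nearW.
  by apply: cvgM; [exact: cvg_cst|exact: hc].
have FG : {ae mu, forall x n, setT x -> (`|F n x| <= G x)%E}.
  apply: aeW => x n _; rewrite /F /G lee_fin normrM ler_wpM2l// indicE.
  have /andP[h1 h2] := h01 n x; rewrite ger0_norm//.
  by have [Ax|nAx] := pselect (A x); [rewrite mem_set|rewrite memNset//= hA].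
have mf : measurable_fun setT (fun x => (w x * \1_A x)%:E).
  by apply/measurable_EFinP; apply: measurable_funM => //; exact: measurable_indic.
have [iwA _] := @dominated_convergence _ _ _ mu _ measurableT F _ G mF mf Fc iG FG.
have -> : (fun n => \int[mu]_x F n x)%E = cst 0%E.
  apply/funext => n; rewrite -[LHS]fineK.
    by congr EFin; exact: h0.
  apply: integrable_fin_num => //; apply: le_integrable iG => // x _.
  apply: le_trans (_ : (G x <= _)%E).
    rewrite /F /G lee_fin normrM ler_wpM2l// indicE.
    have /andP[h1 h2] := h01 n x; rewrite ger0_norm//.
    by have [Ax|nAx] := pselect (A x); [rewrite mem_set|rewrite memNset//= hA].
  by rewrite gee0_abs// /G lee_fin mulr_ge0// indicE.
move=> /cvg_lim => /(_ (@ereal_hausdorff _)); rewrite lim_cst// => E.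
rewrite integral_mkcond [RHS]E; apply: eq_integral => x _.
by rewrite patchE indicE; case: ifP => _; rewrite ?mulr1 ?mulr0.
Qed.

End Fundamental.

Section Fundamental1.
Context {R : realType}.
Notation mu := (@leb1 R).
Local Notation RR := (measurableTypeR R).

Lemma measurable_cinf (f : R -> R) : cinf f -> measurable_fun [set: RR] f.
Proof.
move=> fC; apply: continuous_measurable_fun => x.
by apply/differentiable_continuous/derivable1_diffP; exact: cinf_derivable.
Qed.

Lemma ae0_of_intervals (w : R -> R) : mu.-integrable setT (EFin \o w) ->
  (forall a b : R, (\int[mu]_(x in `]a, b[%classic) (w x)%:E = 0)%E) ->
  {ae mu, forall x, w x = 0}.
Proof.
move=> iw w0.
apply: (@ae0_of_generator _ RR R mu w (@ocitv R) (fun k => `](- k%:R), k%:R]%classic)) => //.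
- exact: ocitvI.
- by move=> k; exact: is_ocitv.
- apply/seteqP; split => // x _; exists (Num.truncn `|x|).+1 => //=.
  rewrite in_itv/=; have := truncnS_gt `|x|; rewrite ltr_norml => /andP[-> /ltW ->].
  by [].
- move=> _ [[a b] _ <-] /=; rewrite -(w0 a b); apply/esym.
  apply: integral_itv_bndo_bndc; apply: measurable_funTS.
  exact: measurable_int iw.
Qed.

(** [w] is only locally integrable, so it is cut to the intervals []- k, k[]; these meet []a, b[] in
    open intervals again, where bumps are available. *)
Lemma fundamental1 (w : R -> R) : measurable_fun [set: RR] w ->
  (forall M : R, mu.-integrable `[- M, M]%classic (EFin \o w)) ->
  (forall f, test1 f -> \int[mu]_x (w x * f x) = 0) -> {ae mu, forall x, w x = 0}.
Proof.
move=> mw iw w0.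
have io a b : mu.-integrable `]a, b[%classic (EFin \o w).
  apply: (integrableS _ _ _ (iw (`|a| + `|b|))) => //.
  move=> x /=; rewrite !in_itv/= => /andP[ax xb]; rewrite -ler_norml ler_norml.
  apply/andP; split.
    by have := ler_norm (- a); rewrite normrN; have := normr_ge0 b; lra.
  by have := ler_norm b; have := normr_ge0 a; lra.
have w0' a b : (\int[mu]_(x in `]a, b[%classic) (w x)%:E = 0)%E.
  apply: (@int0_limit _ RR R mu w `]a, b[%classic (bump a b)) => //.
  - by move=> n; apply: measurable_cinf; exact: cinf_bump.
  - by move=> n x /=; rewrite in_itv/= => ?; exact: bump_out.
  - by move=> n x; rewrite bump_ge0 bump_le1.
  - exact: bump_cvg.
  - by move=> n; apply: w0; exact: test1_bump.
have H k : {ae mu, forall x, (w \_ `](- k%:R), k%:R[%classic) x = 0}.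
  apply: ae0_of_intervals.
    by rewrite -restrict_EFin -integrable_mkcond.
  move=> a b; rewrite integral_restrict.
  rewrite (_ : `]a, b[%classic `&` _ = `]Num.max a (- k%:R), Num.min b k%:R[%classic)//.
  apply/seteqP; split=> x /=; rewrite !in_itv/= gt_max lt_min.
    by move=> [/andP[-> ->] /andP[-> ->]].
  by move=> /andP[/andP[-> ->] /andP[-> ->]].
have : {ae mu, forall x k, (w \_ `](- k%:R), k%:R[%classic) x = 0}.
  by apply/ae_foralln => k; exact: H.
move=> H2; apply: (filterS (F := almost_everywhere mu)) H2 => x /(_ (Num.truncn `|x|).+1).
rewrite patchE mem_set//=.
by rewrite in_itv/=; have := truncnS_gt `|x|; rewrite ltr_norml.
Qed.

End Fundamental1.

Section RealFubini.
Context d (T : measurableType d) {R : realType} (mu : {measure set T -> \bar R}).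

(** The inner integrals in Fubini's theorem are finite only almost everywhere; [fine] gives them
    real values without changing the outer integral. *)
Lemma Rintegrable_fine (F : T -> \bar R) : mu.-integrable setT F ->
  mu.-integrable setT (EFin \o (fine \o F)) /\
  (\int[mu]_x (fine (F x))%:E = \int[mu]_x F x)%E.
Proof.
move=> iF; have mF := measurable_int _ iF.
have mfF : measurable_fun setT (fun x => (fine (F x))%:E).
  by apply/measurable_EFinP; apply: measurableT_comp.
have E : ae_eq mu setT (fun x => (fine (F x))%:E) F.
  by have := integrable_ae measurableT iF; apply: filterS => x /(_ I) fx _; rewrite fineK.
split; last exact: ae_eq_integral.
apply: le_integrable iF => // x _ /=.
by case: (F x) => [r| |] //=; rewrite normr0 leey.
Qed.

Lemma integral_indic_prod (f : T -> R) (A : set T) : measurable A ->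
  mu.-integrable setT (EFin \o f) ->
  mu.-integrable setT (fun x => (f x * \1_A x)%:E) /\
  (\int[mu]_(x in A) (f x)%:E = (\int[mu]_x (f x * \1_A x))%:E)%E.
Proof.
move=> mA i; have iA : mu.-integrable A (EFin \o f).
  exact: (integrableS measurableT mA (@subsetT _ _) i).
have E x : (f x * \1_A x)%:E = ((EFin \o f) \_ A) x.
  by rewrite patchE indicE; case: ifP => _ /=; rewrite ?mulr1 ?mulr0.
split.
  by move: iA; rewrite integrable_mkcond//; apply: eq_integrable => // x _; rewrite E.
rewrite /Rintegral; under [in RHS]eq_integral do rewrite E.
by rewrite -integral_mkcond fineK//; exact: integrable_fin_num.
Qed.

End RealFubini.

Section RealFubini2.
Context d1 d2 (T1 : measurableType d1) (T2 : measurableType d2) (R : realType).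
Variable m1 : {sigma_finite_measure set T1 -> \bar R}.
Variable m2 : {sigma_finite_measure set T2 -> \bar R}.
Variable f : T1 * T2 -> R.
Hypothesis iF : (m1 \x m2)%E.-integrable setT (EFin \o f).

Lemma Rfubini12 :
  m1.-integrable setT (fun x => (\int[m2]_y f (x, y))%:E) /\
  \int[m1]_x \int[m2]_y f (x, y) = \int[(m1 \x m2)%E]_z f z.
Proof.
have [i E] := Rintegrable_fine (integrable_fubini_F iF).
by split => //; rewrite /Rintegral E integral12_prod_meas1.
Qed.

Lemma Rfubini21 :
  m2.-integrable setT (fun y => (\int[m1]_x f (x, y))%:E) /\
  \int[m2]_y \int[m1]_x f (x, y) = \int[(m1 \x m2)%E]_z f z.
Proof.
have mf : measurable_fun setT (EFin \o f) by exact: measurable_int iF.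
have iF' : (m2 \x m1)%E.-integrable setT (EFin \o (fun z => f (z.2, z.1))).
  apply/integrable12ltyP; first last.
    exact: ((@integrable21ltyP _ _ _ _ _ m1 m2 _ mf).1 iF).
  apply: (measurableT_comp mf (g := fun z : T2 * T1 => (z.2, z.1))).
  by apply/measurable_fun_pair => /=; [exact: measurable_snd|exact: measurable_fst].
have [i E] := Rintegrable_fine (integrable_fubini_F iF').
split => //; rewrite /Rintegral -(integral21_prod_meas1 iF); congr fine.
exact: E.
Qed.

End RealFubini2.

Section Fundamental2.
Context {R : realType}.
Local Notation RR := (measurableTypeR R).
Notation mu := (@leb1 R).

Let mitv (a b : R) : measurable (`]a, b[%classic : set RR).
Proof. exact: measurable_itv. Qed.

Lemma indic_prod (A B : set R) (x y : R) :
  \1_(A `*` B) (x, y) = \1_A x * \1_B y :> R.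
Proof.
rewrite !indicE -natrM mulnb; congr (_ %:R); congr nat_of_bool.
by apply/idP/andP => [|[]]; rewrite !inE; [case|].
Qed.

Lemma measurable_rectangles :
  @measurable _ (RR * RR)%type = <<s [set A `*` B | A in @measurable _ RR & B in @measurable _ RR] >>.
Proof. exact: measurable_prod_measurableType. Qed.

(** From intervals to measurable sets one factor at a time: with the other factor fixed, the partial
    integral is an integrable function of one variable whose integrals over intervals vanish, so it
    is 0 almost everywhere. *)
Lemma ae0_of_rectangles (v : R * R -> R) : (@leb2 R).-integrable setT (EFin \o v) ->
  (forall a b c d : R, \int[leb2]_z (v z *
    (\1_(`]a, b[%classic : set RR) z.1 * \1_(`]c, d[%classic : set RR) z.2)) = 0) ->
  {ae (@leb2 R), forall x, v x = 0}.
Proof.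
move=> iv v0.
pose PP (A B : set RR) : R := \int[leb2]_z (v z * (\1_A z.1 * \1_B z.2)).
have iP (A B : set RR) : measurable A -> measurable B -> (@leb2 R).-integrable setT
    (EFin \o (fun z : RR * RR => v z * (\1_A z.1 * \1_B z.2))).
  move=> mA mB; have [+ _] := integral_indic_prod (measurableX mA mB) iv.
  by apply: eq_integrable => // -[x y] _; rewrite /= indic_prod.
have iPA (A : set RR) : measurable A -> (@leb2 R).-integrable setT
    (EFin \o (fun z : RR * RR => v z * \1_A z.1)).
  move=> mA; apply: eq_integrable (iP A setT mA measurableT) => // z _.
  by rewrite /= indicT mulr1.
have iPB (B : set RR) : measurable B -> (@leb2 R).-integrable setT
    (EFin \o (fun z : RR * RR => v z * \1_B z.2)).
  move=> mB; apply: eq_integrable (iP setT B measurableT mB) => // z _.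
  by rewrite /= indicT mul1r.
have int_ind (w : RR -> R) (A : set RR) : measurable A -> mu.-integrable setT (EFin \o w) ->
    {ae mu, forall x, w x = 0} -> \int[mu]_x (w x * \1_A x) = 0.
  move=> mA iw w0; rewrite /Rintegral (@ae_eq_integral _ _ _ _ _ (cst 0%E)) ?integral0//.
    apply/measurable_EFinP; apply: measurable_funM; last exact: measurable_indic.
    by apply/measurable_EFinP; exact: measurable_int iw.
  by apply: filterS w0 => x -> _; rewrite mul0r.
have P12 (A B : set RR) : measurable A -> measurable B -> PP A B =
    \int[mu]_x ((\int[mu]_y (v (x, y) * \1_B y)) * \1_A x).
  move=> mA mB; rewrite /PP -(Rfubini12 (iP A B mA mB)).2; apply: eq_Rintegral => x _.
  rewrite /= indicE; case: (x \in A) => /=.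
    by rewrite mulr1; apply: eq_Rintegral => y _; rewrite mul1r.
  rewrite mulr0 /Rintegral; under eq_integral do rewrite mul0r mulr0.
  by rewrite integral0.
have P21 (A B : set RR) : measurable A -> measurable B -> PP A B =
    \int[mu]_y ((\int[mu]_x (v (x, y) * \1_A x)) * \1_B y).
  move=> mA mB; rewrite /PP -(Rfubini21 (iP A B mA mB)).2; apply: eq_Rintegral => y _.
  rewrite /= [\1_B y]indicE; case: (y \in B) => /=.
    by rewrite mulr1; apply: eq_Rintegral => x _; rewrite mulr1.
  rewrite mulr0 /Rintegral; under eq_integral do rewrite mulr0 mulr0.
  by rewrite integral0.
have i_ind (w : RR -> R) (a b : R) : mu.-integrable setT (EFin \o w) ->
    (\int[mu]_(x in `]a, b[%classic) (w x)%:E = (\int[mu]_x (w x * \1_(`]a, b[%classic : set RR) x))%:E)%E.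
  by move=> iw; have [] := integral_indic_prod (mitv a b) iw.
have PA (A : set RR) (c d : R) : measurable A -> PP A `]c, d[%classic = 0.
  move=> mA; rewrite P12//; apply: int_ind => //.
    by have [] := Rfubini12 (iPB _ (mitv c d)).
  apply: ae0_of_intervals => [|a b].
    by have [] := Rfubini12 (iPB _ (mitv c d)).
  rewrite i_ind; last by have [] := Rfubini12 (iPB _ (mitv c d)).
  by rewrite -P12// /PP v0.
have PAB (A B : set RR) : measurable A -> measurable B -> PP A B = 0.
  move=> mA mB; rewrite P21//; apply: int_ind => //.
    by have [] := Rfubini21 (iPA _ mA).
  apply: ae0_of_intervals => [|a b]; first by have [] := Rfubini21 (iPA _ mA).
  rewrite i_ind; last by have [] := Rfubini21 (iPA _ mA).
  by rewrite -P21// PA.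
apply: (@ae0_of_generator _ (RR * RR)%type R (@leb2 R) v _ (fun=> setT) iv measurable_rectangles) => //.
- move=> _ _ [A1 mA1 [B1 mB1 <-]] [A2 mA2 [B2 mB2 <-]].
  exists (A1 `&` A2); first exact: measurableI.
  by exists (B1 `&` B2); [exact: measurableI|rewrite setXI].
- by move=> k; exists setT => //; exists setT => //; rewrite setXTT.
- by apply/seteqP; split => // z _; exists 0%N.
- move=> _ [A mA [B mB <-]].
  have [_ ->] := integral_indic_prod (measurableX mA mB) iv.
  have -> : \int[leb2]_x (v x * \1_(A `*` B) x) = PP A B.
    by apply: eq_Rintegral => -[x y] _; rewrite indic_prod.
  by rewrite PAB.
Qed.

Definition box (M : R) : set (RR * RR) := `]- M, M[%classic `*` `]- M, M[%classic.

Lemma measurable_box M : measurable (box M).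
Proof. by apply: measurableX; exact: measurable_itv. Qed.

(** Products of bumps in each coordinate suffice, since rectangles generate the sigma-algebra of the
    plane. *)
Lemma fundamental2 (w : R * R -> R) : measurable_fun [set: RR * RR] w ->
  (forall M, (@leb2 R).-integrable (box M) (EFin \o w)) ->
  (forall f g, test1 f -> test1 g -> \int[leb2]_x (w x * (f x.1 * g x.2)) = 0) ->
  {ae (@leb2 R), forall x, w x = 0}.
Proof.
move=> mw iw w0.
have rect a b c d : (\int[leb2]_(z in (`]a, b[ `*` `]c, d[)%classic) (w z)%:E = 0)%E.
  pose M := `|a| + `|b| + `|c| + `|d| + 1.
  apply: (@int0_limit _ (RR * RR)%type R leb2 w _ (fun n z => bump a b n z.1 * bump c d n z.2)) => //.
  - by apply: measurableX; exact: measurable_itv.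
  - apply: (integrableS _ _ _ (iw M)); [exact: measurable_box|by apply: measurableX; exact: measurable_itv|].
    move=> [x y] [/= ]; rewrite !in_itv/= => /andP[ax xb] /andP[cy yd].
    have := ler_norm (- a); have := ler_norm b; have := ler_norm (- c); have := ler_norm d.
    rewrite !normrN => da db dc dd.
    have := normr_ge0 a; have := normr_ge0 b; have := normr_ge0 c; have := normr_ge0 d.
    move=> na nb nc nd; rewrite /box /M; split => /=; rewrite in_itv/=; apply/andP; split; lra.
  - move=> n; apply: measurable_funM.
      apply: (measurableT_comp (f := bump a b n)); last exact: measurable_fst.
      by apply: measurable_cinf; exact: cinf_bump.
    apply: (measurableT_comp (f := bump c d n)); last exact: measurable_snd.
    by apply: measurable_cinf; exact: cinf_bump.
  - move=> n [x y] /not_andP[] /= h; [rewrite bump_out ?mul0r//|rewrite [X in _ * X]bump_out ?mulr0//];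
      by move=> H; apply: h; rewrite in_itv.
  - by move=> n z; rewrite mulr_ge0 ?bump_ge0// mulr_ile1 ?bump_ge0 ?bump_le1.
  - by move=> [x y]; rewrite indic_prod; apply: cvgM; exact: bump_cvg.
  - by move=> n; apply: w0; exact: test1_bump.
have H (k : nat) : {ae (@leb2 R), forall x, (w \_ (box k%:R)) x = 0}.
  have iwk : (@leb2 R).-integrable setT (EFin \o w \_ (box k%:R)).
    by rewrite -restrict_EFin -integrable_mkcond//; exact: measurable_box.
  apply: ae0_of_rectangles => // a b c d.
  pose A : set (RR * RR) := (`]a, b[ `*` `]c, d[)%classic.
  have mA : measurable A by apply: measurableX; exact: measurable_itv.
  have [_ E] := integral_indic_prod mA iwk.
  transitivity (\int[leb2]_x ((w \_ (box k%:R)) x * \1_A x)).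
    by apply: eq_Rintegral => -[x y] _; rewrite indic_prod.
  apply: EFin_inj; rewrite -E integral_restrict.
  rewrite (_ : A `&` _ = (`]Num.max a (- k%:R), Num.min b k%:R[ `*`
    `]Num.max c (- k%:R), Num.min d k%:R[)%classic).
    exact: rect.
  apply/seteqP; split=> -[x y] /=; rewrite /A /box /= !in_itv/= !gt_max !lt_min.
    by move=> [[/andP[-> ->] /andP[-> ->]] [/andP[-> ->] /andP[-> ->]]].
  by move=> [/andP[/andP[-> ->] /andP[-> ->]] /andP[/andP[-> ->] /andP[-> ->]]].
have : {ae (@leb2 R), forall x (k : nat), (w \_ (box k%:R)) x = 0}.
  by apply/ae_foralln => k; exact: H.
move=> H2; apply: (filterS (F := almost_everywhere (@leb2 R))) H2 => x.
move=> /(_ (maxn (Num.truncn `|x.1|).+1 (Num.truncn `|x.2|).+1)).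
rewrite patchE mem_set//=.
set k := maxn _ _.
have k1 : `|x.1| < k%:R.
  by apply: lt_le_trans (truncnS_gt _) _; rewrite ler_nat leq_maxl.
have k2 : `|x.2| < k%:R.
  by apply: lt_le_trans (truncnS_gt _) _; rewrite ler_nat leq_maxr.
by split => /=; rewrite in_itv/= -ltr_norml.
Qed.

End Fundamental2.

(** * Integration in polar coordinates *)

Section PushforwardDensity.
Context d (T : measurableType d) {R : realType} (nu : {measure set T -> \bar R}).
Local Notation RR := (measurableTypeR R).
Notation mu := (@leb1 R).
Variables (w : T -> R) (phi : T -> RR) (h : R -> R).
Hypotheses (mw : measurable_fun setT w) (w0 : forall x, 0 <= w x).
Hypothesis mphi : measurable_fun setT phi.
Hypotheses (mh : measurable_fun [set: RR] h) (h0 : forall t, 0 <= h t).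
Hypothesis wh : forall a b : R, a < b ->
  (\int[nu]_(x in phi @^-1` `]a, b]) (w x)%:E = \int[mu]_(t in `]a, b]) (h t)%:E)%E.
Hypothesis hfin : forall a b : R, (\int[mu]_(t in `]a, b]) (h t)%:E < +oo)%E.

(** The image measure and the measure of density [h] agree on half-open intervals, where they are
    finite, hence everywhere. This is applied to [lrad] on the plane, for polar coordinates, and to
    its restriction to horizontal lines, for the change of variable there. *)
Lemma ge0_integral_pushforward_density (G : R -> R) :
  measurable_fun [set: RR] G -> (forall t, 0 <= G t) ->
  (\int[nu]_x (G (phi x) * w x)%:E = \int[mu]_t (G t * h t)%:E)%E.
Proof.
move=> mG G0.
pose pf := measure_function_pushforward__canonical__measure_function_Measure
  (density_measure nu mw w0) mphi.
have hw A : measurable A -> pf A = density_measure mu mh h0 A.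
  move=> mA; apply: (@g_sigma_algebra_measure_unique _ R RR (@ocitv R) _
    (fun k => `](- k%:R), k%:R]%classic) _ _ pf (density_measure mu mh h0)) => //.
  - exact: sub_sigma_algebra.
  - by move=> k; exact: is_ocitv.
  - apply/seteqP; split => // x _; exists (Num.truncn `|x|).+1 => //=.
    rewrite in_itv/=; have := truncnS_gt `|x|; rewrite ltr_norml => /andP[-> /ltW ->].
    by [].
  - exact: ocitvI.
  - move=> _ [[a b] _ <-] /=; rewrite /pushforward /density.
    have [ab|ba] := ltP a b; first exact: wh.
    by rewrite set_itv_ge ?preimage_set0 ?integral_set0// bnd_simp -leNgt.
  - move=> k; rewrite /pf /= /pushforward /density.
    have [ab|ba] := ltP (- k%:R) (k%:R : R); first by rewrite wh.
    by rewrite set_itv_ge ?preimage_set0 ?integral_set0// bnd_simp -leNgt.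
have mG' : measurable_fun setT (fun x => G (phi x)) by exact: (measurableT_comp mG).
rewrite -(ge0_integral_density nu mw w0)//.
rewrite -(ge0_integral_density mu mh h0)//.
transitivity (\int[pf]_t (G t)%:E)%E; last first.
  by apply: eq_measure_integral => A mA _; exact: hw.
rewrite ge0_integral_pushforward//; [exact/measurable_EFinP|].
by move=> x _; rewrite lee_fin.
Qed.

End PushforwardDensity.

Section Plane.
Context {R : realType}.
Local Notation RR := (measurableTypeR R).
Notation mu := (@leb1 R).
Notation mu2 := (@leb2 R).
Implicit Types F : R * R -> R.

Lemma tonelli12 (F : R * R -> R) : measurable_fun [set: RR * RR] F -> (forall z, 0 <= F z) ->
  (\int[mu2]_z (F z)%:E = \int[mu]_x \int[mu]_y (F (x, y))%:E)%E.
Proof.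
by move=> mF F0; rewrite /leb2 fubini_tonelli1//; exact/measurable_EFinP.
Qed.

Lemma tonelli21 (F : R * R -> R) : measurable_fun [set: RR * RR] F -> (forall z, 0 <= F z) ->
  (\int[mu2]_z (F z)%:E = \int[mu]_y \int[mu]_x (F (x, y))%:E)%E.
Proof.
move=> mF F0; rewrite tonelli12//.
have mF' : measurable_fun [set: RR * RR] (EFin \o F) by exact/measurable_EFinP.
by apply: (@fubini_tonelli _ _ _ _ _ mu mu _ mF') => z; rewrite lee_fin.
Qed.

Lemma measurable_section1 (F : R * R -> R) x : measurable_fun [set: RR * RR] F ->
  measurable_fun [set: RR] (fun y => F (x, y)).
Proof. by move=> mF; apply: measurableT_comp mF _; exact: pair1_measurable. Qed.

Lemma measurable_section2 (F : R * R -> R) y : measurable_fun [set: RR * RR] F ->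
  measurable_fun [set: RR] (fun x => F (x, y)).
Proof. by move=> mF; apply: measurableT_comp mF _; exact: pair2_measurable. Qed.

Lemma integral_scale r F : 0 < r -> measurable_fun [set: RR * RR] F -> (forall z, 0 <= F z) ->
  (\int[mu2]_z (F z)%:E = (r ^+ 2)%:E * \int[mu2]_z (F (r * z.1, r * z.2))%:E)%E.
Proof.
move=> r0 mF F0.
have mF1 : measurable_fun [set: RR * RR] (fun z => F (z.1, r * z.2)).
  apply: (measurableT_comp mF); apply/measurable_fun_pair; first exact: measurable_fst.
  by apply: measurable_funM => //; exact: measurable_snd.
have mF2 : measurable_fun [set: RR * RR] (fun z => F (r * z.1, r * z.2)).
  apply: (measurableT_comp mF); apply/measurable_fun_pair.
    by apply: measurable_funM => //; exact: measurable_fst.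
  by apply: measurable_funM => //; exact: measurable_snd.
rewrite expr2 EFinM -muleA tonelli21//=.
have E : (r%:E * \int[mu2]_z (F (r * z.1, r * z.2))%:E =
          \int[mu2]_z (F (z.1, r * z.2))%:E)%E.
  rewrite [RHS]tonelli21// tonelli21//= -ge0_integralZl//=.
  - apply: eq_integral => y _; rewrite [RHS](ge0_integral_affine 0 r0)//.
    + by congr (_ * _)%E; apply: eq_integral => x _; rewrite addr0.
    + exact: (measurable_section2 _ mF1).
  - apply: (@measurable_fun_fubini_tonelli_G _ _ RR RR R mu
      (fun z => (F (r * z.1, r * z.2))%:E)) => //=.
      exact/measurable_EFinP.
    by move=> z; rewrite lee_fin.
  - by move=> y _; apply: integral_ge0 => x _; rewrite lee_fin.
  - by rewrite lee_fin ltW.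
rewrite E -tonelli21// !tonelli12//= -ge0_integralZl//=.
- apply: eq_integral => x _; rewrite (ge0_integral_affine 0 r0)//.
  + by congr (_ * _)%E; apply: eq_integral => y _; rewrite addr0.
  + exact: (measurable_section1 _ mF).
- apply: (@measurable_fun_fubini_tonelli_F _ _ RR RR R mu
    (fun z => (F (z.1, r * z.2))%:E)) => //=.
    exact/measurable_EFinP.
  by move=> z; rewrite lee_fin.
- by move=> y _; apply: integral_ge0 => x _; rewrite lee_fin.
- by rewrite lee_fin ltW.
Qed.

Lemma measurable_enorm : measurable_fun [set: RR * RR] (@enorm R).
Proof.
apply: (@measurableT_comp _ _ _ (RR * RR)%type RR RR (@Num.sqrt R)).
  by apply: continuous_measurable_fun; exact: sqrt_continuous.
by apply: measurable_funD; apply: measurable_funX; [exact: measurable_fst|exact: measurable_snd].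
Qed.

Lemma leb2_prod (A B : set RR) : measurable A -> measurable B ->
  mu2 (A `*` B) = (mu A * mu B)%E.
Proof. exact: product_measure1E. Qed.

Definition disk (r : R) : set (RR * RR) := [set z | enorm z < r].

Lemma measurable_disk r : measurable (disk r).
Proof.
rewrite (_ : disk r = @enorm R @^-1` `]-oo, r[%classic); last first.
  by apply/seteqP; split => z; rewrite /disk /= in_itv.
rewrite -[X in measurable X]setTI; apply: (measurable_enorm measurableT).
exact: measurable_itv.
Qed.

Lemma enorm_scale (r : R) (z : R * R) : 0 <= r -> enorm (r * z.1, r * z.2) = r * enorm z.
Proof.
move=> r0; rewrite /enorm /= !exprMn -mulrDr sqrtrM ?sqr_ge0// sqrtr_sqr ger0_norm//.
Qed.

Lemma enorm_ge0 (z : R * R) : 0 <= enorm z. Proof. exact: sqrtr_ge0. Qed.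

Lemma enorm_sqr (z : R * R) : enorm z ^+ 2 = z.1 ^+ 2 + z.2 ^+ 2.
Proof. by rewrite sqr_sqrtr// addr_ge0// sqr_ge0. Qed.

Lemma le_enorm1 (z : R * R) : `|z.1| <= enorm z.
Proof. by rewrite -sqrtr_sqr ler_sqrt ?addr_ge0 ?sqr_ge0// lerDl sqr_ge0. Qed.

Lemma le_enorm2 (z : R * R) : `|z.2| <= enorm z.
Proof. by rewrite -sqrtr_sqr ler_sqrt ?addr_ge0 ?sqr_ge0// lerDr sqr_ge0. Qed.

Lemma disk_scale r : 0 < r -> mu2 (disk r) = ((r ^+ 2)%:E * mu2 (disk 1))%E.
Proof.
move=> r0; have mD := measurable_disk.
rewrite -(setIT (disk r)) -(setIT (disk 1)) -!integral_indic// (integral_scale r0)//.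
congr (_ * _)%E; apply: eq_integral => z _; rewrite !indicE.
congr (_ _)%:E; congr (nat_of_bool _); apply/idP/idP; rewrite !inE /disk /=;
  by rewrite enorm_scale ?(ltW r0)// -{2}[r]mulr1 ltr_pM2l.
Qed.

Lemma disk_fin r : (mu2 (disk r) < +oo)%E.
Proof.
have mI : measurable (`[- r, r]%classic : set RR) by exact: measurable_itv.
apply: (@le_lt_trans _ _ (mu2 (`[- r, r]%classic `*` `[- r, r]%classic))).
  apply: le_measure; rewrite ?inE; [exact: measurable_disk|exact: measurableX|].
  move=> z; rewrite /disk /= => zr; rewrite !in_itv/= -!ler_norml.
  by split; apply: le_trans (ltW zr); [exact: le_enorm1|exact: le_enorm2].
rewrite leb2_prod// leb1E lebesgue_measure_itv/= lte_fin.
by case: ifP => _; rewrite ?mule0// -!EFinD -EFinM ltry.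
Qed.

(** Scaling alone makes the area of a disk a multiple of [r ^ 2]; the constant stays abstract until
    the Gaussian integral identifies it. *)
Definition disk_area : R := fine (mu2 (disk 1)).

Lemma disk_areaE r : 0 < r -> mu2 (disk r) = (r ^+ 2 * disk_area)%:E.
Proof.
move=> r0; rewrite disk_scale// (EFinM (r ^+ 2)) /disk_area fineK// ge0_fin_numE ?measure_ge0//.
exact: disk_fin.
Qed.

Lemma measurable_origin : measurable ([set (0, 0)] : set (RR * RR)).
Proof.
rewrite (_ : [set (0, 0)] = [set 0 : RR] `*` [set 0 : RR]); first exact: measurableX.
by apply/seteqP; split => -[x y] /= => [[-> ->]|[-> ->]].
Qed.

Lemma origin_null : mu2 [set (0, 0) : RR * RR] = 0%E.
Proof.
rewrite (_ : [set (0, 0)] = [set 0 : RR] `*` [set 0 : RR]); last first.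
  by apply/seteqP; split => -[x y] /= => [[-> ->]|[-> ->]].
by rewrite leb2_prod// leb1E lebesgue_measure_set1 mule0.
Qed.

Lemma enorm_eq0 (z : R * R) : (enorm z == 0) = (z == (0, 0)).
Proof.
case: z => x y; rewrite /enorm sqrtr_eq0 /= le_eqVlt ltNge addr_ge0 ?sqr_ge0// orbF.
by rewrite paddr_eq0 ?sqr_ge0// !sqrf_eq0.
Qed.

(* At the origin the junk value [ln 0 = 0] gives [lrad (0, 0) = 0]. *)
Definition lrad (z : R * R) : R := - ln (enorm z).

Lemma measurable_lrad : measurable_fun [set: RR * RR] (lrad : RR * RR -> RR).
Proof.
apply: (@measurableT_comp _ _ _ (RR * RR)%type RR RR (fun x : R => - x)).
  by apply: continuous_measurable_fun => x; exact: oppr_continuous.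
apply: (@measurableT_comp _ _ _ (RR * RR)%type RR RR (@ln R)); first exact: measurable_ln.
exact: measurable_enorm.
Qed.

Lemma lrad_le (z : R * R) b : z != (0, 0) -> (lrad z <= b) = (expR (- b) <= enorm z).
Proof.
rewrite -enorm_eq0 => z0; have zp : 0 < enorm z by rewrite lt_neqAle eq_sym z0 enorm_ge0.
by rewrite /lrad lerNl -{2}(lnK (x := enorm z)) ?posrE// ler_expR.
Qed.

Lemma FTC_oc (F f : R -> R) a b : (forall x : R, is_derive (x : R) (1 : R) F (f x)) ->
  continuous f -> a <= b ->
  (\int[mu]_(x in `]a, b]) (f x)%:E = (F b - F a)%:E)%E.
Proof.
move=> Ff cf; rewrite le_eqVlt => /predU1P[->|ab].
  by rewrite set_itv_ge ?bnd_simp ?ltxx// integral_set0 subrr.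
have cF : continuous F.
  by move=> x; apply/differentiable_continuous/derivable1_diffP; have [] := Ff x.
rewrite /leb1 integral_itv_obnd_cbnd; last first.
  by apply/measurable_EFinP/measurable_funTS; exact: continuous_measurable_fun.
rewrite (continuous_FTC2 (F := F) ab).
- by rewrite EFinB.
- by apply: continuous_subspaceT => x; exact: cf.
- split; first by move=> x _; have [] := Ff x.
  + by apply: cvg_at_right_filter; exact: cF.
  + by apply: cvg_at_left_filter; exact: cF.
- by move=> x _; rewrite derive1E; apply: derive_val.
Qed.

Lemma is_derive_expM (k : R) (x : R) :
  is_derive (x : R) (1 : R) (fun t : R => expR (k * t)) (k * expR (k * x)).
Proof. rewrite mulrC; apply: (@is_derive1_comp _ expR (fun t => k * t)).
by rewrite -[X in is_derive _ _ _ X]mulr1; exact: is_deriveZ. Qed.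

Lemma integral_exp2 (a b : R) : a <= b ->
  (\int[mu]_(t in `]a, b]) (2 * disk_area * expR (- 2 * t))%:E =
   (disk_area * (expR (- 2 * a) - expR (- 2 * b)))%:E)%E.
Proof.
move=> ab.
have dF x : is_derive (x : R) (1 : R) (fun t : R => - disk_area * expR (- 2 * t))
    (2 * disk_area * expR (- 2 * x)).
  rewrite (_ : _ * _ = (- disk_area) *: (- 2 * expR (- 2 * x))).
    by apply: is_deriveZ; exact: is_derive_expM.
  by rewrite /GRing.scale /=; ring.
rewrite (FTC_oc dF)//.
- by congr EFin; ring.
- move=> x; apply: cvgM; first exact: cvg_cst.
  apply: continuous_comp; last exact: continuous_expR.
  by apply: cvgM; [exact: cvg_cst|exact: cvg_id].
Qed.

Lemma disk_area_ge0 : 0 <= disk_area.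
Proof. by rewrite fine_ge0// measure_ge0. Qed.

(** Up to the origin, the preimage of []a, b]] is the annulus between the circles of radii
    [expR (- b)] and [expR (- a)], whose area is the integral of the density over []a, b]]. *)
Lemma radial_integral_area (G : R -> R) : measurable_fun [set: RR] G -> (forall t, 0 <= G t) ->
  (\int[mu2]_z (G (lrad z))%:E = \int[mu]_t (G t * (2 * disk_area * expR (- 2 * t)))%:E)%E.
Proof.
move=> mG G0.
transitivity (\int[mu2]_z (G (lrad z) * cst 1 z)%:E)%E.
  by apply: eq_integral => z _; rewrite mulr1.
have mE : measurable_fun [set: RR] (fun t : R => 2 * disk_area * expR (- 2 * t)).
  apply: measurable_funM => //; apply: (measurableT_comp (@measurable_expR R)).
  exact: measurable_funM.
apply: (ge0_integral_pushforward_density (nu := mu2) (w := cst 1) (phi := lrad)) => //.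
- exact: measurable_lrad.
- by move=> t; rewrite !mulr_ge0 ?expR_ge0 ?disk_area_ge0.
- move=> a b ab; rewrite integral_exp2 ?(ltW ab)//.
  have mS : measurable (lrad @^-1` `]a, b]%classic : set (RR * RR)).
    by rewrite -[X in measurable X]setTI; apply: measurable_lrad.
  transitivity (mu2 (lrad @^-1` `]a, b]%classic)).
    by rewrite [LHS](integral_cst mu2 mS 1) mul1e.
  have mZ := measurable_origin.
  have mD := measurable_disk.
  (* The value of [lrad] at the origin is a convention, but the origin is a null set. *)
  have Z0 : mu2 (lrad @^-1` `]a, b]%classic `&` [set (0, 0)]) = 0%E.
    apply/eqP; rewrite eq_le measure_ge0 andbT -origin_null.
    by apply: le_measure; rewrite ?inE//; exact: measurableI.
  have DU : lrad @^-1` `]a, b]%classic `\` [set (0, 0)] =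
      disk (expR (- a)) `\` disk (expR (- b)).
    apply/seteqP; split => z /=.
      move=> [+ /eqP z0]; rewrite in_itv/= lrad_le// ltNge lrad_le// -ltNge => /andP[? ?].
      by split => //; rewrite /disk /= => ?; lra.
    move=> [/= z1 /negP]; rewrite /disk/= -leNgt => z2.
    have z0 : z != (0, 0).
      by apply: contraL z2 => /eqP ->; rewrite -ltNge /enorm/= expr0n/= addr0 sqrtr0 expR_gt0.
    split; last exact/eqP.
    by rewrite in_itv/= lrad_le// ltNge lrad_le// -ltNge z2 andbT.
  rewrite -(setUIDK (lrad @^-1` `]a, b]%classic) [set (0, 0)]).
  rewrite measureU//; [|exact: measurableI|exact: measurableD|]; last first.
    by apply/seteqP; split => z //= -[[_ ?] []].
  rewrite [X in (X + _)%E]Z0 add0e DU measureD//; last exact: disk_fin.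
  have sub : disk (expR (- b)) `<=` disk (expR (- a)).
    move=> z; rewrite /disk /= => /lt_trans; apply; rewrite ltr_expR; lra.
  rewrite setIidr// [X in (X - _)%E](disk_areaE (expR_gt0 _)).
  rewrite [X in (_ - X)%E](disk_areaE (expR_gt0 _)) -EFinB; congr EFin.
  rewrite -!expRM_natl mulrBr.
  have E t : 2%:R * - t = - 2 * t :> R by rewrite mulrN mulNr.
  by rewrite !E; ring.
- move=> a b; have [ab|ba] := leP a b; first by rewrite integral_exp2// ltry.
  by rewrite set_itv_ge ?integral_set0// bnd_simp -leNgt ltW.
Qed.

Lemma ae_origin (P : R * R -> Prop) : (forall z, z != (0, 0) -> P z) ->
  {ae mu2, forall z, P z}.
Proof.
move=> Pz; exists [set (0, 0)]; split; [exact: measurable_origin|exact: origin_null|].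
by move=> z /= nP; apply/eqP; rewrite -[_ == _]negbK; apply: contra_notN nP => /Pz.
Qed.

Lemma integral_gauss2 : (\int[mu2]_z (expR (- enorm z ^+ 2))%:E = pi%:E)%E.
Proof.
have m1 : measurable_fun [set: RR] (@gauss_fun R) by exact: measurable_gauss_fun.
under eq_integral do rewrite enorm_sqr opprD expRD -!/(gauss_fun _).
rewrite tonelli12/=; last first.
- by move=> z; rewrite mulr_ge0// gauss_fun_ge0.
- apply: measurable_funM; apply: (measurableT_comp m1); [exact: measurable_fst|].
  exact: measurable_snd.
transitivity (\int[mu]_x ((Num.sqrt pi)%:E * (gauss_fun x)%:E))%E.
  apply: eq_integral => x _; under eq_integral do rewrite EFinM.
  rewrite ge0_integralZl//=.
  - by rewrite -integralT_gauss muleC.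
  - exact/measurable_EFinP.
  - by move=> y _; rewrite lee_fin gauss_fun_ge0.
  - by rewrite lee_fin gauss_fun_ge0.
rewrite ge0_integralZl//=.
- by rewrite [X in (_ * X)%E](@integralT_gauss R) -EFinM -expr2 sqr_sqrtr// pi_ge0.
- exact/measurable_EFinP.
- by move=> y _; rewrite lee_fin gauss_fun_ge0.
Qed.

(* Both sides are read off the Gaussian integral over the plane. *)
Lemma disk_area_pi : disk_area = pi.
Proof.
(* Away from the origin [G (lrad z)] is [expR (- |z| ^ 2)], and [disk_area * G] is a primitive of
   its radial density, with limits 0 and [disk_area] at the two ends of the line. *)
pose G (t : R) := expR (- expR (- 2 * t)).
have ce (k : R) : continuous (fun t : R => expR (k * t)).
  move=> x; apply: continuous_comp; last exact: continuous_expR.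
  by apply: cvgM; [exact: cvg_cst|exact: cvg_id].
have cG : continuous G.
  move=> x; apply: continuous_comp; last exact: continuous_expR.
  by apply: cvgN; exact: ce.
have mG : measurable_fun [set: RR] G by exact: continuous_measurable_fun.
pose g t := G t * (2 * disk_area * expR (- 2 * t)).
have dG (x : R) : is_derive (x : R) (1 : R) (fun t => disk_area * G t) (g x).
  rewrite (_ : g x = disk_area *: (G x * (- (- 2 * expR (- 2 * x))))); last first.
    by rewrite /g /GRing.scale /=; ring.
  apply: is_deriveZ; apply: (@is_derive1_comp _ expR (fun t => - expR (- 2 * t))).
  by apply: is_deriveN; exact: is_derive_expM.
have cg : continuous g.
  by move=> x; apply: cvgM; [exact: cG|apply: cvgM; [exact: cvg_cst|exact: ce]].
have g0 x : 0 <= g x by rewrite !mulr_ge0 ?expR_ge0 ?disk_area_ge0.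
have mg : measurable_fun [set: RR] g by exact: continuous_measurable_fun.
apply/EFin_inj; rewrite -integral_gauss2.
transitivity (\int[mu2]_z (G (lrad z))%:E)%E; last first.
  apply: ae_eq_integral => //.
  - apply/measurable_EFinP/(measurableT_comp mG); exact: measurable_lrad.
  - apply/measurable_EFinP/(measurableT_comp (@measurable_expR R)).
    by apply: measurable_funN; apply: measurable_funX; exact: measurable_enorm.
  - apply: ae_origin => z; rewrite -enorm_eq0 => z0 _.
    have zp : 0 < enorm z by rewrite lt_neqAle eq_sym z0 enorm_ge0.
    by rewrite /G /lrad mulrNN mulr_natl -lnXn// lnK// posrE exprn_gt0.
rewrite radial_integral_area//; last by move=> t; exact: expR_ge0.
pose A (n : nat) : set RR := `](- n%:R), n%:R]%classic.
have AT : \bigcup_n A n = setT.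
  apply/seteqP; split => // x _; exists (Num.truncn `|x|).+1 => //=.
  rewrite /A /= in_itv/=; have := truncnS_gt `|x|; rewrite ltr_norml => /andP[-> /ltW ->].
  by [].
have lim1 : (\int[mu]_(x in A n) (g x)%:E)%E @[n --> \oo] --> (\int[mu]_x (g x)%:E)%E.
  rewrite -[in X in _ --> X]AT.
  apply: ge0_nondecreasing_set_cvg_integral.
  - move=> m n mn; rewrite subsetEset => x; rewrite /A /= !in_itv/= => /andP[x1 x2].
    have : (m%:R <= n%:R :> R) by rewrite ler_nat.
    by move=> ?; apply/andP; split; lra.
  - by move=> n; exact: measurable_itv.
  - by move=> n; apply/measurable_funTS/measurable_EFinP.
  - by move=> n x _; rewrite lee_fin.
have e0 : expR (- 2 * (n%:R : R)) @[n --> \oo] --> (0 : R).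
  under eq_fun do rewrite mulNr.
  apply: (@cvg_comp _ _ _ (fun n : nat => 2 * n%:R : R) (fun x => expR (- x)) _ +oo%R).
    apply/cvgryPge => B; apply: filterS (nbhs_infty_ger B) => n nB.
    by have := ler0n R n; lra.
  exact: cvgr_expR.
have lim2 : (\int[mu]_(x in A n) (g x)%:E)%E @[n --> \oo] --> disk_area%:E.
  rewrite (_ : (fun n => _) = fun n : nat =>
    (disk_area * G n%:R - disk_area * G (- n%:R))%:E); last first.
    apply/funext => n; apply: (FTC_oc dG) => //.
    by rewrite -subr_ge0 opprK addr_ge0.
  apply: cvg_EFin; first exact: nearW.
  rewrite -[X in _ --> X]subr0 -[X in X - _]mulr1 -[X in _ - X](mulr0 disk_area).
  apply: cvgB; apply: cvgM; try exact: cvg_cst.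
  - rewrite -[X in _ --> X]expR0 -[X in expR X]oppr0.
    apply: (@cvg_comp _ _ _ (fun n : nat => - expR (- 2 * n%:R) : R) (@expR R) _ (nbhs (- 0 : R))).
      exact: cvgN.
    exact: continuous_expR.
  - apply: (@cvg_comp _ _ _ (fun n : nat => expR (- 2 * - n%:R) : R) (fun x => expR (- x)) _ +oo%R).
      apply/cvgryPge => B; apply: filterS (nbhs_infty_ger B) => n nB.
      rewrite mulrNN; have := expR_ge1Dx (2 * n%:R : R); have := ler0n R n; lra.
    exact: cvgr_expR.
exact: (cvg_unique _ lim2 lim1).
Qed.

Lemma radial_integral (G : R -> R) : measurable_fun [set: RR] G -> (forall t, 0 <= G t) ->
  (\int[mu2]_z (G (lrad z))%:E = \int[mu]_t (G t * (2 * pi * expR (- 2 * t)))%:E)%E.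
Proof. by move=> mG G0; rewrite radial_integral_area// disk_area_pi. Qed.

End Plane.

(** * Absolutely continuous functions on the line *)

Section Primitives.
Context {R : realType}.
Local Notation RR := (measurableTypeR R).
Notation mu := (@leb1 R).
Notation mu2 := (@leb2 R).
Notation L2 := (Lfun mu 2%:E).
Local Notation ip := (ip mu).
Implicit Types f g v : R -> R.

Definition loc_int g := measurable_fun [set: RR] g /\
  forall M : R, mu.-integrable `[- M, M]%classic (EFin \o g).

(** Absolute continuity with derivative [g] in integrated form, so that differentiability almost
    everywhere never enters. *)
Definition primitive v g := forall a b : R, a <= b -> v b - v a = \int[mu]_(t in `]a, b]) g t.

Lemma Rint_indic d (T : measurableType d) (nu : {measure set T -> \bar R}) (A : set T) (f : T -> R) :
  \int[nu]_(x in A) f x = \int[nu]_x (f x * \1_A x).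
Proof.
rewrite Rintegral_mkcond; apply: eq_Rintegral => x _.
by rewrite patchE indicE; case: ifP => _; rewrite ?mulr1 ?mulr0.
Qed.

Lemma integrable_indic_prod d (T : measurableType d) (nu : {measure set T -> \bar R})
    (A : set T) (f : T -> R) : measurable A -> nu.-integrable A (EFin \o f) ->
  nu.-integrable setT (EFin \o (fun x => f x * \1_A x)).
Proof.
move=> mA; rewrite integrable_mkcond//; apply: eq_integrable => // x _ /=.
by rewrite patchE indicE; case: ifP => _ /=; rewrite ?mulr1 ?mulr0.
Qed.

Lemma subitv (A : set R) a b : (forall x, A x -> a <= x <= b) ->
  A `<=` `[- (`|a| + `|b|), `|a| + `|b|]%classic.
Proof.
move=> Aab x /Aab /andP[ax xb]; rewrite /= in_itv/= -ler_norml ler_norml.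
apply/andP; split.
  by have := ler_norm (- a); rewrite normrN; have := normr_ge0 b; lra.
by have := ler_norm b; have := normr_ge0 a; lra.
Qed.

Lemma loc_int_cc g a b : loc_int g -> mu.-integrable `[a, b]%classic (EFin \o g).
Proof.
move=> [mg ig]; apply: (integrableS _ _ _ (ig (`|a| + `|b|))) => //.
by apply: subitv => x /=; rewrite in_itv.
Qed.

Lemma loc_int_oc g a b : loc_int g -> mu.-integrable `]a, b]%classic (EFin \o g).
Proof.
move=> [mg ig]; apply: (integrableS _ _ _ (ig (`|a| + `|b|))) => //.
by apply: subitv => x /=; rewrite in_itv/= => /andP[/ltW -> ->].
Qed.

Lemma loc_int_oo g a b : loc_int g -> mu.-integrable `]a, b[%classic (EFin \o g).
Proof.
move=> [mg ig]; apply: (integrableS _ _ _ (ig (`|a| + `|b|))) => //.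
by apply: subitv => x /=; rewrite in_itv/= => /andP[/ltW -> /ltW ->].
Qed.

Lemma continuous_loc_int g : continuous g -> loc_int g.
Proof.
move=> cg; split; first exact: continuous_measurable_fun.
move=> M; apply: continuous_compact_integrable; first exact: segment_compact.
by apply: continuous_subspaceT => x; exact: cg.
Qed.

Lemma L2_loc_int g : g \in L2 -> loc_int g.
Proof.
move=> g2; split; first exact: (Lfun2_measurable g2).
move=> M; have mI : measurable (`[- M, M]%classic : set RR) by exact: measurable_itv.
apply/integrable_mkcond => //.
have i1 : (\1_(`[- M, M]%classic) : R -> R) \in L2.
  apply/Lfun2P; split; first exact: measurable_indic.
  have E x : (\1_(`[- M, M]%classic) x : R) ^+ 2 = \1_(`[- M, M]%classic) x.
    by rewrite indicE; case: (_ \in _); rewrite ?expr1n ?expr0n.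
  under eq_integral do rewrite E.
  rewrite integral_indic//= setIT lebesgue_measure_itv/=.
  by case: ifP => _; rewrite -?EFinB ltry.
apply: eq_integrable (L2_integrable_prod g2 i1) => // x _.
by rewrite patchE indicE; case: ifP => _ /=; rewrite ?mulr1 ?mulr0.
Qed.

Lemma Rint_cat g a b c : loc_int g -> a <= b -> b <= c ->
  \int[mu]_(t in `]a, c]) g t = \int[mu]_(t in `]a, b]) g t + \int[mu]_(t in `]b, c]) g t.
Proof.
move=> ig ab bc; apply/eqP; rewrite addrC -subr_eq; apply/eqP.
by apply: Rintegral_itvB; [exact: loc_int_oc|rewrite bnd_simp|rewrite bnd_simp].
Qed.

Lemma R_FTC (F f : R -> R) a b : (forall x : R, is_derive (x : R) (1 : R) F (f x)) ->
  continuous f -> a <= b -> \int[mu]_(x in `]a, b]) f x = F b - F a.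
Proof. by move=> Ff cf ab; rewrite /Rintegral (FTC_oc Ff cf ab). Qed.

Lemma tensor_integrable (f g : R -> R) :
  mu.-integrable setT (EFin \o f) -> mu.-integrable setT (EFin \o g) ->
  mu2.-integrable setT (EFin \o (fun z : R * R => f z.1 * g z.2)).
Proof.
move=> /integrableP[/measurable_EFinP mf fi] /integrableP[/measurable_EFinP mg gi].
apply/integrable12ltyP.
  apply/measurable_EFinP/measurable_funM.
    by apply: (measurableT_comp mf); exact: measurable_fst.
  by apply: (measurableT_comp mg); exact: measurable_snd.
apply: le_lt_trans (_ : (\int[mu]_x `|f x|%:E * \int[mu]_y `|g y|%:E < +oo)%E).
  rewrite -ge0_integralZr//=.
  - apply: ge0_le_integral => //=.
    + by move=> x _; apply: integral_ge0 => y _.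
    + apply: (@measurable_fun_fubini_tonelli_F _ _ RR RR R mu
        (fun z => (`|f z.1 * g z.2|)%:E)) => //=.
      apply/measurable_EFinP/measurableT_comp => //; apply: measurable_funM.
        by apply: (measurableT_comp mf); exact: measurable_fst.
      by apply: (measurableT_comp mg); exact: measurable_snd.
    + apply: emeasurable_funM => //; apply/measurable_EFinP; exact: measurableT_comp.
    + move=> x _; under eq_integral do rewrite normrM EFinM.
      rewrite ge0_integralZl//=; apply/measurable_EFinP; exact: measurableT_comp.
  - by apply/measurable_EFinP; exact: measurableT_comp.
  - by apply: integral_ge0 => y _; rewrite lee_fin.
by apply: lte_mul_pinfty => //; [exact: integral_ge0|rewrite ge0_fin_numE//; exact: integral_ge0].
Qed.

(** Fubini for [g s * f' t] over [- M < s <= M], [s < t]: integrating in [s] yields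
    [(v t - v (- M)) * f' t], integrating in [t] yields [- (g s * f s)], since [f] vanishes at
    [M]. *)
Lemma ac_ibp (v g f f' : R -> R) (M : R) : loc_int g -> primitive v g ->
  (forall x, is_derive (x : R) (1 : R) f (f' x)) -> continuous f' -> 0 <= M ->
  (forall x, M <= `|x| -> f x = 0) -> (forall x, M <= `|x| -> f' x = 0) ->
  mu.-integrable setT (EFin \o (fun x => v x * f' x)) /\
  \int[mu]_x (v x * f' x) = - \int[mu]_x (g x * f x).
Proof.
move=> ig vg df cf' M0 fM f'M.
have [mg _] := ig; have [mf' _] := continuous_loc_int cf'.
have NM : - M <= M by rewrite ge0_cp.
have fMM : f M = 0 by rewrite fM// ler_norm.
have fNM : f (- M) = 0 by rewrite fM// normrN ler_norm.
have out x : x \notin (`]- M, M]%classic : set R) -> M <= `|x|.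
  rewrite notin_setE/= in_itv/= => /negP n.
  rewrite leNgt; apply: contra n; rewrite ltr_norml => /andP[-> /ltW]; exact.
have f'E x : f' x * \1_(`]- M, M]%classic) x = f' x.
  by rewrite indicE; case: (boolP (x \in _)) => [|/out/f'M ->]; rewrite ?mulr1 ?mul0r.
have mI : measurable (`]- M, M]%classic : set RR) by exact: measurable_itv.
have i1 : mu.-integrable setT (EFin \o (fun x => g x * \1_(`]- M, M]%classic) x)).
  by apply: integrable_indic_prod => //; exact: loc_int_oc.
have i2 : mu.-integrable setT (EFin \o f').
  rewrite (_ : f' = fun x => f' x * \1_(`]- M, M]%classic) x); last first.
    by apply/funext => x; rewrite f'E.
  by apply: integrable_indic_prod => //; apply: loc_int_oc; exact: continuous_loc_int.
pose lt2 (z : R * R) : R := \1_([set z : RR * RR | 0 < z.2 - z.1]) z.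
have mlt2 : measurable_fun [set: RR * RR] lt2.
  apply: measurable_indic.
  rewrite (_ : [set z | _] = (fun z : RR * RR => z.2 - z.1) @^-1` `]0, +oo[%classic); last first.
    by apply/seteqP; split => z; rewrite /= in_itv/= andbT.
  rewrite -[X in measurable X]setTI; apply: measurable_funB => //.
pose k z := (g z.1 * \1_(`]- M, M]%classic) z.1) * f' z.2 * lt2 z.
have ik : mu2.-integrable setT (EFin \o k).
  apply: le_integrable (tensor_integrable i1 i2) => //.
    apply/measurable_EFinP; apply: measurable_funM => //.
    apply/measurable_EFinP; exact: measurable_int (tensor_integrable i1 i2).
  move=> z _ /=; rewrite lee_fin /k normrM ler_piMr// /lt2 indicE.
  by case: (_ \in _); rewrite ?normr1 ?normr0.
have kA t : \int[mu]_s k (s, t) = f' t * v t - v (- M) * f' t.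
  have [tM|tM] := leP M `|t|.
    rewrite f'M// mul0r mulr0 subrr; under eq_Rintegral do rewrite /k/= f'M// mulr0 mul0r.
    by rewrite /Rintegral integral0.
  move: (tM); rewrite ltr_norml => /andP[t1 t2].
  have io := loc_int_oo (- M) t ig.
  rewrite [X in _ - X]mulrC -mulrBr (vg _ _ (ltW t1)) -(Rintegral_itv_bndo_bndc io).
  have mt : measurable (`]- M, t[%classic : set RR) by exact: measurable_itv.
  rewrite [X in _ * X]Rint_indic -(RintegralZl _ _ (integrable_indic_prod mt io))//.
  apply: eq_Rintegral => s _; rewrite /k/= /lt2 mulrAC [RHS]mulrC; congr (_ * _).
  rewrite -mulrA !indicE; congr (_ * _); rewrite -natrM mulnb; congr (nat_of_bool _)%:R.
  apply/idP/idP; rewrite !inE/= ?in_itv/=.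
    by move=> /andP[]; rewrite !inE/= in_itv/= subr_gt0 => /andP[-> _] ->.
  move=> /andP[s1 s2]; apply/andP; rewrite !inE/= in_itv/= subr_gt0 s1 s2; split => //.
  exact: ltW (lt_trans s2 t2).
have kB s : \int[mu]_t k (s, t) = - (g s * f s).
  case: (boolP (s \in (`]- M, M]%classic : set R))) => [|sM]; last first.
    have I0 : \1_(`]- M, M]%classic : set R) s = 0 :> R by rewrite indicE (negbTE sM).
    rewrite fM ?out// mulr0 oppr0; under eq_Rintegral do rewrite /k/= I0 mulr0 !mul0r.
    by rewrite /Rintegral integral0.
  move=> sI; have I1 : \1_(`]- M, M]%classic : set R) s = 1 :> R by rewrite indicE sI.
  have := sI; rewrite inE/= in_itv/= => /andP[s1 s2].
  rewrite -mulrN -[- f s]add0r -fMM -(R_FTC df cf' s2) Rint_indic -RintegralZl//; last first.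
    by apply: integrable_indic_prod => //; apply: loc_int_oc; exact: continuous_loc_int.
  apply: eq_Rintegral => t _; rewrite /k/= I1 mulr1 -mulrA; congr (_ * _).
  have [tM|tM] := leP M `|t|; first by rewrite f'M// !mul0r.
  congr (_ * _); rewrite /lt2 !indicE; congr (nat_of_bool _)%:R.
  apply/idP/idP; rewrite !inE/= in_itv/= subr_gt0; last by move=> /andP[].
  by move=> ->; rewrite ltW// (le_lt_trans (ler_norm t)).
have [j1 E1] := Rfubini12 ik; have [j2 E2] := Rfubini21 ik.
have ivf : mu.-integrable setT (EFin \o (fun x => v x * f' x)).
  have := integrableD measurableT j2 (integrableZl measurableT (v (- M)) i2).
  by apply: eq_integrable => // x _; rewrite /= kA -EFinM -EFinD; congr EFin; ring.
split => //.
have j3 := integrableZl measurableT (v (- M)) i2.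
(* The constant [v (- M)] contributes nothing, since [f] vanishes at both ends. *)
have v0 : \int[mu]_x (v (- M) * f' x) = 0.
  rewrite RintegralZl//; under eq_Rintegral do rewrite -f'E.
  by rewrite -Rint_indic (R_FTC df)// fMM fNM subrr mulr0.
have igf : mu.-integrable setT (EFin \o (fun x => g x * f x)).
  have := integrableZl measurableT (- 1) j1; apply: eq_integrable => // x _ /=.
  by rewrite kB -EFinM mulN1r opprK.
rewrite -[LHS]subr0 -v0 -RintegralB//.
rewrite -[RHS]mulN1r -[RHS]RintegralZl//.
transitivity (\int[mu]_y \int[mu]_x k (x, y)).
  by apply: eq_Rintegral => t _; rewrite kA mulrC.
by rewrite E2 -E1; apply: eq_Rintegral => s _; rewrite kB mulN1r.
Qed.

Definition antideriv g : R -> R := fun x =>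
  if 0 <= x then \int[mu]_(t in `]0, x]) g t else - \int[mu]_(t in `]x, 0]) g t.

Lemma primitive_antideriv g : loc_int g -> primitive (antideriv g) g.
Proof.
move=> ig a b ab; rewrite /antideriv; have [b0|b0] := leP 0 b; have [a0|a0] := leP 0 a.
- by rewrite (Rint_cat ig a0 ab) addrAC subrr add0r.
- by rewrite opprK addrC -Rint_cat// ltW.
- by have := le_lt_trans a0 (le_lt_trans ab b0); rewrite ltxx.
- by rewrite opprK addrC (Rint_cat ig ab (ltW b0)) addrK.
Qed.

Lemma indic_oc_L2 (a b : R) : (\1_(`]a, b]%classic) : R -> R) \in L2.
Proof.
have mI : measurable (`]a, b]%classic : set RR) by exact: measurable_itv.
apply/Lfun2P; split; first exact: measurable_indic.
have E x : (\1_(`]a, b]%classic) x : R) ^+ 2 = \1_(`]a, b]%classic) x.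
  by rewrite indicE; case: (_ \in _); rewrite ?expr1n ?expr0n.
under eq_integral do rewrite E.
rewrite integral_indic//= setIT lebesgue_measure_itv/=.
by case: ifP => _; rewrite -?EFinB ltry.
Qed.

Lemma ip_indic_oc (a b : R) : a <= b ->
  ip (\1_(`]a, b]%classic) : R -> R) (\1_(`]a, b]%classic) : R -> R) = b - a.
Proof.
move=> ab; have mI : measurable (`]a, b]%classic : set RR) by exact: measurable_itv.
rewrite /ip -Rint_indic /Rintegral.
under eq_integral => x xI do rewrite indicE xI.
rewrite integral_cst//= mul1e lebesgue_measure_itv/= lte_fin.
by move: ab; rewrite le_eqVlt => /predU1P[->|->]; rewrite ?ltxx ?subrr//= -EFinB.
Qed.

Lemma primitive_holder v g a b : g \in L2 -> primitive v g -> a <= b ->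
  (v b - v a) ^+ 2 <= (b - a) * ip (g \_ `]a, b]%classic) (g \_ `]a, b]%classic).
Proof.
move=> g2 vg ab; have mI : measurable (`]a, b]%classic : set RR) by exact: measurable_itv.
have gI := L2_restrict mI g2.
have -> : v b - v a = ip (g \_ `]a, b]%classic) (\1_(`]a, b]%classic) : R -> R).
  rewrite vg// Rint_indic; apply: eq_Rintegral => x _.
  by rewrite patchE indicE; case: ifP => // _; rewrite !mulr0.
rewrite mulrC -(ip_indic_oc ab).
apply: (ph_CS (L2on_preHilbert mu measurableT)); split=> //; try by move=> x /(_ I).
exact: indic_oc_L2.
Qed.

Lemma primitive_holderT v g a b : g \in L2 -> primitive v g ->
  (v b - v a) ^+ 2 <= `|b - a| * ip g g.
Proof.
move=> g2 vg; wlog ab : a b / a <= b.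
  move=> H; have [ab|/ltW ba] := leP a b; first exact: H.
  by rewrite -sqrrN opprB distrC; exact: H.
apply: le_trans (primitive_holder g2 vg ab) _.
rewrite ger0_norm ?subr_ge0// ler_wpM2l ?subr_ge0//.
by apply: ip_restrict_le => //; exact: measurable_itv.
Qed.

Lemma primitive_continuous v g : g \in L2 -> primitive v g -> continuous v.
Proof.
move=> g2 vg x; apply/cvgrPdist_le => eps eps0.
have e0 : 0 < eps ^+ 2 / (ip g g + 1) by rewrite divr_gt0 ?exprn_gt0// ltr_wpDl// ip_ge0.
near=> y; rewrite -(@ler_pXn2r _ 2) ?nnegrE ?(ltW eps0)// real_normK ?num_real//.
apply: le_trans (primitive_holderT y x g2 vg) _.
have : `|x - y| <= eps ^+ 2 / (ip g g + 1) by near: y; exact: cvgr_dist_le.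
rewrite ler_pdivlMr ?ltr_wpDl ?ip_ge0//; apply: le_trans.
by rewrite ler_wpM2l// lerDl.
Unshelve. all: by end_near. Qed.

Lemma is_derive_antideriv g (x : R) : continuous g -> is_derive x (1 : R) (antideriv g) (g x).
Proof.
move=> cg; have ig := continuous_loc_int cg; have pg := primitive_antideriv ig.
pose F y := \int[mu]_(t in `]x - 1, y]) g t.
have [] := @continuous_FTC1 R g (BRight (x - 1)) x (x + 1).
- lra.
- exact: loc_int_oc.
- by rewrite /Order.lt/=; lra.
- exact: cg.
rewrite derive1E -/F => dF Fx.
apply: (near_eq_is_derive (f := fun y => antideriv g (x - 1) + F y)).
  near=> y; rewrite /F -pg; first by rewrite addrCA subrr addr0.
  apply/ltW; near: y; apply: lt_nbhsr; lra.
rewrite -[X in is_derive _ _ _ X]add0r; apply: is_deriveD.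
exact: DeriveDef.
Unshelve. all: by end_near. Qed.

Lemma continuous_cinf g : cinf g -> continuous g.
Proof. by move=> gC x; apply/differentiable_continuous/derivable1_diffP; exact: cinf_derivable. Qed.

Lemma is_derive_cinf g (x : R) : cinf g -> is_derive x (1 : R) g ((g^`())%classic x).
Proof. by move=> gC; apply: DeriveDef; [exact: cinf_derivable|rewrite derive1E]. Qed.

Lemma derive_support g (S : R) : (forall x, S < `|x| -> g x = 0) ->
  forall x : R, S < `|x| -> (g^`())%classic x = 0.
Proof.
move=> gS x xS; rewrite derive1E (near_eq_derive (g := cst 0)); first exact: derive_cst.
near=> y; rewrite gS//; near: y.
apply: (@cvgr_gt _ _ _ _ (fun y : R => `|y|) `|x|) => //.
by apply: cvg_norm; exact: cvg_id.
Unshelve. all: by end_near. Qed.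

Lemma test1_derive f : test1 f -> test1 (f^`())%classic.
Proof.
move=> [fC [S Sf]]; split; first exact: cinf_derive.
by exists S; exact: derive_support.
Qed.

Lemma test1_bounded f : test1 f -> exists M, forall x, `|f x| <= M.
Proof.
move=> [fC [S Sf]]; have NS : - `|S| <= `|S| by rewrite ge0_cp.
have cf : {within `[- `|S|, `|S|], continuous (fun x => `|f x|)}.
  apply: continuous_subspaceT => x; apply: continuous_comp; first exact: continuous_cinf.
  exact: norm_continuous.
have [c cI cM] := EVT_max NS cf.
exists `|f c| => x; have [xS|xS] := leP `|x| `|S|; first by apply: cM; rewrite in_itv/= -ler_norml.
by rewrite Sf ?normr0// (le_lt_trans (ler_norm S)).
Qed.

Lemma test1_support f : test1 f -> exists2 M : R, 0 <= M & forall x, M <= `|x| -> f x = 0.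
Proof.
move=> [_ [S Sf]]; exists (`|S| + 1) => [|x xS]; first by rewrite addr_ge0.
by apply: Sf; apply: lt_le_trans xS; rewrite ltr_pwDr// ler_norm.
Qed.

Lemma loc_int_test v f : loc_int v -> test1 f ->
  mu.-integrable setT (EFin \o (fun x => v x * f x)).
Proof.
move=> iv tf; have [M M0 fM] := test1_support tf; have [C fC] := test1_bounded tf.
have mI : measurable (`[- M, M]%classic : set RR) by exact: measurable_itv.
have := integrable_indic_prod mI (iv.2 M) => i1.
have C0 : 0 <= C by exact: le_trans (normr_ge0 _) (fC 0).
apply: le_integrable (integrableZl measurableT C i1) => //.
  by apply/measurable_EFinP/measurable_funM; [case: iv|apply: measurable_cinf; case: tf].
move=> x _ /=; rewrite lee_fin -/(GRing.mul _ _) !normrM (ger0_norm C0) indicE.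
case: (boolP (x \in _)) => [_|]; first by rewrite normr1 mulr1 mulrC ler_wpM2r.
rewrite notin_setE/= in_itv/= -ler_norml => /negP; rewrite -ltNge => /ltW /fM ->.
by rewrite normr0 !mulr0.
Qed.

Lemma test1_lin (a b : R) f g : test1 f -> test1 g -> test1 (fun x => a * f x + b * g x).
Proof.
move=> [fC [S Sf]] [gC [S' Sg]]; split; first by apply: cinfD; exact: cinfZ.
by exists (Num.max S S') => x; rewrite gt_max => /andP[/Sf -> /Sg ->]; rewrite !mulr0 addr0.
Qed.

Lemma integrable_test1 f : test1 f -> mu.-integrable setT (EFin \o f).
Proof.
move=> tf; have := loc_int_test (continuous_loc_int (cst_continuous (x := 1 : R))) tf.
by apply: eq_integrable => // x _ /=; rewrite mul1r.
Qed.

(** The vanishing mean makes the primitive vanish to the right of the support as well as to the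
    left. *)
Lemma test1_primitive k : test1 k -> \int[mu]_x k x = 0 ->
  exists2 K, test1 K & (K^`())%classic = k.
Proof.
move=> tk k0; have [M M0 kM] := test1_support tk; have ck := continuous_cinf tk.1.
have pk := primitive_antideriv (continuous_loc_int ck).
pose K x := antideriv k x - antideriv k (- M).
have dK x : is_derive x (1 : R) K (k x).
  rewrite -[X in is_derive _ _ _ X]subr0; apply: is_deriveB; exact: is_derive_antideriv.
have null a b : a <= b -> (forall x, a < x <= b -> k x = 0) -> antideriv k b - antideriv k a = 0.
  move=> ab kab; rewrite pk// Rint_indic; transitivity (\int[mu]_x (0 : R)).
    2: by rewrite /Rintegral integral0.
  apply: eq_Rintegral => x _; rewrite indicE; case: (boolP (x \in _)); rewrite ?mulr0// inE/= in_itv/= => /kab ->.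
  by rewrite mul0r.
exists K; last by apply/funext => x; rewrite derive1E; have [_ ->] := dK x.
split; first exact: cinf_primitive tk.1 dK.
exists M => x xM; have [x0|x0] := leP 0 x.
  move: xM; rewrite ger0_norm// => xM.
  have -> : K x = K M.
    apply/eqP; rewrite -subr_eq0 /K opprB addrA subrK; apply/eqP; apply: null; first exact: ltW.
    by move=> y /andP[My _]; apply: kM; rewrite ger0_norm ?ltW// (le_lt_trans M0).
  rewrite /K pk ?ge0_cp// -[RHS]k0 Rint_indic; apply: eq_Rintegral => y _.
  rewrite indicE; case: (boolP (y \in _)) => [|yM]; first by rewrite mulr1.
  rewrite mulr0 kM// leNgt; apply: contra yM; rewrite ltr_norml => /andP[y1 y2].
  by rewrite inE/= in_itv/= y1 ltW.
move: xM; rewrite ltr0_norm// => xM; rewrite -[LHS]opprK opprB null ?oppr0//; first by lra.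
by move=> y /andP[xy yM]; apply: kM; rewrite -normrN (le_trans _ (ler_norm _))//; lra.
Qed.

(** If all test functions had mean 0, the fundamental lemma would give [1 = 0] almost everywhere. *)
Lemma unit_mass_test1 : exists2 h : R -> R, test1 h & \int[mu]_x h x = 1.
Proof.
have [h th /eqP h0] : exists2 h : R -> R, test1 h & \int[mu]_x h x <> 0.
  apply: contrapT => H.
  have : {ae mu, forall x : R, (1 : R) = 0}.
    apply: fundamental1 => //.
      by move=> M; have [] := continuous_loc_int (cst_continuous (x := 1 : R)).
    move=> f tf; under eq_Rintegral do rewrite mul1r.
    by apply: contrapT => nf; apply: H; exists f.
  move=> [A [mA A0 sub]]; have AT : A = setT.
    by apply/seteqP; split => // x _; apply: sub => /= /eqP; rewrite oner_eq0.
  move: A0; rewrite AT leb1E.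
  rewrite -set_itvNyy lebesgue_measure_itv//.
exists (fun x => (\int[mu]_x h x)^-1 * h x + 0 * h x); first exact: test1_lin.
under eq_Rintegral do rewrite mul0r addr0.
by rewrite RintegralZl ?mulVf//; exact: integrable_test1.
Qed.

(** The difference [D] of [v] and a primitive of [g] annihilates derivatives of test functions. As
    [f - (\int f) * h0] has mean 0 it is such a derivative, so [D] minus the constant [\int D * h0]
    annihilates every [f]. *)
Lemma dubois_reymond v g : loc_int v -> g \in L2 ->
  (forall f, test1 f -> \int[mu]_x (v x * (f^`())%classic x) = - \int[mu]_x (g x * f x)) ->
  exists w, primitive w g /\ {ae mu, forall x, v x = w x}.
Proof.
move=> iv g2 vg; have ig := L2_loc_int g2; have pw := primitive_antideriv ig.
set w0 := antideriv g in pw; have cw := primitive_continuous g2 pw.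
have iw := continuous_loc_int cw.
pose D x := v x - w0 x.
have iD : loc_int D.
  split; first by apply: measurable_funB; [case: iv|case: iw].
  by move=> M; have := integrableB _ (iv.2 M) (iw.2 M); apply.
have D0 f : test1 f -> \int[mu]_x (D x * (f^`())%classic x) = 0.
  move=> tf; have tf' := test1_derive tf.
  have [M M0 fM] := test1_support tf; have [M' M'0 f'M] := test1_support tf'.
  have mono (h : R -> R) N N' : N <= N' -> (forall x, N <= `|x| -> h x = 0) ->
    forall x, N' <= `|x| -> h x = 0 by move=> NN hN x /(le_trans NN)/hN.
  have [] := @ac_ibp w0 g f (f^`())%classic (Num.max M M') ig pw.
  - by move=> x; apply: is_derive_cinf; case: tf.
  - by apply: continuous_cinf; case: tf'.
  - by rewrite le_max M0.
  - by apply: mono fM; rewrite le_max lexx.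
  - by apply: mono f'M; rewrite le_max lexx orbT.
  move=> i1 E1; rewrite /D; under eq_Rintegral do rewrite mulrBl.
  by rewrite RintegralB// ?vg// ?E1 ?subrr//; exact: loc_int_test.
have [h0 th0 h01] := unit_mass_test1.
pose c := \int[mu]_x (D x * h0 x).
have Dc : {ae mu, forall x, D x - c = 0}.
  apply: fundamental1.
  - by apply: measurable_funB => //; case: iD.
  - move=> M; have := integrableB _ (iD.2 M) ((continuous_loc_int (cst_continuous (x := c))).2 M).
    by apply.
  - move=> f tf; pose I := \int[mu]_x f x.
    have [] := @test1_primitive (fun x => 1 * f x + - I * h0 x); first exact: test1_lin.
      rewrite RintegralD//; first last.
      - apply: integrable_test1.
        rewrite (_ : (fun _ => _) = fun x => (- I) * h0 x + 0 * f x); first exact: test1_lin.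
        by apply/funext => x; rewrite mul0r addr0.
      - apply: integrable_test1.
        rewrite (_ : (fun _ => _) = fun x => 1 * f x + 0 * f x); first exact: test1_lin.
        by apply/funext => x; rewrite mul0r addr0.
      rewrite RintegralZl//; last exact: integrable_test1.
      by rewrite RintegralZl ?h01; [rewrite mulr1 mul1r subrr| |exact: integrable_test1].
    move=> K tK KE; have := D0 K tK; rewrite KE.
    have i1 := loc_int_test iD tf; have i2 := loc_int_test iD th0.
    under eq_Rintegral do rewrite mulrDr mul1r mulrCA.
    rewrite RintegralD//; last first.
      by apply: eq_integrable (integrableZl measurableT (- I) i2) => // x _; rewrite /= EFinM.
    rewrite RintegralZl// -/c => E.
    under eq_Rintegral do rewrite mulrBl.
    rewrite RintegralB//; last first.
      by apply: eq_integrable (integrableZl measurableT c (integrable_test1 tf)) => // x _; rewrite /= EFinM.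
    rewrite RintegralZl//; last exact: integrable_test1.
    by rewrite -/I -[RHS]E; ring.
exists (fun x => w0 x + c); split; first by move=> a b ab; rewrite -pw//; ring.
apply: (filterS (F := almost_everywhere mu)) Dc => x /eqP.
by rewrite subr_eq0 subr_eq => /eqP ->; rewrite addrC.
Qed.

End Primitives.

(** * Radial functions of class H^1 *)

Section PlaneContinuous.
Context {R : realType}.
Local Notation RR := (measurableTypeR R).

(** The sigma-algebra here is the product one: an open set belongs to it as a countable union of
    boxes with rational vertices. *)
Lemma continuous_measurable_plane (f : R * R -> R) : continuous f ->
  measurable_fun [set: RR * RR] f.
Proof.
move=> cf; apply: (measurability _ (@RGenOInfty.measurableE R)).
move=> _ [_ [a ->] <-]; rewrite setTI; set O := f @^-1` _.
have oO : open (O : set (R * R)).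
  by move/continuousP : cf; apply; exact: interval_open.
pose box (q : (rat * rat) * (rat * rat)) : set (RR * RR) :=
  `]ratr q.1.1, ratr q.1.2[%classic `*` `]ratr q.2.1, ratr q.2.2[%classic.
pose B q : set (RR * RR) := if `[< box q `<=` O >] then box q else set0.
rewrite (_ : O = \bigcup_q B q); last first.
  apply/seteqP; split => [[x y] Oxy|z [q _]]; last first.
    by rewrite /B; case: asboolP => // qO; exact: qO.
  have /nbhs_ballP[e /= e0 eO] := open_nbhs_nbhs (conj oO Oxy).
  have [p1 p1x] := @rat_in_itvoo R (x - e) x ltac:(lra).
  have [p2 p2x] := @rat_in_itvoo R x (x + e) ltac:(lra).
  have [q1 q1y] := @rat_in_itvoo R (y - e) y ltac:(lra).
  have [q2 q2y] := @rat_in_itvoo R y (y + e) ltac:(lra).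
  move: p1x p2x q1y q2y; rewrite !in_itv/= => /andP[? ?] /andP[? ?] /andP[? ?] /andP[? ?].
  exists ((p1, p2), (q1, q2)) => //; rewrite /B; case: asboolP => [_|].
    by split => /=; rewrite in_itv/=; apply/andP; split.
  case=> -[x' y'] [/=]; rewrite !in_itv/= => /andP[? ?] /andP[? ?]; apply: eO.
  by split; rewrite /ball/= ltr_norml; apply/andP; split; lra.
apply: countable_bigcupT_measurable => [|q].
  exact: countableP.
by rewrite /B; case: asboolP => // _; apply: measurableX; exact: measurable_itv.
Qed.

End PlaneContinuous.

Section Reflection.
Context {R : realType}.
Local Notation RR := (measurableTypeR R).
Notation mu := (@leb1 R).

Lemma lebesgue_opp (A : set RR) : measurable A -> mu A = (1%:E * mu (-%R @^-1` A))%E.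
Proof.
have mN : measurable_fun [set: RR] (-%R : RR -> RR).
  by apply: continuous_measurable_fun => x; exact: oppr_continuous.
move=> mA; rewrite mul1e.
pose pf := measure_function_pushforward__canonical__measure_function_Measure mu mN.
have := @lebesgue_measure_unique R pf; apply => // _ [[p q] _ <-] /=.
rewrite /pushforward (_ : _ @^-1` _ = `[- q, - p[%classic); last first.
  by apply/seteqP; split => x /=; rewrite !in_itv/= => /andP[? ?]; apply/andP; split; lra.
rewrite /leb1 !lebesgue_measure_itv/= !lte_fin ltrN2; case: ifP => // _.
by rewrite -!EFinD; congr EFin; ring.
Qed.

Lemma measurable_opp : measurable_fun [set: RR] (-%R : RR -> RR).
Proof. by apply: continuous_measurable_fun => x; exact: oppr_continuous. Qed.

Lemma integrable_opp (f : R -> R) : mu.-integrable setT (EFin \o f) ->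
  mu.-integrable setT (EFin \o (fun x => f (- x))).
Proof.
move=> fi; have mf : measurable_fun [set: RR] f by apply/measurable_EFinP; case/integrableP : fi.
exact: (integrable_map measurable_opp ltr01 lebesgue_opp mf).1 fi.
Qed.

Lemma Rintegral_opp (f : R -> R) : mu.-integrable setT (EFin \o f) ->
  \int[mu]_x f x = \int[mu]_x f (- x).
Proof.
move=> fi; have mf : measurable_fun [set: RR] f by apply/measurable_EFinP; case/integrableP : fi.
by rewrite (Rintegral_map measurable_opp ltr01 lebesgue_opp mf fi) mul1r.
Qed.

End Reflection.

Section PushforwardDensityReal.
Context d (T : measurableType d) {R : realType} (nu : {measure set T -> \bar R}).
Local Notation RR := (measurableTypeR R).
Notation mu := (@leb1 R).
Variables (w : T -> R) (phi : T -> RR) (h : R -> R).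
Hypotheses (mw : measurable_fun setT w) (w0 : forall x, 0 <= w x).
Hypothesis mphi : measurable_fun setT phi.
Hypotheses (mh : measurable_fun [set: RR] h) (h0 : forall t, 0 <= h t).
Hypothesis push : forall (G : R -> R), measurable_fun [set: RR] G -> (forall t, 0 <= G t) ->
  (\int[nu]_x (G (phi x) * w x)%:E = \int[mu]_t (G t * h t)%:E)%E.

Lemma integrable_pushforward_density (G : R -> R) : measurable_fun [set: RR] G ->
  nu.-integrable setT (EFin \o (fun x => G (phi x) * w x)) <->
  mu.-integrable setT (EFin \o (fun t => G t * h t)).
Proof.
move=> mG; have mGp : measurable_fun setT (fun x => G (phi x)) by exact: (measurableT_comp mG).
have mn : measurable_fun [set: RR] (fun t => `|G t|) by exact: measurableT_comp.
have E := push mn (fun t => normr_ge0 (G t)).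
have Ew : (\int[nu]_x (`|G (phi x) * w x|)%:E = \int[nu]_x (`|G (phi x)| * w x)%:E)%E.
  by apply: eq_integral => x _; rewrite normrM (ger0_norm (w0 _)).
have Eh : (\int[mu]_t (`|G t * h t|)%:E = \int[mu]_t (`|G t| * h t)%:E)%E.
  by apply: eq_integral => t _; rewrite normrM (ger0_norm (h0 _)).
split=> /integrableP[_ i]; apply/integrableP; split;
  try by apply/measurable_EFinP; exact: measurable_funM.
- by move: i; rewrite /= Ew E -Eh.
- by move: i; rewrite /= Ew E -Eh.
Qed.

Lemma Rintegral_pushforward_density (G : R -> R) : measurable_fun [set: RR] G ->
  mu.-integrable setT (EFin \o (fun t => G t * h t)) ->
  \int[nu]_x (G (phi x) * w x) = \int[mu]_t (G t * h t).
Proof.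
move=> mG i; have i' := (integrable_pushforward_density mG).2 i.
have mp : measurable_fun [set: RR] (G^\+)%R by exact: measurable_funrpos.
have mn : measurable_fun [set: RR] (G^\-)%R by exact: measurable_funrneg.
rewrite RintE// [in RHS]RintE//; congr (fine _ - fine _).
- have E := push mp (funrpos_ge0 G).
  transitivity (\int[nu]_x ((G^\+)%R (phi x) * w x)%:E)%E.
    by apply: eq_integral => x _; rewrite /funrpos maxr_pMl// mul0r.
  by rewrite E; apply: eq_integral => x _; rewrite /funrpos maxr_pMl// mul0r.
- have E := push mn (funrneg_ge0 G).
  transitivity (\int[nu]_x ((G^\-)%R (phi x) * w x)%:E)%E.
    by apply: eq_integral => x _; rewrite /funrneg maxr_pMl// mul0r mulNr.
  by rewrite E; apply: eq_integral => x _; rewrite /funrneg maxr_pMl// mul0r mulNr.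
Qed.

End PushforwardDensityReal.

(** * Radial functions along lines parallel to an axis *)

Section Sections.
Context {R : realType}.
Local Notation RR := (measurableTypeR R).
Notation mu := (@leb1 R).
Notation L2 := (Lfun mu 2%:E).
Variable y : R.
Hypothesis y0 : y != 0.

Let q (x : R) := x ^+ 2 + y ^+ 2.

Let q_gt0 x : 0 < q x.
Proof. by rewrite ltr_wpDl ?sqr_ge0// lt_neqAle eq_sym sqrf_eq0 y0 sqr_ge0. Qed.

Let xy0 (x : R) : (x, y) != (0, 0) :> R * R. Proof. by apply: contra_neq y0 => -[]. Qed.

(* [lrad] on the horizontal line of ordinate [y != 0], which avoids the
   singularity at the origin; [cut] is its inverse on [x >= 0]. *)
Definition sec (x : R) : R := lrad (x, y).

Lemma secE x : sec x = - (2^-1 * ln (x ^+ 2 + y ^+ 2)).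
Proof.
have e0 : 0 < enorm (x, y) by rewrite lt_neqAle eq_sym enorm_eq0 xy0 enorm_ge0.
by rewrite /sec /lrad; congr (- _); rewrite -[_ + _](enorm_sqr (x, y)) lnXn// -[ln _ *+ 2]mulr_natl mulKf.
Qed.

Lemma is_derive_sec (x : R) : is_derive x (1 : R) (fun x => - sec x) (x / (x ^+ 2 + y ^+ 2)).
Proof.
rewrite (_ : (fun x => _) = fun x => 2^-1 * ln (x ^+ 2 + y ^+ 2)); last first.
  by apply/funext => z; rewrite secE opprK.
rewrite (_ : _ / _ = 2^-1 *: ((x ^+ 2 + y ^+ 2)^-1 * (2 * x))); last first.
  by rewrite /GRing.scale /=; field; rewrite ?gt_eqF ?q_gt0.
apply: is_deriveZ; apply: (@is_derive1_comp _ (@ln R) (fun x => x ^+ 2 + y ^+ 2)).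
  by apply: is_derive1_ln; exact: q_gt0.
by apply: is_derive_eq; rewrite /GRing.scale/= addr0 mulr1; ring.
Qed.

Lemma continuous_sec : continuous sec.
Proof.
move=> x; have d := is_deriveN (is_derive_sec x).
have E : - (fun x => - sec x) = sec by apply/funext => z; rewrite fctE opprK.
by move: d; rewrite E => -[d _]; apply/differentiable_continuous/derivable1_diffP.
Qed.

Lemma sec_le b x : (sec x <= b) = (expR (- b) ^+ 2 - y ^+ 2 <= x ^+ 2).
Proof.
rewrite /sec lrad_le ?xy0// lerBlDr -[LHS](@ler_pXn2r _ 2) ?nnegrE ?expR_ge0 ?enorm_ge0//.
by rewrite enorm_sqr.
Qed.

Definition cut (b : R) : R := Num.sqrt (expR (- b) ^+ 2 - y ^+ 2).

Lemma sec_le_cut b x : 0 <= x -> (sec x <= b) = (cut b <= x).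
Proof.
by move=> x0; rewrite sec_le /cut -{2}(ger0_norm x0) -sqrtr_sqr ler_sqrt ?sqr_ge0.
Qed.

Lemma sec_cut b : sec (cut b) = Num.min b (sec 0).
Proof.
have [Lb|bL] := leP (sec 0) b.
  have : cut b <= 0 by rewrite -sec_le_cut.
  by move=> c0; congr sec; apply/eqP; rewrite eq_le c0 sqrtr_ge0.
have c0 : 0 < expR (- b) ^+ 2 - y ^+ 2.
  by move: bL; rewrite ltNge sec_le expr0n/= -ltNge.
rewrite secE sqr_sqrtr ?(ltW c0)// subrK lnXn ?expR_gt0// expRK -[(- b) *+ 2]mulr_natl mulKf//.
by rewrite opprK.
Qed.

Lemma sec_anti x z : (sec z <= sec x) = (x ^+ 2 <= z ^+ 2).
Proof. by rewrite !secE lerN2 ler_pM2l ?invr_gt0// ler_ln ?posrE ?q_gt0// lerD2r. Qed.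

(** The density [- sec'] on [x >= 0], where [sec] decreases; the cut at 0 prevents the even function
    [sec] from being counted twice. *)
Definition secw (x : R) : R := Num.max x 0 / (x ^+ 2 + y ^+ 2).

Lemma secw_ge0 x : 0 <= secw x.
Proof. by rewrite divr_ge0 ?le_max ?lexx ?orbT// ltW// q_gt0. Qed.

Lemma continuous_secw : continuous (fun x : R => x / (x ^+ 2 + y ^+ 2)).
Proof.
move=> x; apply: cvgM; first exact: cvg_id.
apply: cvgV; first by rewrite gt_eqF// q_gt0.
by apply: cvgD; [apply: cvgM; exact: cvg_id|exact: cvg_cst].
Qed.

Lemma measurable_secw : measurable_fun [set: RR] secw.
Proof.
rewrite (_ : secw = fun x => Num.max (x / (x ^+ 2 + y ^+ 2)) 0).
  apply: measurable_maxr => //; apply: continuous_measurable_fun; exact: continuous_secw.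
by apply/funext => x; rewrite /secw maxr_pMl ?mul0r// invr_ge0 ltW// q_gt0.
Qed.

Lemma measurable_sec : measurable_fun [set: RR] sec.
Proof. by apply: continuous_measurable_fun; exact: continuous_sec. Qed.

(** [sec] takes its largest value at 0, so the change of variable covers this half line only. *)
Definition below : R -> R := \1_(`]-oo, sec 0]%classic).

Lemma section_cov (G : R -> R) : measurable_fun [set: RR] G -> (forall t, 0 <= G t) ->
  (\int[mu]_x (G (sec x) * secw x)%:E = \int[mu]_t (G t * below t)%:E)%E.
Proof.
have mB : measurable (`]-oo, sec 0]%classic : set RR) by exact: measurable_itv.
have itvE (a b : R) : (\int[mu]_(t in `]a, b]) (below t)%:E =
    mu `]a, Num.min b (sec 0)]%classic)%E.
  rewrite integral_indic//=; congr (mu _); apply/seteqP; split => x /=; rewrite !in_itv/= le_min.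
    by move=> [-> /andP[-> ->]].
  by move=> /andP[-> /andP[-> ->]].
apply: (ge0_integral_pushforward_density (nu := mu) measurable_secw secw_ge0 measurable_sec).
- exact: measurable_indic.
- by move=> t; rewrite /below indicE.
- move=> a b ab; rewrite itvE.
  transitivity (\int[mu]_(x in `[cut b, cut a[) (x / (x ^+ 2 + y ^+ 2))%:E)%E.
    rewrite integral_mkcond [RHS]integral_mkcond; apply: eq_integral => x _; rewrite !patchE.
    have [x0|x0] := leP 0 x; last first.
      have -> : (x \in `[cut b, cut a[%classic) = false.
        apply/negbTE; rewrite notin_setE/= in_itv/= => /andP[h _].
        by have := sqrtr_ge0 (expR (- b) ^+ 2 - y ^+ 2); rewrite -/(cut b); lra.
      by case: ifP => // _; rewrite /secw max_r ?(ltW x0)// mul0r.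
    have -> : (x \in sec @^-1` `]a, b]%classic) = (x \in `[cut b, cut a[%classic).
      apply/idP/idP; rewrite !inE/= !in_itv/= sec_le_cut// !ltNge sec_le_cut//;
        by move=> /andP[-> ->].
    by case: ifP => // _; rewrite /secw max_l.
  have cab : cut b <= cut a by rewrite -sec_le_cut ?sqrtr_ge0// sec_cut ge_min (ltW ab).
  have mf : measurable_fun [set: RR] (fun x : R => (x / (x ^+ 2 + y ^+ 2))%:E).
    by apply/measurable_EFinP; apply: continuous_measurable_fun; exact: continuous_secw.
  rewrite /leb1 (integral_itv_bndo_bndc (measurable_funTS mf)).
  rewrite -(integral_itv_obnd_cbnd (measurable_funTS mf)).
  rewrite [LHS](FTC_oc is_derive_sec continuous_secw cab) !sec_cut.
  rewrite [RHS](lebesgue_measure_itv `]a, Num.min b (sec 0)])/= lte_fin.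
  case: ltP => h; rewrite -?EFinB; congr EFin.
    have -> : Num.min a (sec 0) = a; last by lra.
    by apply: min_l; move: h; rewrite lt_min => /andP[_ /ltW].
  move: h; rewrite ge_min leNgt ab /= => h.
  by rewrite !min_r// ?subrr// (le_trans h)// ltW.
- by move=> a b; rewrite itvE [X in (X < _)%E](lebesgue_measure_itv `]a, Num.min b (sec 0)])/=;
    case: ifP => _; rewrite -?EFinB ltry.
Qed.

Variables (v g : R -> R).
Hypotheses (g2 : g \in L2) (vg : primitive v g).

(** The derivative of [v \o sec] expected from the chain rule. *)
Definition secg (x : R) : R := - (g (sec x) * (x / (x ^+ 2 + y ^+ 2))).

Lemma sec_opp x : sec (- x) = sec x.
Proof. by rewrite !secE sqrrN. Qed.

Lemma secg_opp x : secg (- x) = - secg x.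
Proof. by rewrite /secg sec_opp sqrrN mulNr mulrN. Qed.

Lemma secgE x : 0 <= x -> secg x = - (g (sec x) * secw x).
Proof. by move=> x0; rewrite /secg /secw max_l. Qed.

(** On [[- M, M]] the values of [sec] stay in a compact interval, on which [g] is integrable; the
    change of variable carries this to [x >= 0], and reflection to [x < 0]. *)
Lemma loc_int_secg : loc_int secg.
Proof.
have mg := Lfun2_measurable g2; have ig := L2_loc_int g2.
split.
  apply: measurable_funN; apply: measurable_funM.
    by apply: (measurableT_comp mg); exact: measurable_sec.
  by apply: continuous_measurable_fun; exact: continuous_secw.
move=> M.
pose I := `[sec M, sec 0]%classic.
have mI : measurable (I : set RR) by exact: measurable_itv.
have mB : measurable (`]-oo, sec 0]%classic : set RR) by exact: measurable_itv.
pose G t := g t * \1_I t.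
have mG : measurable_fun [set: RR] G by apply: measurable_funM => //; exact: measurable_indic.
have mbelow : measurable_fun [set: RR] below by exact: measurable_indic.
have GB t : G t * below t = G t.
  rewrite /G /below !indicE -mulrA -natrM mulnb; congr (_ * (nat_of_bool _)%:R).
  apply/andP/idP => [[]//|tI]; split => //.
  by move: tI; rewrite !inE/= !in_itv/= => /andP[].
have iK : mu.-integrable setT (EFin \o (fun x => G (sec x) * secw x)).
  apply/(integrable_pushforward_density measurable_secw secw_ge0 measurable_sec mbelow _ section_cov mG).
    by move=> t; rewrite /below indicE.
  rewrite (_ : (fun t => _) = G); last by apply/funext => t; exact: GB.
  by apply: integrable_indic_prod => //; exact: loc_int_cc.
have iK' := integrable_opp iK.
(* [secw] vanishes on negative arguments, so at most one of the two terms survives at each [x], and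
   their difference is the odd function [secg]. *)
have i : mu.-integrable `[- M, M]%classic (EFin \o (fun x => G (sec (- x)) * secw (- x) - G (sec x) * secw x)).
  apply: (integrableS _ _ _ (integrableB _ iK' iK)) => //.
apply: eq_integrable i => //.
move=> x; rewrite inE/= in_itv/= => /andP[x1 x2]; congr EFin.
have secI : I (sec x).
  rewrite /I /= in_itv/= !sec_anti expr0n sqr_ge0 andbT.
  by rewrite -[x ^+ 2]real_normK ?num_real// ler_pXn2r ?nnegrE ?ler_norml ?x1//; lra.
have GE : G (sec x) = g (sec x) by rewrite /G indicE mem_set// mulr1.
rewrite sec_opp GE -mulrBr /secg -[RHS]mulrN; congr (_ * _).
rewrite /secw sqrrN -mulrBl -mulNr; congr (_ / _).
have [x0|x0] := leP 0 x; last by rewrite (max_l (x := - x)) ?(max_r (x := x)) ?(ltW x0)//; lra.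
by rewrite (max_r (x := - x)) ?(max_l (x := x))//; lra.
Qed.

(** The chain rule in integrated form, deduced from the change of variable because [v] need not be
    differentiable. *)
Lemma secg_pos a b : 0 <= a -> a <= b ->
  v (sec b) - v (sec a) = \int[mu]_(t in `]a, b]) secg t.
Proof.
move=> a0 ab; have b0 := le_trans a0 ab.
have mg := Lfun2_measurable g2; have ig := L2_loc_int g2.
pose I := `[sec b, sec a[%classic.
have mI : measurable (I : set RR) by exact: measurable_itv.
pose G t := g t * \1_I t.
have mG : measurable_fun [set: RR] G by apply: measurable_funM => //; exact: measurable_indic.
have mbelow : measurable_fun [set: RR] below by apply: measurable_indic; exact: measurable_itv.
have GB t : G t * below t = G t.
  rewrite /G /below !indicE -mulrA -natrM mulnb; congr (_ * (nat_of_bool _)%:R).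
  apply/andP/idP => [[]//|tI]; split => //.
  move: tI; rewrite !inE/= !in_itv/= => /andP[_ /ltW ta].
  by apply: le_trans ta _; rewrite sec_anti expr0n sqr_ge0.
have sba : sec b <= sec a by rewrite sec_anti ler_pXn2r.
have iI : mu.-integrable I (EFin \o g).
  apply: (integrableS _ _ _ (loc_int_cc (sec b) (sec a) ig)) => //.
  by move=> x; rewrite /I /= !in_itv/= => /andP[-> /ltW].
have iG : mu.-integrable setT (EFin \o (fun t => G t * below t)).
  rewrite (_ : (fun t => _) = G); last by apply/funext => t; exact: GB.
  exact: integrable_indic_prod.
have bel0 t : 0 <= below t by rewrite /below indicE.
have E := Rintegral_pushforward_density measurable_secw secw_ge0 measurable_sec mbelow bel0 section_cov mG iG.
have iGs := (integrable_pushforward_density measurable_secw secw_ge0 measurable_sec mbelow bel0 section_cov mG).2 iG.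
rewrite Rint_indic (_ : \int[mu]_x (secg x * _) = \int[mu]_x (- 1 * (G (sec x) * secw x))); last first.
  apply: eq_Rintegral => x _; have [x0|x0] := leP 0 x; last first.
    rewrite /secw max_r ?(ltW x0)// mul0r !mulr0 indicE.
    by rewrite memNset ?mulr0//= in_itv/= => /andP[/(le_lt_trans a0)/ltW]; rewrite leNgt x0.
  rewrite secgE// mulN1r mulNr; congr (- _); rewrite /G mulrAC; congr (_ * _ * _).
  have h1 : (a < x) = (sec x < sec a) by rewrite !ltNge sec_anti ler_pXn2r.
  have h2 : (x <= b) = (sec b <= sec x) by rewrite sec_anti ler_pXn2r.
  rewrite !indicE; congr (nat_of_bool _)%:R.
  by apply/idP/idP; rewrite /I !inE/= !in_itv/= h1 h2 => /andP[-> ->].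
rewrite RintegralZl// E; under eq_Rintegral do rewrite GB.
rewrite -Rint_indic Rintegral_itv_bndo_bndc// -Rintegral_itv_obnd_cbnd; last exact: loc_int_oc.
by rewrite -vg// mulN1r opprB.
Qed.

Lemma primitive_secg : primitive (v \o sec) secg.
Proof.
have ig := loc_int_secg.
have neg a b : a <= b -> b <= 0 -> v (sec b) - v (sec a) = \int[mu]_(t in `]a, b]) secg t.
  move=> ab b0; rewrite Rint_indic Rintegral_opp; last first.
    by apply: integrable_indic_prod; [exact: measurable_itv|exact: loc_int_oc].
  rewrite -(sec_opp b) -(sec_opp a) -opprB (secg_pos (a := - b) (b := - a)); [|lra|lra].
  have io : mu.-integrable `[- b, - a[%classic (EFin \o secg).
    apply: (integrableS _ _ _ (loc_int_cc (- b) (- a) ig)) => //.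
    by move=> x; rewrite /= !in_itv/= => /andP[-> /ltW].
  have -> : \int[mu]_(t in `]- b, - a]) secg t = \int[mu]_(t in `[- b, - a[) secg t.
    by rewrite Rintegral_itv_bndo_bndc// -Rintegral_itv_obnd_cbnd//; exact: loc_int_oc.
  have mI : measurable (`[- b, - a[%classic : set RR) by exact: measurable_itv.
  rewrite Rint_indic -mulN1r -RintegralZl//; last exact: integrable_indic_prod.
  apply: eq_Rintegral => x _; rewrite secg_opp mulN1r [RHS]mulNr; congr (- _); congr (_ * _).
  rewrite !indicE; congr (nat_of_bool _)%:R; apply/idP/idP; rewrite !inE/= !in_itv/=;
    by move=> /andP[? ?]; apply/andP; split; lra.
move=> a b ab; have [a0|a0] := leP 0 a; first exact: secg_pos.
have [b0|b0] := leP b 0; first exact: neg.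
rewrite (Rint_cat ig (ltW a0) (ltW b0)) -neg ?(ltW a0)// -secg_pos ?(ltW b0)//=; ring.
Qed.

Lemma section_ibp (f f' : R -> R) M : (forall x, is_derive (x : R) (1 : R) f (f' x)) ->
  continuous f' -> 0 <= M -> (forall x, M <= `|x| -> f x = 0) ->
  (forall x, M <= `|x| -> f' x = 0) ->
  \int[mu]_x (v (sec x) * f' x) = - \int[mu]_x (secg x * f x).
Proof.
move=> df cf M0 fM f'M.
exact: (ac_ibp loc_int_secg primitive_secg df cf M0 fM f'M).2.
Qed.

End Sections.

Section TestFunctions2.
Context {R : realType}.
Local Notation RR := (measurableTypeR R).
Notation mu := (@leb1 R).
Notation mu2 := (@leb2 R).

Lemma bounded_support (V : normedModType R) (phi : V -> R) :
  compact (closure [set x | phi x != 0]) ->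
  exists2 M : R, 0 <= M & forall z, M <= `|z| -> phi z = 0.
Proof.
move=> /compact_bounded [M0 [_ HM]]; exists (`|M0| + 2); first by rewrite addr_ge0.
move=> z zM; apply: contrapT => /eqP nz.
have : `|z| <= `|M0| + 1.
  apply: HM; first by rewrite ltr_pwDr// ler_norm.
  exact: subset_closure.
by move: zM; lra.
Qed.

Lemma continuous_support_bounded (V : normedModType R) (f : V -> R) (K : set V) :
  compact K -> continuous f -> (forall z, ~ K z -> f z = 0) ->
  exists2 C : R, 0 <= C & forall z, `|f z| <= C.
Proof.
move=> cK cf fK.
have [M0 [_ HM]] := compact_bounded (continuous_compact (continuous_subspaceT cf) cK).
exists (`|M0| + 1); first by rewrite addr_ge0.
move=> z; have [Kz|/fK ->] := pselect (K z); last by rewrite normr0 addr_ge0.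
by apply: HM; [rewrite ltr_pwDr// ler_norm|exists z].
Qed.

Lemma derive_support_norm (V : normedModType R) (phi : V -> R) (v : V) (M : R) :
  (forall z, M <= `|z| -> phi z = 0) -> forall z, M + 1 <= `|z| -> 'D_v phi z = 0.
Proof.
move=> phiM z zM; rewrite (near_eq_derive (g := cst 0)); first exact: derive_cst.
near=> w; rewrite phiM//; apply/ltW; near: w.
apply: (@cvgr_gt _ _ _ _ (fun w : V => `|w|) `|z|); last by lra.
by apply: cvg_norm; exact: cvg_id.
Unshelve. all: by end_near. Qed.

Lemma smooth_continuous_derive (V : normedModType R) (phi : V -> R) v : smooth phi ->
  continuous (fun x => 'D_v phi x).
Proof. by move=> sphi x; exact/differentiable_continuous/(sphi [:: v]). Qed.

Lemma smooth_continuous (V : normedModType R) (phi : V -> R) : smooth phi -> continuous phi.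
Proof. by move=> sphi x; exact/differentiable_continuous/(sphi [::]). Qed.

Lemma cc_plane_L2 (f : R * R -> R) (M : R) : continuous f ->
  (forall z, M <= `|z| -> f z = 0) -> f \in Lfun mu2 2%:E.
Proof.
move=> cf fM; have mf := continuous_measurable_plane cf.
have mI : measurable (`[- M, M]%classic : set RR) by exact: measurable_itv.
pose K : set (RR * RR) := `[- M, M]%classic `*` `[- M, M]%classic.
have mK : measurable K by exact: measurableX.
have fK z : ~ K z -> f z = 0.
  move=> nK; apply: fM; rewrite leNgt; apply/negP => zM; apply: nK; rewrite /K.
  have : Num.max `|z.1| `|z.2| < M by exact: zM.
  by rewrite gt_max => /andP[/ltW h1 /ltW h2]; split; rewrite /= in_itv/= -ler_norml.
have [C C0 fC] := continuous_support_bounded (compact_setX (segment_compact (a := - M) (b := M))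
  (segment_compact (a := - M) (b := M))) cf fK.
apply/Lfun2P; split=> //.
apply: (@le_lt_trans _ _ (\int[mu2]_(x in K) (C ^+ 2)%:E)%E).
  rewrite [leRHS]integral_mkcond; apply: ge0_le_integral => //.
  - by move=> x _; rewrite lee_fin sqr_ge0.
  - by apply/measurable_EFinP; exact: measurable_funX.
  - by apply/(measurable_restrictT _ mK); exact: measurable_cst.
  - move=> x _; rewrite patchE; case: ifPn => [_|].
      by rewrite lee_fin -[X in X <= _]real_normK ?num_real// ler_pXn2r ?nnegrE.
    by rewrite notin_setE => /fK ->; rewrite expr0n.
rewrite integral_cst//.
rewrite lte_mul_pinfty ?lee_fin ?sqr_ge0// /K [X in (X < _)%E]leb2_prod// leb1E lebesgue_measure_itv/=.
by case: ifP => _; rewrite ?mule0 ?ltry// -EFinB -EFinM ltry.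
Qed.

Lemma indic_L2 d (T : measurableType d) (nu : {measure set T -> \bar R}) (A : set T) :
  measurable A -> (nu A < +oo)%E -> (\1_A : T -> R) \in Lfun nu 2%:E.
Proof.
move=> mA Aoo; apply/Lfun2P; split; first exact: measurable_indic.
have E x : (\1_A x : R) ^+ 2 = \1_A x.
  by rewrite indicE; case: (_ \in _); rewrite ?expr1n ?expr0n.
by under eq_integral do rewrite E; rewrite integral_indic// setIT.
Qed.

Lemma is_derive_line1 (phi : R * R -> R) (x y : R) : differentiable phi (x, y) ->
  is_derive x (1 : R) (fun x => phi (x, y)) ('D_e1 phi (x, y)).
Proof.
move=> /(@diff_derivable _ _ _ phi (x, y) e1) d.
have E (h : R) : h *: (e1 : R * R) + (x, y) = (h *: (1 : R) + x, y).
  by rewrite /e1; congr pair; rewrite /= ?scaler0 ?add0r.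
have F : (fun h : R => h^-1 *: ((phi \o shift (x, y)) (h *: (e1 : R * R)) - phi (x, y))) =
    (fun h : R => h^-1 *: (((fun x => phi (x, y)) \o shift x) (h *: (1 : R)) - phi (x, y))).
  by apply/funext => h /=; rewrite E.
by apply: DeriveDef; [rewrite /derivable -F; exact: d|rewrite /derive -F].
Qed.

Lemma is_derive_line2 (phi : R * R -> R) (x y : R) : differentiable phi (x, y) ->
  is_derive y (1 : R) (fun y => phi (x, y)) ('D_e2 phi (x, y)).
Proof.
move=> /(@diff_derivable _ _ _ phi (x, y) e2) d.
have E (h : R) : h *: (e2 : R * R) + (x, y) = (x, h *: (1 : R) + y).
  by rewrite /e2; congr pair; rewrite /= ?scaler0 ?add0r.
have F : (fun h : R => h^-1 *: ((phi \o shift (x, y)) (h *: (e2 : R * R)) - phi (x, y))) =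
    (fun h : R => h^-1 *: (((fun y => phi (x, y)) \o shift y) (h *: (1 : R)) - phi (x, y))).
  by apply/funext => h /=; rewrite E.
by apply: DeriveDef; [rewrite /derivable -F; exact: d|rewrite /derive -F].
Qed.

End TestFunctions2.

(** * Weak gradient and energy of a radial function *)

Section RadialGradient.
Context {R : realType}.
Local Notation RR := (measurableTypeR R).
Notation mu := (@leb1 R).
Notation mu2 := (@leb2 R).
Implicit Types (u : R * R -> R) (v g : R -> R).

(** Working form of membership in [H1rad]: [H1rad_rad] produces it, and [rad_H1] returns [H1]
    together with the norm of the gradient. *)
Definition rad u v g := [/\ measurable_fun [set: RR * RR] u,
  {ae mu2, forall z, u z = v (lrad z)}, primitive v g, g \in Lfun mu 2%:E &
  (\int[mu]_t (v t ^+ 2 * expR (- 2 * t))%:E < +oo)%E].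

Lemma expR_lrad (z : R * R) : z != (0, 0) -> expR (2 * lrad z) = (z.1 ^+ 2 + z.2 ^+ 2)^-1.
Proof.
rewrite -enorm_eq0 => z0; have zp : 0 < enorm z by rewrite lt_neqAle eq_sym z0 enorm_ge0.
by rewrite /lrad mulrN expRN mulr_natl -lnXn// lnK ?posrE ?exprn_gt0// enorm_sqr.
Qed.

(* Since [expR (2 * lrad z) = |z|^-2], the gradient of [v (lrad z)] with [v' = g] is
   [(radg g fst z, radg g snd z)]. *)
Definition radg g (w : R * R -> R) (z : R * R) : R := - (g (lrad z) * (w z * expR (2 * lrad z))).

Lemma ae_eq_Rint d (T : measurableType d) (nu : {measure set T -> \bar R}) (f h : T -> R) :
  measurable_fun setT f -> measurable_fun setT h -> {ae nu, forall x, f x = h x} ->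
  \int[nu]_x f x = \int[nu]_x h x.
Proof.
move=> mf mh fh; rewrite /Rintegral; congr fine; apply: ae_eq_integral => //; try exact/measurable_EFinP.
by apply: (filterS (F := almost_everywhere nu)) fh => x -> _.
Qed.

Lemma ae_neq0 (P : R -> Prop) : (forall y, y != 0 -> P y) -> {ae mu, forall y, P y}.
Proof.
move=> Py; exists [set 0]; split; [by []|by rewrite leb1E lebesgue_measure_set1|].
by move=> z /= nP; apply/eqP; rewrite -[_ == _]negbK; apply: contra_notN nP => /Py.
Qed.

Lemma radial_measurable g : measurable_fun [set: RR] g ->
  measurable_fun [set: RR * RR] (fun z => g (lrad z)).
Proof. by move=> mg; apply: (measurableT_comp mg); exact: measurable_lrad. Qed.

Lemma measurable_expR2 (k : R) : measurable_fun [set: RR] (fun t : R => expR (k * t)).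
Proof. by apply: (measurableT_comp (@measurable_expR R)); exact: measurable_funM. Qed.

Lemma radg_measurable g (w : R * R -> R) : measurable_fun [set: RR] g ->
  measurable_fun [set: RR * RR] w -> measurable_fun [set: RR * RR] (radg g w).
Proof.
move=> mg mw; apply: measurable_funN; apply: measurable_funM; first exact: radial_measurable.
apply: measurable_funM => //; apply: (radial_measurable (g := fun t => expR (2 * t))).
exact: measurable_expR2.
Qed.

(** The factor [|z| ^ -2] of the squared gradient cancels the Jacobian [expR (- 2 * t)], an instance
    of the conformal invariance of the Dirichlet energy in dimension two. *)
Lemma radial_energy g : g \in Lfun mu 2%:E ->
  (\int[mu2]_z (g (lrad z) ^+ 2 * expR (2 * lrad z))%:E = (2 * pi * ip mu g g)%:E)%E.
Proof.
move=> g2; have mg := Lfun2_measurable g2.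
rewrite (radial_integral (G := fun t => g t ^+ 2 * expR (2 * t))).
- rewrite EFinM -L2_integral_sqr// -intZ//.
  + apply: eq_integral => t _; congr EFin.
    have e : expR (2 * t) * expR (- 2 * t) = 1 by rewrite -expRD mulNr subrr expR0.
    transitivity (2 * pi * g t ^+ 2 * (expR (2 * t) * expR (- 2 * t))); first by ring.
    by rewrite e mulr1.
  + by rewrite mulr_ge0// pi_ge0.
  + exact: measurable_funX.
  + by move=> x; exact: sqr_ge0.
- by apply: measurable_funM; [exact: measurable_funX|exact: measurable_expR2].
- by move=> t; rewrite mulr_ge0 ?sqr_ge0 ?expR_ge0.
Qed.

Lemma radg_sqr g (w : R * R -> R) z : (forall z, w z ^+ 2 <= z.1 ^+ 2 + z.2 ^+ 2) ->
  radg g w z ^+ 2 <= g (lrad z) ^+ 2 * expR (2 * lrad z).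
Proof.
move=> wz; rewrite /radg sqrrN !exprMn ler_wpM2l ?sqr_ge0//.
(* At the origin [expR (2 * lrad z)] is not [|z| ^ -2], but [w] vanishes there by [wz]. *)
have [->|z0] := eqVneq z (0, 0).
  have := wz (0, 0); rewrite /= expr0n addr0 => w0.
  by apply: le_trans (expR_ge0 _); rewrite pmulr_lle0 ?exprn_gt0 ?expR_gt0.
rewrite [X in _ * X <= _]expr2 mulrA ler_piMl ?expR_ge0// expR_lrad//.
by rewrite ler_pdivrMr ?mul1r// -enorm_sqr exprn_gt0// lt_neqAle eq_sym enorm_eq0 z0 enorm_ge0.
Qed.

Lemma radg_L2 g (w : R * R -> R) : g \in Lfun mu 2%:E -> measurable_fun [set: RR * RR] w ->
  (forall z, w z ^+ 2 <= z.1 ^+ 2 + z.2 ^+ 2) -> radg g w \in Lfun mu2 2%:E.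
Proof.
move=> g2 mw wz; have mg := Lfun2_measurable g2; have mr := radg_measurable mg mw.
apply/Lfun2P; split => //.
apply: (@le_lt_trans _ _ (\int[mu2]_z (g (lrad z) ^+ 2 * expR (2 * lrad z))%:E)%E); last first.
  by rewrite radial_energy// ltry.
apply: int_le; first exact: measurable_funX.
- apply: (radial_measurable (g := fun t => g t ^+ 2 * expR (2 * t))).
  by apply: measurable_funM; [exact: measurable_funX|exact: measurable_expR2].
- by move=> z; exact: sqr_ge0.
- by move=> z; exact: radg_sqr.
Qed.

Lemma rad_L2 u v g : rad u v g -> u \in Lfun mu2 2%:E /\
  (\int[mu2]_z (u z ^+ 2)%:E = (2 * pi)%:E * \int[mu]_t (v t ^+ 2 * expR (- 2 * t))%:E)%E.
Proof.
move=> [mu_ uv vg g2 v2].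
have mv : measurable_fun [set: RR] v.
  by apply: continuous_measurable_fun; exact: primitive_continuous g2 vg.
have E : (\int[mu2]_z (u z ^+ 2)%:E = (2 * pi)%:E * \int[mu]_t (v t ^+ 2 * expR (- 2 * t))%:E)%E.
  transitivity (\int[mu2]_z (v (lrad z) ^+ 2)%:E)%E.
    apply: ae_eq_integral => //.
    - by apply/measurable_EFinP; exact: measurable_funX.
    - apply/measurable_EFinP; apply: measurable_funX; exact: radial_measurable.
    - by apply: (filterS (F := almost_everywhere mu2)) uv => z -> _.
  rewrite (radial_integral (G := fun t => v t ^+ 2)).
  - rewrite -intZ.
    + by apply: eq_integral => t _; congr EFin; ring.
    + by rewrite mulr_ge0// pi_ge0.
    + by apply: measurable_funM; [exact: measurable_funX|exact: measurable_expR2].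
    + by move=> t; rewrite mulr_ge0 ?sqr_ge0 ?expR_ge0.
  - exact: measurable_funX.
  - by move=> t; exact: sqr_ge0.
split => //; apply/Lfun2P; split => //; rewrite E lte_mul_pinfty//.
by rewrite lee_fin mulr_ge0// pi_ge0.
Qed.

Lemma fst_sqr_le (z : R * R) : z.1 ^+ 2 <= z.1 ^+ 2 + z.2 ^+ 2.
Proof. by rewrite lerDl sqr_ge0. Qed.

Lemma snd_sqr_le (z : R * R) : z.2 ^+ 2 <= z.1 ^+ 2 + z.2 ^+ 2.
Proof. by rewrite lerDr sqr_ge0. Qed.

Lemma lradC (x y : R) : lrad (x, y) = lrad (y, x).
Proof. by rewrite /lrad /enorm /= addrC. Qed.

Lemma radg_sec1 g (x y : R) : y != 0 -> radg g fst (x, y) = secg y g x.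
Proof.
move=> y0; rewrite /radg /secg expR_lrad//.
by apply: contra_neq y0 => -[].
Qed.

Lemma radg_sec2 g (x y : R) : x != 0 -> radg g snd (x, y) = secg x g y.
Proof.
move=> x0; rewrite /radg /secg expR_lrad/=; last by apply: contra_neq x0 => -[].
by rewrite /sec lradC [x ^+ 2 + _]addrC.
Qed.

Lemma test_function_facts (phi : R * R -> R) (e : R * R) : test_function phi ->
  [/\ continuous phi, continuous (fun z => 'D_e phi z) & exists2 M : R, 0 <= M &
    forall z, M <= `|z| -> phi z = 0 /\ 'D_e phi z = 0].
Proof.
move=> [sphi cphi]; split; [exact: smooth_continuous|exact: smooth_continuous_derive|].
have [M M0 phiM] := bounded_support cphi; exists (M + 1); first by rewrite addr_ge0.
move=> z zM; split; last exact: derive_support_norm phiM _ zM.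
by apply: phiM; apply: le_trans zM; rewrite lerDl.
Qed.

Lemma le_norm_fst (z : R * R) : `|z.1| <= `|z|.
Proof. by rewrite /Num.norm/= le_max lexx. Qed.

Lemma le_norm_snd (z : R * R) : `|z.2| <= `|z|.
Proof. by rewrite /Num.norm/= le_max lexx orbT. Qed.

Lemma rad_int_partial u v g (w : R * R -> R) (phi : R * R -> R) (e : R * R) :
  rad u v g -> measurable_fun [set: RR * RR] w ->
  (forall z, w z ^+ 2 <= z.1 ^+ 2 + z.2 ^+ 2) -> test_function phi ->
  [/\ mu2.-integrable setT (EFin \o (fun z => v (lrad z) * 'D_e phi z)),
    mu2.-integrable setT (EFin \o (fun z => radg g w z * phi z)) &
    \int[mu2]_z (u z * 'D_e phi z) = \int[mu2]_z (v (lrad z) * 'D_e phi z)].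
Proof.
move=> r mw wz tphi; have [u2 _] := rad_L2 r; case: (r) => mu_ uv vg g2 v2.
have [cphi cD [M M0 phiM]] := test_function_facts e tphi.
have D2 : (fun z => 'D_e phi z) \in Lfun mu2 2%:E.
  by apply: (cc_plane_L2 (M := M)) => // z /phiM[].
have phi2 : phi \in Lfun mu2 2%:E by apply: (cc_plane_L2 (M := M)) => // z /phiM[].
have mv : measurable_fun [set: RR] v.
  by apply: continuous_measurable_fun; exact: primitive_continuous g2 vg.
have mD := continuous_measurable_plane cD.
have muD : measurable_fun [set: RR * RR] (fun z => u z * 'D_e phi z) by exact: measurable_funM.
have mvD : measurable_fun [set: RR * RR] (fun z => v (lrad z) * 'D_e phi z).
  by apply: measurable_funM => //; exact: radial_measurable.
split.
- have r' : rad (fun z => v (lrad z)) v g.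
    by split => //; [exact: radial_measurable|exact: aeW].
  exact: L2_integrable_prod (rad_L2 r').1 D2.
- by apply: L2_integrable_prod => //; exact: radg_L2.
- by apply: ae_eq_Rint => //; apply: (filterS (F := almost_everywhere mu2)) uv => z ->.
Qed.

(** Integration by parts on each horizontal line [y != 0]. The singular origin lies on the one
    excluded line, which is null; this takes the place of a cut-off around it. *)
Lemma rad_partial1 u v g : rad u v g -> is_weak_partial e1 u (radg g fst).
Proof.
move=> r phi tphi; case: (r) => mu_ uv vg g2 v2.
have [|i1 i2 ->] := rad_int_partial e1 r _ fst_sqr_le tphi; first exact: measurable_fst.
have [cphi cD [M M0 phiM]] := test_function_facts e1 tphi.
have [j1 E1] := Rfubini21 i1; have [j2 E2] := Rfubini21 i2.
rewrite -[LHS]E1 -[X in _ = - X]E2 -mulN1r -RintegralZl//; apply: ae_eq_Rint.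
- by apply/measurable_EFinP; case/integrableP : j1.
- by apply: measurable_funM => //; apply/measurable_EFinP; case/integrableP : j2.
apply: ae_neq0 => y y0; rewrite mulN1r.
rewrite [LHS](section_ibp y0 g2 vg (f := fun x => phi (x, y)) (M := M))//.
- by congr (- _); apply: eq_Rintegral => x _; rewrite radg_sec1.
- by move=> x; apply: is_derive_line1; exact: (tphi.1 [::]).
- move=> x; apply: (@continuous_comp _ _ _ (fun x => (x, y)) (fun z => 'D_e1 phi z)); last exact: cD.
  apply: (@cvg_pair _ _ _ (nbhs x) (nbhs x) (nbhs y)); [exact: cvg_id|exact: cvg_cst].
- by move=> x xM; apply: (phiM (x, y) _).1; apply: le_trans xM (le_norm_fst (x, y)).
- by move=> x xM; apply: (phiM (x, y) _).2; apply: le_trans xM (le_norm_fst (x, y)).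
Qed.

Lemma rad_partial2 u v g : rad u v g -> is_weak_partial e2 u (radg g snd).
Proof.
move=> r phi tphi; case: (r) => mu_ uv vg g2 v2.
have [|i1 i2 ->] := rad_int_partial e2 r _ snd_sqr_le tphi; first exact: measurable_snd.
have [cphi cD [M M0 phiM]] := test_function_facts e2 tphi.
have [j1 E1] := Rfubini12 i1; have [j2 E2] := Rfubini12 i2.
rewrite -[LHS]E1 -[X in _ = - X]E2 -mulN1r -RintegralZl//; apply: ae_eq_Rint.
- by apply/measurable_EFinP; case/integrableP : j1.
- by apply: measurable_funM => //; apply/measurable_EFinP; case/integrableP : j2.
apply: ae_neq0 => x x0; rewrite mulN1r; under eq_Rintegral do rewrite lradC.
rewrite [LHS](section_ibp x0 g2 vg (f := fun y => phi (x, y)) (M := M))//.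
- by congr (- _); apply: eq_Rintegral => y _; rewrite radg_sec2.
- by move=> y; apply: is_derive_line2; exact: (tphi.1 [::]).
- move=> y; apply: (@continuous_comp _ _ _ (fun y => (x, y)) (fun z => 'D_e2 phi z)); last exact: cD.
  apply: (@cvg_pair _ _ _ (nbhs y) (nbhs x) (nbhs y)); [exact: cvg_cst|exact: cvg_id].
- by move=> y yM; apply: (phiM (x, y) _).1; apply: le_trans yM (le_norm_snd (x, y)).
- by move=> y yM; apply: (phiM (x, y) _).2; apply: le_trans yM (le_norm_snd (x, y)).
Qed.

Lemma test2_L2 (f h : R -> R) : test1 f -> test1 h ->
  (fun z : R * R => f z.1 * h z.2) \in Lfun mu2 2%:E.
Proof.
move=> tf th; have tp := test2_prod tf th; have [M M0 pM] := bounded_support tp.2.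
by apply: (cc_plane_L2 (M := M)) => //; exact: smooth_continuous tp.1.
Qed.

Lemma weak_partial_unique (e : R * R) u (g h : R * R -> R) :
  g \in Lfun mu2 2%:E -> h \in Lfun mu2 2%:E ->
  is_weak_partial e u g -> is_weak_partial e u h -> {ae mu2, forall z, g z = h z}.
Proof.
move=> g2 h2 ug uh.
have w2 := L2_lin (- 1) h2 g2.
have : {ae mu2, forall z, - 1 * h z + g z = 0}.
  apply: fundamental2.
  - exact: (Lfun2_measurable w2).
  - move=> M; apply/integrable_mkcond; first exact: measurable_box.
    have i1 : (\1_(box M) : R * R -> R) \in Lfun mu2 2%:E.
      apply: indic_L2; first exact: measurable_box.
      have mI : measurable (`]- M, M[%classic : set RR) by exact: measurable_itv.
      rewrite /box leb2_prod// leb1E lebesgue_measure_itv/=.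
      by case: ifP => _; rewrite ?mule0 ?ltry// -EFinB -EFinM ltry.
    apply: eq_integrable (L2_integrable_prod w2 i1) => // z _.
    by rewrite patchE indicE; case: ifP => _ /=; rewrite ?mulr1 ?mulr0.
  - move=> f k tf tk; have p2 := test2_L2 tf tk; have tp := test2_prod tf tk.
    have := ipl (- 1) h2 g2 p2; rewrite /ip => ->.
    have := ug _ tp; rewrite uh// => /eqP; rewrite eqr_opp => /eqP ->.
    by rewrite mulN1r addNr.
apply: (filterS (F := almost_everywhere mu2)) => z /eqP.
by rewrite mulN1r addrC subr_eq0 => /eqP.
Qed.

Lemma weak_partial_spec (e : R * R) u (g : R * R -> R) :
  g \in Lfun mu2 2%:E -> is_weak_partial e u g ->
  weak_partial e u \in Lfun mu2 2%:E /\ is_weak_partial e u (weak_partial e u).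
Proof.
move=> g2 ug; apply: (@xgetPex _ (cst 0)
  [set g | g \in Lfun mu2 2%:E /\ is_weak_partial e u g]).
by exists g.
Qed.

Lemma weak_partial_rad u v g : rad u v g ->
  {ae mu2, forall z, weak_partial e1 u z = radg g fst z} /\
  {ae mu2, forall z, weak_partial e2 u z = radg g snd z}.
Proof.
move=> r; have [_ _ _ g2 _] := r.
have m1 : radg g fst \in Lfun mu2 2%:E.
  by apply: radg_L2 => // z; exact: fst_sqr_le.
have m2 : radg g snd \in Lfun mu2 2%:E.
  by apply: radg_L2; [|exact: measurable_snd|exact: snd_sqr_le].
have [h1 uh1] := weak_partial_spec m1 (rad_partial1 r).
have [h2 uh2] := weak_partial_spec m2 (rad_partial2 r).
split; [exact: weak_partial_unique h1 m1 uh1 (rad_partial1 r)|].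
exact: weak_partial_unique h2 m2 uh2 (rad_partial2 r).
Qed.

Lemma rad_H1 u v g : rad u v g -> H1 u /\ grad_norm u ^+ 2 = 2 * pi * ip mu g g.
Proof.
move=> r; have [mu_ uv vg g2 v2] := r; have [u2 _] := rad_L2 r.
have m1 : radg g fst \in Lfun mu2 2%:E.
  by apply: radg_L2 => // z; exact: fst_sqr_le.
have m2 : radg g snd \in Lfun mu2 2%:E.
  by apply: radg_L2; [|exact: measurable_snd|exact: snd_sqr_le].
split.
  split => // e [->|->].
  - by exists (radg g fst); split => //; exact: rad_partial1 r.
  - by exists (radg g snd); split => //; exact: rad_partial2 r.
have [p1 p2] := weak_partial_rad r.
have [q1 _] := weak_partial_spec m1 (rad_partial1 r).
have [q2 _] := weak_partial_spec m2 (rad_partial2 r).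
have mG : measurable_fun [set: RR * RR] (fun z => enorm (gradient u z)).
  apply: (measurableT_comp (@measurable_enorm R) (g := fun z => gradient u z)).
  have w1 := Lfun2_measurable q1; have w2 := Lfun2_measurable q2.
  exact: (measurable_fun_pair w1 w2).
have mg := Lfun2_measurable g2.
have mE : measurable_fun [set: RR * RR] (fun z => g (lrad z) ^+ 2 * expR (2 * lrad z)).
  apply: (radial_measurable (g := fun t => g t ^+ 2 * expR (2 * t))).
  by apply: measurable_funM; [exact: measurable_funX|exact: measurable_expR2].
have E : (\int[mu2]_z (enorm (gradient u z) ^+ 2)%:E = (2 * pi * ip mu g g)%:E)%E.
  rewrite -radial_energy//; apply: ae_eq_integral => //.
  - by apply/measurable_EFinP; exact: measurable_funX.
  - exact/measurable_EFinP.
  have ae0 : {ae mu2, forall z, z != (0, 0)} by exact: ae_origin.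
  apply: (filterS3 (F := almost_everywhere mu2)) p1 p2 ae0 => z e1z e2z z0 _.
  congr EFin; rewrite enorm_sqr /gradient /= e1z e2z /radg !sqrrN !exprMn expR_lrad//.
  have q0 : z.1 ^+ 2 + z.2 ^+ 2 != 0.
    by rewrite -enorm_sqr expf_neq0// enorm_eq0.
  by field.
have G2 : (fun z => enorm (gradient u z)) \in Lfun mu2 2%:E.
  by apply/Lfun2P; split => //; rewrite E ltry.
rewrite /grad_norm L2norm_sqr//; apply/EFin_inj; rewrite -L2_integral_sqr//.
Qed.

Lemma primitive_weak_deriv v g : g \in Lfun mu 2%:E -> primitive v g -> is_weak_deriv v g.
Proof.
move=> g2 vg phi [sphi cphi]; have [M M0 phiM] := bounded_support cphi.
have dE : (phi^`())%classic = fun x : R => 'D_1 phi x by apply/funext => x; rewrite derive1E.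
have [] := ac_ibp (L2_loc_int g2) vg (f := phi) (f' := (phi^`())%classic) (M := M + 1).
- by move=> x; apply: DeriveDef; [apply/derivable1_diffP; exact: (sphi [::])|rewrite derive1E].
- by rewrite dE; exact: smooth_continuous_derive.
- by rewrite addr_ge0.
- by move=> x xM; apply: phiM; apply: le_trans xM; rewrite lerDl.
- by move=> x xM; rewrite dE; exact: derive_support_norm phiM _ xM.
- by [].
Qed.

Lemma L2norm_weak_deriv v g : g \in Lfun mu 2%:E -> primitive v g ->
  L2norm mu (weak_deriv v) ^+ 2 = ip mu g g.
Proof.
move=> g2 vg; have ug := primitive_weak_deriv g2 vg.
have [h2 uh] : weak_deriv v \in Lfun mu 2%:E /\ is_weak_deriv v (weak_deriv v).
  apply: (@xgetPex _ (cst 0) [set g | g \in Lfun mu 2%:E /\ is_weak_deriv v g]).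
  by exists g.
have w2 := L2_lin (- 1) h2 g2.
have : {ae mu, forall z, - 1 * weak_deriv v z + g z = 0}.
  have [mw iw] := L2_loc_int w2.
  apply: fundamental1 => // f tf.
  have f2 : f \in Lfun mu 2%:E.
    have [M M0 fM] := test1_support tf; have [C fC] := test1_bounded tf.
    have i1 : (\1_(`[- M, M]%classic) : R -> R) \in Lfun mu 2%:E.
      apply: indic_L2; first exact: measurable_itv.
      by rewrite leb1E lebesgue_measure_itv/=; case: ifP => _; rewrite -?EFinB ltry.
    apply/Lfun2P; split; first by apply: measurable_cinf; case: tf.
    have /Lfun2P[m1 fin] := L2_lin C i1 (L2_0 mu).
    apply: le_lt_trans fin; apply: int_le.
    - by apply: measurable_funX; apply: measurable_cinf; case: tf.
    - exact: measurable_funX.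
    - by move=> x; exact: sqr_ge0.
    move=> x; rewrite addr0 indicE; case: (boolP (x \in _)) => [_|].
      rewrite mulr1 -[X in X <= _]real_normK ?num_real// ler_pXn2r ?nnegrE//.
      exact: le_trans (normr_ge0 _) (fC x).
    rewrite notin_setE/= in_itv/= -ler_norml => /negP; rewrite -ltNge => /ltW /fM ->.
    by rewrite expr0n sqr_ge0.
  have := ipl (- 1) h2 g2 f2; rewrite /ip => ->.
  have := ug _ (test1_test tf); rewrite uh; last exact: test1_test.
  by move=> /eqP; rewrite eqr_opp => /eqP ->; rewrite mulN1r addNr.
move=> E; rewrite L2norm_sqr//; apply: ae_eq_Rint.
- by apply: measurable_funM; exact: (Lfun2_measurable h2).
- by apply: measurable_funM; exact: (Lfun2_measurable g2).
apply: (filterS (F := almost_everywhere mu)) E => x /eqP.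
by rewrite mulN1r addrC subr_eq0 => /eqP ->.
Qed.

End RadialGradient.

(** * Measurable radial representative *)

Section RadialRepresentative.
Context {R : realType}.
Local Notation RR := (measurableTypeR R).
Notation mu := (@leb1 R).
Notation mu2 := (@leb2 R).

Lemma ae_measurable_null d (T : measurableType d) (nu : {measure set T -> \bar R}) (P : T -> Prop) :
  {ae nu, forall x, P x} -> exists A, [/\ measurable A, nu A = 0%E & forall x, ~ A x -> P x].
Proof. by move=> [A [mA A0 sub]]; exists A; split => // x nA; apply: contrapT => /sub. Qed.

Lemma int_indic0 d (T : measurableType d) (nu : {measure set T -> \bar R}) (A : set T) :
  measurable A -> (\int[nu]_x (\1_A x)%:E = 0)%E -> nu A = 0%E.
Proof. by move=> mA; rewrite integral_indic// setIT. Qed.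

Lemma ae_of_int0 d (T : measurableType d) (nu : {measure set T -> \bar R}) (f : T -> \bar R) :
  measurable_fun setT f -> (forall x, 0 <= f x)%E -> (\int[nu]_x f x = 0)%E ->
  {ae nu, forall x, f x = 0%E}.
Proof.
move=> mf f0 i0; have := (ae_eq_integral_abs nu measurableT mf).1.
under eq_integral do rewrite gee0_abs//.
move=> /(_ i0); apply: (filterS (F := almost_everywhere nu)) => x; exact.
Qed.

Lemma ae_radial (P : R -> Prop) : {ae mu, forall t, P t} -> {ae mu2, forall z, P (lrad z)}.
Proof.
move=> /ae_measurable_null[A [mA A0 AP]].
exists (lrad @^-1` A); split.
- by rewrite -[X in measurable X]setTI; apply: measurable_lrad.
- have mL : measurable (lrad @^-1` A : set (RR * RR)).
    by rewrite -[X in measurable X]setTI; apply: measurable_lrad.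
  apply: int_indic0 => //.
  transitivity (\int[mu2]_z ((\1_A : R -> R) (lrad z))%:E)%E.
    by apply: eq_integral => z _; rewrite !indicE.
  rewrite radial_integral//.
  transitivity (\int[mu]_(t in A) (2 * pi * expR (- 2 * t))%:E)%E.
    rewrite [RHS]integral_mkcond; apply: eq_integral => t _.
    by rewrite patchE indicE; case: ifP => _; rewrite ?mul1r ?mul0r.
  apply: null_set_integral => //.
  apply/measurable_EFinP/measurable_funTS; apply: measurable_funM => //; exact: measurable_expR2.
- by move=> z /= nP; apply: contrapT => nA; apply: nP; exact: AP.
Qed.

Lemma null_sections (A : set (RR * RR)) : measurable A -> mu2 A = 0%E ->
  {ae mu, forall y, mu [set x | A (x, y)] = 0%E}.
Proof.
move=> mA A0.
have mAi : measurable_fun [set: RR * RR] (\1_A : RR * RR -> R) by exact: measurable_indic.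
have mS y : measurable ([set x | A (x, y)] : set RR).
  by rewrite -[X in measurable X]setTI; exact: (pair2_measurable y measurableT mA).
have E y : (\int[mu]_x (\1_A (x, y))%:E = mu [set x | A (x, y)])%E.
  transitivity (\int[mu]_x (\1_([set x | A (x, y)]) x)%:E)%E.
    by apply: eq_integral => x _; rewrite !indicE.
  by rewrite integral_indic// setIT.
have : {ae mu, forall y, (\int[mu]_x (\1_A (x, y))%:E = 0)%E}.
  apply: (ae_of_int0 (f := fun y => (\int[mu]_x (\1_A (x, y))%:E)%E)).
  - apply: (@measurable_fun_fubini_tonelli_G _ _ RR RR R mu
      (fun z => (\1_A z)%:E)) => //=.
    exact/measurable_EFinP.
  - by move=> y; apply: integral_ge0 => x _; rewrite lee_fin indicE.
  - by rewrite -tonelli21// ?integral_indic// ?setIT// => z; rewrite indicE.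
by apply: (filterS (F := almost_everywhere mu)) => y <-.
Qed.

Lemma ae_interval_exists (P : R -> Prop) (a b : R) : a < b -> {ae mu, forall y, P y} ->
  exists y, a < y < b /\ P y.
Proof.
move=> ab /ae_measurable_null[A [mA A0 AP]].
apply: contrapT => nex.
have sub : `]a, b[%classic `<=` A.
  by move=> y; rewrite /= in_itv/= => yab; apply: contrapT => /AP Py; apply: nex; exists y.
have : (mu `]a, b[%classic <= mu A)%E by apply: le_measure; rewrite ?inE.
rewrite [X in (_ <= X)%E]A0 leb1E lebesgue_measure_itv/= lte_fin ab -EFinD lee_fin; lra.
Qed.

Lemma cut_sec (y x : R) : y != 0 -> 0 <= x -> cut y (sec y x) = x.
Proof.
move=> y0 x0; have c := sec_cut y0 (sec y x).
have : sec y (cut y (sec y x)) = sec y x.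
  by rewrite c; apply: min_l; rewrite sec_anti// expr0n sqr_ge0.
move=> E; apply/eqP; rewrite eq_le; apply/andP; split.
  by rewrite -(sec_le_cut y0 _ x0).
have : sec y (cut y (sec y x)) <= sec y x by rewrite E.
have : sec y x >= sec y (cut y (sec y x)) by rewrite E.
rewrite sec_anti// ler_pXn2r ?nnegrE ?sqrtr_ge0//.
Qed.

Lemma measurable_cut (y : R) : measurable_fun [set: RR] (cut y : RR -> RR).
Proof.
apply: (@measurableT_comp _ _ _ RR RR RR (@Num.sqrt R)).
  by apply: continuous_measurable_fun; exact: sqrt_continuous.
apply: measurable_funB => //; apply: measurable_funX.
apply: (measurableT_comp (@measurable_expR R)).
exact: measurable_opp.
Qed.

Lemma enorm_lrad (z : R * R) : z != (0, 0) -> enorm z = expR (- lrad z).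
Proof.
rewrite -enorm_eq0 => z0; have zp : 0 < enorm z by rewrite lt_neqAle eq_sym z0 enorm_ge0.
by rewrite /lrad opprK lnK.
Qed.

(** The change of variable [section_cov] carries a null set of abscissas to a null set of parameters
    [s]. *)
Lemma section_null (y : R) (A : set (RR * RR)) : y != 0 -> measurable A ->
  mu [set x | A (x, y)] = 0%E ->
  {ae mu, forall s, s <= sec y 0 -> ~ A (cut y s, y)}.
Proof.
move=> y0 mA A0.
have mS : measurable ([set x | A (x, y)] : set RR).
  by rewrite -[X in measurable X]setTI; exact: (pair2_measurable y measurableT mA).
have mc := measurable_cut y.
pose G (s : R) : R := \1_([set x | A (x, y)]) (cut y s).
have mG : measurable_fun [set: RR] G.
  have mi : measurable_fun [set: RR] (\1_([set x | A (x, y)]) : RR -> R) by exact: measurable_indic.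
  exact: (measurableT_comp mi mc).
have : {ae mu, forall s : RR, (G s * below y s)%:E = 0%E}.
  apply: (ae_of_int0 (T := RR) (f := fun s => (G s * below y s)%:E)).
  - by apply/measurable_EFinP; apply: measurable_funM => //; exact: measurable_indic.
  - by move=> s; rewrite lee_fin mulr_ge0// /G /below indicE.
  - rewrite -section_cov//.
    transitivity (\int[mu]_(x in [set x | A (x, y)]) (secw y x)%:E)%E.
      rewrite [RHS]integral_mkcond; apply: eq_integral => x _; rewrite patchE /G.
      have [x0|x0] := leP 0 x; last first.
        by rewrite /secw max_r ?(ltW x0)// mul0r mulr0; case: ifP.
      by rewrite cut_sec// indicE; case: ifP => _; rewrite ?mul1r ?mul0r.
    apply: null_set_integral => //.
    by apply/measurable_EFinP/measurable_funTS; exact: measurable_secw.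
apply: (filterS (F := almost_everywhere mu)) => s [] + sL As.
have -> : G s = 1 by rewrite /G indicE mem_set.
have -> : below y s = 1 by rewrite /below indicE mem_set//= in_itv.
by move/eqP; rewrite mulr1 oner_eq0.
Qed.

(** [f] may fail to be measurable. On a horizontal line whose section of the exceptional set is
    null, [u (cut y s, y)] is a measurable function of [s], equal to [f (expR (- s))] for almost
    every [s <= sec y 0]. Ordinates tending to 0 exhaust all [s]. *)
Lemma radial_representative (u : R * R -> R) (f : R -> R) :
  measurable_fun [set: RR * RR] u -> {ae mu2, forall z, u z = f (enorm z)} ->
  exists2 v : R -> R, measurable_fun [set: RR] v & {ae mu2, forall z, u z = v (lrad z)}.
Proof.
move=> mu_ uf; have [A [mA A0 AP]] := ae_measurable_null uf.
have good := null_sections mA A0.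
have ex (n : nat) : exists y : R, 0 < y < n.+1%:R^-1 /\ mu [set x | A (x, y)] = 0%E.
  by apply: ae_interval_exists good; rewrite invr_gt0.
pose y n := projT1 (cid (ex n)).
have yP n : 0 < y n < n.+1%:R^-1 by rewrite /y; case: cid => z [].
have yA n : mu [set x | A (x, y n)] = 0%E by rewrite /y; case: cid => z [].
have y0 n : y n != 0 by have /andP[/lt0r_neq0] := yP n.
pose vn n (s : R) := u (cut (y n) s, y n).
have mvn n : measurable_fun [set: RR] (vn n).
  have mc : measurable_fun [set: RR] (fun s : RR => (cut (y n) s, y n) : RR * RR).
    by apply/measurable_fun_pair => //; exact: measurable_cut.
  exact: (measurableT_comp mu_ mc).
(* A limsup of measurable functions is measurable; for almost every [s] the sequence is eventually
   constant, equal to [f (expR (- s))]. *)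
pose v (s : R) := fine (limn_esup (fun n => (vn n s)%:E)).
have mv : measurable_fun [set: RR] v.
  apply: (@measurableT_comp _ _ _ _ _ _ fine) => //.
  by apply: measurable_fun_limn_esup => n; exact/measurable_EFinP.
have vf : {ae mu, forall s, v s = f (expR (- s))}.
  have : {ae mu, forall s, forall n, s <= sec (y n) 0 -> ~ A (cut (y n) s, y n)}.
    by apply/ae_foralln => n; exact: section_null.
  apply: (filterS (F := almost_everywhere mu)) => s sn.
  have lim : (vn n s)%:E @[n --> \oo] --> (f (expR (- s)))%:E.
    (* The line of ordinate [y n] meets the circle of radius [expR (- s)] when [y n <= expR (- s)],
       which holds once [n >= expR s]. *)
    apply: cvg_near_cst; apply: filterS (nbhs_infty_ger (expR s)) => n ns; congr EFin.
    have sL : s <= sec (y n) 0.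
      rewrite leNgt; apply/negP => /ltW; rewrite sec_le// expr0n subr_le0.
      have /andP[yn0 yn1] := yP n.
      rewrite ler_pXn2r ?nnegrE ?expR_ge0 ?(ltW yn0)// => h.
      have := lt_le_trans (le_lt_trans h yn1) _ => /(_ (expR (- s))).
      rewrite ltxx => H; suff : false by []. apply: H.
      rewrite expRN lef_pV2 ?posrE ?expR_gt0//; apply: le_trans ns _.
      by rewrite ler_nat.
    rewrite /vn AP; last exact: sn.
    congr f; rewrite enorm_lrad; last by apply: contra_neq (y0 n) => -[].
    by rewrite -[lrad _]/(sec (y n) (cut (y n) s)) sec_cut// min_l.
  rewrite /v is_cvg_limn_esupE; last by apply/cvg_ex; eexists; exact: lim.
  by move/cvg_lim : lim => -> //.
exists v => //.
have aez : {ae mu2, forall z, z != (0, 0)} by exact: ae_origin.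
apply: (filterS3 (F := almost_everywhere mu2)) uf (ae_radial vf) aez => z -> -> z0.
by rewrite enorm_lrad.
Qed.

Lemma push_radial (G : R -> R) : measurable_fun [set: RR] G -> (forall t, 0 <= G t) ->
  (\int[mu2]_z (G (lrad z) * cst 1 z)%:E = \int[mu]_t (G t * (2 * pi * expR (- 2 * t)))%:E)%E.
Proof.
move=> mG G0; rewrite -radial_integral//.
by apply: eq_integral => z _; rewrite mulr1.
Qed.

Lemma Rradial_integral (G : R -> R) : measurable_fun [set: RR] G ->
  mu.-integrable setT (EFin \o (fun t => G t * (2 * pi * expR (- 2 * t)))) ->
  \int[mu2]_z G (lrad z) = \int[mu]_t (G t * (2 * pi * expR (- 2 * t))).
Proof.
move=> mG i; rewrite -(Rintegral_pushforward_density (nu := mu2) (w := cst 1) (phi := lrad) _ _ _ _ _ push_radial mG i)//.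
- by apply: eq_Rintegral => z _; rewrite mulr1.
- exact: measurable_lrad.
- by apply: measurable_funM => //; exact: measurable_expR2.
- by move=> t; rewrite !mulr_ge0 ?expR_ge0 ?pi_ge0.
Qed.

(** On a bounded interval [v] is the product of the square-integrable function [v t * expR (- t)]
    and a truncated exponential. *)
Lemma weighted_loc_int (v : R -> R) : measurable_fun [set: RR] v ->
  (\int[mu]_t (v t ^+ 2 * expR (- 2 * t))%:E < +oo)%E -> loc_int v.
Proof.
move=> mv v2; split=> // M.
have mI : measurable (`[- M, M]%classic : set RR) by exact: measurable_itv.
pose h t := v t * expR (- t).
have h2 : h \in Lfun mu 2%:E.
  apply/Lfun2P; split.
    apply: measurable_funM => //; apply: (measurableT_comp (@measurable_expR R)).
    exact: measurable_opp.
  apply: le_lt_trans v2; rewrite le_eqVlt; apply/orP; left; apply/eqP.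
  apply: eq_integral => t _; congr EFin; rewrite /h exprMn; congr (_ * _).
  by rewrite expr2 -expRD; congr expR; ring.
have k2 : ((@expR R) \_ `[- M, M]%classic) \in Lfun mu 2%:E.
  apply/Lfun2P; split.
    apply/(measurable_restrictT _ mI); apply: measurable_funTS; exact: measurable_expR.
  have mex : measurable_fun [set: RR] (@expR R \_ `[- M, M]%classic).
    by apply/(measurable_restrictT _ mI); apply: measurable_funTS; exact: measurable_expR.
  have i1 : (\1_(`[- M, M]%classic) : R -> R) \in Lfun mu 2%:E.
    apply: indic_L2 => //.
    by rewrite leb1E lebesgue_measure_itv/=; case: ifP => _; rewrite -?EFinB ltry.
  have /Lfun2P[m1 fin] := L2_lin (expR M) i1 (L2_0 mu).
  apply: le_lt_trans fin; apply: int_le.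
  - exact: measurable_funX.
  - exact: measurable_funX.
  - by move=> x; exact: sqr_ge0.
  move=> x; rewrite patchE addr0 indicE; case: ifPn => [|_].
    rewrite inE/= in_itv/= => /andP[_ xM].
    by rewrite mulr1 ler_pXn2r ?nnegrE ?expR_ge0// ler_expR.
  by change ((0 : R) ^+ 2 <= (expR M * 0) ^+ 2); rewrite mulr0.
apply/integrable_mkcond => //.
apply: eq_integrable (L2_integrable_prod h2 k2) => // x _.
rewrite !patchE /h; case: ifP => _ /=; last by rewrite [X in X%:E]mulr0.
by rewrite -mulrA -expRD addNr expR0 mulr1.
Qed.

End RadialRepresentative.

(** * Radial derivative found by testing with radial vector fields *)

Section RadialFields.
Context {R : realType}.
Local Notation RR := (measurableTypeR R).
Notation mu := (@leb1 R).
Notation mu2 := (@leb2 R).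
Implicit Types chi : R -> R.

(* [rtest chi (|z| ^ 2) = chi (lrad z) / |z| ^ 2]: the field [z * rtest chi (|z| ^ 2)]
   is smooth at the origin, where it vanishes, and its divergence is
   [- chi' (lrad z) / |z| ^ 2]. *)
Definition rtest chi (t : R) : R := if 0 < t then chi (- (2^-1 * ln t)) / t else 0.

(** Chosen so that [rtest (rtest_deriv chi)] is the derivative of [rtest chi], with [expR (2 * s)]
    standing for [t^-1]: the functions [rtest chi] thus form a class closed under derivation. *)
Definition rtest_deriv chi (s : R) : R :=
  (- 2^-1 * (chi^`())%classic s + - 1 * chi s) * expR (2 * s).

Lemma test1_rtest_deriv chi : test1 chi -> test1 (rtest_deriv chi).
Proof.
move=> tc; have [cC [S Sc]] := test1_lin (- 2^-1) (- 1) (test1_derive tc) tc.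
split; last by exists S => x /Sc; rewrite /rtest_deriv => ->; rewrite mul0r.
apply: cinfM => //; apply: cinf_comp; first exact: cinf_expR.
have := cinf_affine 2 (0 : R); rewrite (_ : (fun x => _) = fun x => 2 * x)//.
by apply/funext => x; rewrite addr0.
Qed.

(** [chi] vanishes for large [s], that is near the origin; this makes [rtest chi] smooth across
    0. *)
Lemma rtest0 chi : test1 chi -> exists2 d : R, 0 < d & forall t, t < d -> rtest chi t = 0.
Proof.
move=> [_ [S Sc]]; exists (expR (- (2 * `|S|))) => [|t td]; first exact: expR_gt0.
rewrite /rtest; case: ifPn => // t0; rewrite Sc ?mul0r//.
have : ln t < - (2 * `|S|) by rewrite -[X in _ < X]expRK ltr_ln ?posrE ?expR_gt0.
have := ler_norm S; have := ler_norm (- (2^-1 * ln t)); lra.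
Qed.

Lemma is_derive_rtest chi (t : R) : test1 chi ->
  is_derive t (1 : R) (rtest chi) (rtest (rtest_deriv chi) t).
Proof.
move=> tc; have [t0|t0] := ltP 0 t; last first.
  have [d d0 dc] := rtest0 tc; have [d' d'0 dc'] := rtest0 (test1_rtest_deriv tc).
  rewrite dc'; last exact: le_lt_trans t0 d'0.
  have dz : is_derive t (1 : R) (cst (0 : R)) (0 : R) by exact: is_derive_cst.
  apply: (near_eq_is_derive _ dz).
  near=> y; rewrite dc//; near: y; apply: lt_nbhsl; exact: le_lt_trans t0 d0.
apply: (near_eq_is_derive (f := (fun t : R => chi (- (2^-1 * ln t))) * (fun t : R => t^-1))).
  by near=> y; rewrite /rtest ifT//; near: y; exact: lt_nbhsr.
have dl : is_derive t (1 : R) (fun t : R => - (2^-1 * ln t)) (- (2^-1 * t^-1)).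
  apply: is_deriveN; apply: (@is_deriveZ _ _ _ (@ln R) 2^-1 t 1 t^-1); exact: is_derive1_ln.
have d1 : is_derive t (1 : R) (fun t : R => chi (- (2^-1 * ln t)))
    ((chi^`())%classic (- (2^-1 * ln t)) * (- (2^-1 * t^-1))).
  apply: (@is_derive1_comp _ chi (fun t => - (2^-1 * ln t))).
  by apply: is_derive_cinf; case: tc.
have tn0 : t != 0 by rewrite gt_eqF.
have d2 := is_derive_inv tn0.
have dM := is_deriveM d1 d2; apply: is_derive_eq.
rewrite /GRing.scale /= /rtest t0 /rtest_deriv.
have -> : expR (2 * - (2^-1 * ln t)) = t^-1.
  by rewrite mulrN mulVKf// expRN lnK.
by field.
Unshelve. all: by end_near. Qed.

Lemma cinf_rtest chi : test1 chi -> cinf (rtest chi).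
Proof.
move=> tc; exists [set f | exists2 c, test1 c & f = rtest c]; split; first by exists chi.
move=> _ [c tc' ->]; split; first by move=> x; have [] := is_derive_rtest x tc'.
exists (rtest_deriv c); first exact: test1_rtest_deriv.
by apply/funext => x; rewrite derive1E; have [_ ->] := is_derive_rtest x tc'.
Qed.

Lemma rtest_lrad chi (z : R * R) : z != (0, 0) ->
  rtest chi (z.1 ^+ 2 + z.2 ^+ 2) = chi (lrad z) * expR (2 * lrad z).
Proof.
move=> z0; rewrite expR_lrad// /rtest -enorm_sqr.
have zp : 0 < enorm z by rewrite lt_neqAle eq_sym enorm_eq0 z0 enorm_ge0.
by rewrite exprn_gt0// lnXn// -[ln _ *+ 2]mulr_natl mulKf.
Qed.

Lemma smooth_alg_sqr : smooth_alg (fun z : R * R => z.1 ^+ 2 + z.2 ^+ 2).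
Proof.
apply: (@SAadd _ _ (fun z : R * R => z.1 ^+ 2) (fun z : R * R => z.2 ^+ 2)).
- by apply: (@SAmul _ _ fst fst); exact: smooth_alg_fst.
- by apply: (@SAmul _ _ snd snd); exact: smooth_alg_snd.
Qed.

Lemma field_test chi (w : R * R -> R) : test1 chi -> smooth_alg w ->
  test_function (fun z : R * R => w z * rtest chi (z.1 ^+ 2 + z.2 ^+ 2)).
Proof.
move=> tc sw; have [S S0 Sc] := test1_support tc.
apply: (@smooth_alg_test2 _ _ (expR S)).
  apply: SAmul => //; apply: (@SAcomp _ _ (rtest chi) (fun z : R * R => z.1 ^+ 2 + z.2 ^+ 2)).
    exact: cinf_rtest.
  exact: smooth_alg_sqr.
move=> z zS; have Sz : expR S < enorm z.
  by case: zS => /lt_le_trans; apply; [exact: le_enorm1|exact: le_enorm2].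
have z0 : z != (0, 0).
  by rewrite -enorm_eq0 gt_eqF// (lt_trans (expR_gt0 S)).
rewrite rtest_lrad// Sc ?mul0r ?mulr0//.
have : S < ln (enorm z) by rewrite -[X in X < _]expRK ltr_ln ?posrE ?expR_gt0// (lt_trans (expR_gt0 S)).
by rewrite /lrad normrN => /ltW /le_trans; apply; exact: ler_norm.
Qed.

Lemma derive_field1 chi (z : R * R) : test1 chi ->
  'D_e1 (fun z : R * R => z.1 * rtest chi (z.1 ^+ 2 + z.2 ^+ 2)) z =
  rtest chi (z.1 ^+ 2 + z.2 ^+ 2) + z.1 * (rtest (rtest_deriv chi) (z.1 ^+ 2 + z.2 ^+ 2) * (2 * z.1)).
Proof.
move=> tc; have tphi := field_test tc smooth_alg_fst.
case: z => x y; have [_ <-] := is_derive_line1 (tphi.1 [::] (x, y)).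
have dq : is_derive x (1 : R) (fun x : R => x ^+ 2 + y ^+ 2) (2 * x).
  by apply: is_derive_eq; rewrite /GRing.scale/= addr0 mulr1; ring.
have dr : is_derive x (1 : R) (fun x : R => rtest chi (x ^+ 2 + y ^+ 2))
    (rtest (rtest_deriv chi) (x ^+ 2 + y ^+ 2) * (2 * x)).
  apply: (@is_derive1_comp _ (rtest chi) (fun x => x ^+ 2 + y ^+ 2)).
  exact: is_derive_rtest.
have [_ ->] := is_deriveM (is_derive_id x (1 : R)) dr.
by rewrite /GRing.scale /=; ring.
Qed.

Lemma derive_field2 chi (z : R * R) : test1 chi ->
  'D_e2 (fun z : R * R => z.2 * rtest chi (z.1 ^+ 2 + z.2 ^+ 2)) z =
  rtest chi (z.1 ^+ 2 + z.2 ^+ 2) + z.2 * (rtest (rtest_deriv chi) (z.1 ^+ 2 + z.2 ^+ 2) * (2 * z.2)).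
Proof.
move=> tc; have tphi := field_test tc smooth_alg_snd.
case: z => x y; have [_ <-] := is_derive_line2 (tphi.1 [::] (x, y)).
have dq : is_derive y (1 : R) (fun y : R => x ^+ 2 + y ^+ 2) (2 * y).
  by apply: is_derive_eq; rewrite /GRing.scale/= add0r mulr1; ring.
have dr : is_derive y (1 : R) (fun y : R => rtest chi (x ^+ 2 + y ^+ 2))
    (rtest (rtest_deriv chi) (x ^+ 2 + y ^+ 2) * (2 * y)).
  apply: (@is_derive1_comp _ (rtest chi) (fun y => x ^+ 2 + y ^+ 2)).
  exact: is_derive_rtest.
have [_ ->] := is_deriveM (is_derive_id y (1 : R)) dr.
by rewrite /GRing.scale /=; ring.
Qed.

Lemma divergence_field chi (z : R * R) : test1 chi -> z != (0, 0) ->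
  'D_e1 (fun z : R * R => z.1 * rtest chi (z.1 ^+ 2 + z.2 ^+ 2)) z +
  'D_e2 (fun z : R * R => z.2 * rtest chi (z.1 ^+ 2 + z.2 ^+ 2)) z =
  - ((chi^`())%classic (lrad z) * expR (2 * lrad z)).
Proof.
move=> tc z0; rewrite derive_field1// derive_field2// !rtest_lrad// /rtest_deriv expR_lrad//.
have q0 : z.1 ^+ 2 + z.2 ^+ 2 != 0 by rewrite -enorm_sqr expf_neq0// enorm_eq0.
by field.
Qed.

Lemma radg_field chi (w : R * R -> R) (z : R * R) : w (0, 0) = 0 ->
  w z * rtest chi (z.1 ^+ 2 + z.2 ^+ 2) = - radg chi w z.
Proof.
move=> w0; rewrite /radg opprK; have [->|z0] := eqVneq z (0, 0); first by rewrite w0 !mul0r mulr0.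
by rewrite rtest_lrad//; ring.
Qed.

Lemma test1_L2 chi : test1 chi -> chi \in Lfun mu 2%:E.
Proof.
move=> tc; have [M M0 fM] := test1_support tc; have [C fC] := test1_bounded tc.
have i1 : (\1_(`[- M, M]%classic) : R -> R) \in Lfun mu 2%:E.
  apply: indic_L2; first exact: measurable_itv.
  by rewrite leb1E lebesgue_measure_itv/=; case: ifP => _; rewrite -?EFinB ltry.
apply/Lfun2P; split; first by apply: measurable_cinf; case: tc.
have /Lfun2P[m1 fin] := L2_lin C i1 (L2_0 mu).
apply: le_lt_trans fin; apply: int_le.
- by apply: measurable_funX; apply: measurable_cinf; case: tc.
- exact: measurable_funX.
- by move=> x; exact: sqr_ge0.
move=> x; rewrite addr0 indicE; case: (boolP (x \in _)) => [_|].
  rewrite mulr1 -[X in X <= _]real_normK ?num_real// ler_pXn2r ?nnegrE//.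
  exact: le_trans (normr_ge0 _) (fC x).
rewrite notin_setE/= in_itv/= -ler_norml => /negP; rewrite -ltNge => /ltW /fM ->.
by rewrite expr0n sqr_ge0.
Qed.

(** The pairing of [(g1, g2)] with the field [z * chi (lrad z) / |z| ^ 2]; for the gradient of
    [v (lrad z)] it is [- 2 * pi] times the integral of [v' * chi]. *)
Definition flux (g1 g2 : R * R -> R) chi : R :=
  - (ip mu2 g1 (radg chi fst) + ip mu2 g2 (radg chi snd)).

Lemma radg_fst_L2 chi : chi \in Lfun mu 2%:E -> radg chi fst \in Lfun mu2 2%:E.
Proof. by move=> c2; apply: radg_L2 => // z; exact: fst_sqr_le. Qed.

Lemma radg_snd_L2 chi : chi \in Lfun mu 2%:E -> radg chi snd \in Lfun mu2 2%:E.
Proof. by move=> c2; apply: radg_L2; [|exact: measurable_snd|exact: snd_sqr_le]. Qed.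

Lemma ip_radg_le chi (w : R * R -> R) : chi \in Lfun mu 2%:E ->
  measurable_fun [set: RR * RR] w -> (forall z, w z ^+ 2 <= z.1 ^+ 2 + z.2 ^+ 2) ->
  ip mu2 (radg chi w) (radg chi w) <= 2 * pi * ip mu chi chi.
Proof.
move=> c2 mw wz; have r2 := radg_L2 c2 mw wz; have mc := Lfun2_measurable c2.
rewrite -lee_fin -L2_integral_sqr// -radial_energy//; apply: int_le.
- by apply: measurable_funX; exact: radg_measurable.
- apply: (radial_measurable (g := fun t => chi t ^+ 2 * expR (2 * t))).
  by apply: measurable_funM; [exact: measurable_funX|exact: measurable_expR2].
- by move=> z; exact: sqr_ge0.
- by move=> z; exact: radg_sqr.
Qed.

Lemma plane_CS (f g : R * R -> R) : f \in Lfun mu2 2%:E -> g \in Lfun mu2 2%:E ->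
  ip mu2 f g ^+ 2 <= ip mu2 f f * ip mu2 g g.
Proof.
move=> f2 g2; apply: (ph_CS (L2on_preHilbert mu2 measurableT)); split=> //;
  by move=> x /(_ I).
Qed.

(** Riesz representation yields the radial derivative directly, without averaging the gradient over
    circles. The bound combines [(a + b) ^ 2 <= 2 * a ^ 2 + 2 * b ^ 2] with Cauchy-Schwarz and the
    energy of radial fields. *)
Lemma flux_riesz (g1 g2 : R * R -> R) : g1 \in Lfun mu2 2%:E -> g2 \in Lfun mu2 2%:E ->
  exists2 G : R -> R, G \in Lfun mu 2%:E &
    forall chi, chi \in Lfun mu 2%:E -> flux g1 g2 chi = ip mu G chi.
Proof.
move=> h1 h2; have PH := L2on_preHilbert mu measurableT.
pose K := 2 * (ip mu2 g1 g1 + ip mu2 g2 g2) * (2 * pi).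
have K0 : 0 <= K.
  apply: mulr_ge0; last by rewrite mulr_ge0// pi_ge0.
  by apply: mulr_ge0 => //; apply: addr_ge0; exact: ip_ge0.
have [||G [G2 _] Gl] := ph_riesz PH (l := flux g1 g2) K0.
- move=> a x y [x2 _] [y2 _]; have x1 := radg_fst_L2 x2; have x3 := radg_snd_L2 x2.
  have y1 := radg_fst_L2 y2; have y3 := radg_snd_L2 y2.
  have E (w : R * R -> R) : radg (a *: x + y) w = fun z => a * radg x w z + radg y w z.
    by apply/funext => z; rewrite /radg !fctE /GRing.scale /=; ring.
  have L (g r s : R * R -> R) : g \in Lfun mu2 2%:E -> r \in Lfun mu2 2%:E ->
      s \in Lfun mu2 2%:E -> ip mu2 g (fun z => a * r z + s z) = a * ip mu2 g r + ip mu2 g s.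
    by move=> ? ? ?; rewrite ipC ipl// (ipC mu2 r) (ipC mu2 s).
  by rewrite /flux !E L// L//; ring.
- move=> x [x2 _]; have x1 := radg_fst_L2 x2; have x3 := radg_snd_L2 x2.
  have c1 := plane_CS h1 x1; have c2 := plane_CS h2 x3.
  have d1 : ip mu2 (radg x fst) (radg x fst) <= 2 * pi * ip mu x x.
    by apply: ip_radg_le => // z; exact: fst_sqr_le.
  have d2 : ip mu2 (radg x snd) (radg x snd) <= 2 * pi * ip mu x x.
    by apply: ip_radg_le; [|exact: measurable_snd|exact: snd_sqr_le].
  have b1 := le_trans c1 (ler_wpM2l (ip_ge0 mu2 g1) d1).
  have b2 := le_trans c2 (ler_wpM2l (ip_ge0 mu2 g2) d2).
  rewrite /flux sqrrN; move: b1 b2.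
  move: (ip mu2 g1 (radg x fst)) (ip mu2 g2 (radg x snd)) => a b b1 b2.
  apply: (@le_trans _ _ (2 * a ^+ 2 + 2 * b ^+ 2)).
    by have := sqr_ge0 (a - b); nra.
  by rewrite /K; lra.
exists G => // chi c2; by apply: Gl; split=> // x /(_ I).
Qed.

Lemma Rradial_integrable (G : R -> R) : measurable_fun [set: RR] G ->
  mu.-integrable setT (EFin \o (fun t => G t * (2 * pi * expR (- 2 * t)))) ->
  mu2.-integrable setT (EFin \o (fun z => G (lrad z))).
Proof.
move=> mG i.
have mh : measurable_fun [set: RR] (fun t : R => 2 * pi * expR (- 2 * t)).
  by apply: measurable_funM => //; exact: measurable_expR2.
have h0 (t : R) : 0 <= 2 * pi * expR (- 2 * t) by rewrite !mulr_ge0 ?expR_ge0 ?pi_ge0.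
have m1 : measurable_fun [set: RR * RR] (cst 1 : RR * RR -> R) by [].
have := (integrable_pushforward_density m1 (fun=> ler01) (@measurable_lrad R) mh h0 (@push_radial R) mG).2 i.
by apply: eq_integrable => // z _ /=; rewrite mulr1.
Qed.

(** Both weak derivatives are tested at once, so that only the divergence of the field appears; its
    factor [|z| ^ -2] cancels the Jacobian of polar coordinates. *)
Lemma flux_test (u g1 g2 : R * R -> R) (v chi : R -> R) :
  u \in Lfun mu2 2%:E -> g1 \in Lfun mu2 2%:E -> g2 \in Lfun mu2 2%:E ->
  is_weak_partial e1 u g1 -> is_weak_partial e2 u g2 ->
  loc_int v -> {ae mu2, forall z, u z = v (lrad z)} -> test1 chi ->
  flux g1 g2 chi = 2 * pi * \int[mu]_s (v s * (chi^`())%classic s).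
Proof.
move=> u2 h1 h2 ug1 ug2 iv uv tc; have c2 := test1_L2 tc; have tc' := test1_derive tc.
have c'2 := test1_L2 tc'; have mc' := Lfun2_measurable c'2; case: (iv) => mv _.
pose phi1 := fun z : R * R => z.1 * rtest chi (z.1 ^+ 2 + z.2 ^+ 2).
pose phi2 := fun z : R * R => z.2 * rtest chi (z.1 ^+ 2 + z.2 ^+ 2).
have t1 : test_function phi1 := field_test tc smooth_alg_fst.
have t2 : test_function phi2 := field_test tc smooth_alg_snd.
have [cphi1 cD1 [M1 M10 phiM1]] := test_function_facts e1 t1.
have [cphi2 cD2 [M2 M20 phiM2]] := test_function_facts e2 t2.
have D1 : (fun z => 'D_e1 phi1 z) \in Lfun mu2 2%:E.
  by apply: (cc_plane_L2 (M := M1)) => // z /phiM1[].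
have D2 : (fun z => 'D_e2 phi2 z) \in Lfun mu2 2%:E.
  by apply: (cc_plane_L2 (M := M2)) => // z /phiM2[].
have j1 := L2_integrable_prod u2 D1; have j2 := L2_integrable_prod u2 D2.
have E1 : ip mu2 g1 (radg chi fst) = - \int[mu2]_z (g1 z * phi1 z).
  have i1 := L2_integrable_prod h1 (radg_fst_L2 c2).
  rewrite -[LHS]opprK; congr (- _); rewrite -mulN1r -RintegralZl//.
  by apply: eq_Rintegral => z _; rewrite /phi1 radg_field//; ring.
have E2 : ip mu2 g2 (radg chi snd) = - \int[mu2]_z (g2 z * phi2 z).
  have i2 := L2_integrable_prod h2 (radg_snd_L2 c2).
  rewrite -[LHS]opprK; congr (- _); rewrite -mulN1r -RintegralZl//.
  by apply: eq_Rintegral => z _; rewrite /phi2 radg_field//; ring.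
rewrite /flux E1 E2 -(ug1 _ t1) -(ug2 _ t2) -RintegralD//.
pose G s := v s * ((chi^`())%classic s * expR (2 * s)).
have mG : measurable_fun [set: RR] G.
  by apply: measurable_funM => //; apply: measurable_funM => //; exact: measurable_expR2.
have GE : (fun t => G t * (2 * pi * expR (- 2 * t))) = (fun t => 2 * pi * (v t * (chi^`())%classic t)).
  apply/funext => t; have e : expR (2 * t) * expR (- 2 * t) = 1 by rewrite -expRD mulNr subrr expR0.
  transitivity (2 * pi * (v t * (chi^`())%classic t) * (expR (2 * t) * expR (- 2 * t))).
    by rewrite /G; ring.
  by rewrite e mulr1.
have ivc := loc_int_test iv tc'.
have iG : mu.-integrable setT (EFin \o (fun t => G t * (2 * pi * expR (- 2 * t)))).
  rewrite GE; have := integrableZl measurableT (2 * pi) ivc.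
  by move=> i; apply: eq_integrable i.
rewrite -RintegralZl// -GE -Rradial_integral//.
have muD : measurable_fun [set: RR * RR] (fun z => u z * 'D_e1 phi1 z + u z * 'D_e2 phi2 z).
  by apply: measurable_funD; apply/measurable_EFinP; [case/integrableP : j1|case/integrableP : j2].
rewrite -[RHS]opprK -[X in _ = - X]mulN1r -RintegralZl//; last exact: Rradial_integrable.
congr (- _).
apply: ae_eq_Rint => //; first by apply: measurable_funM => //; exact: radial_measurable.
have aez : {ae mu2, forall z, z != (0, 0)} by exact: ae_origin.
apply: (filterS2 (F := almost_everywhere mu2)) uv aez => z uz z0.
by rewrite -mulrDr divergence_field// uz /G; ring.
Qed.

Lemma H1rad_rad (u : R * R -> R) : H1rad u -> exists v g, rad u v g.
Proof.
move=> [[u2 Hu] [f uf]]; have mu_ := Lfun2_measurable u2.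
have [v mv uv] := radial_representative mu_ uf.
have [g1 [h1 ug1]] := Hu e1 (or_introl erefl).
have [g2 [h2 ug2]] := Hu e2 (or_intror erefl).
have v2 : (\int[mu]_t (v t ^+ 2 * expR (- 2 * t))%:E < +oo)%E.
  have /Lfun2P[_ u2'] := u2.
  have : (\int[mu2]_z (u z ^+ 2)%:E = (2 * pi)%:E * \int[mu]_t (v t ^+ 2 * expR (- 2 * t))%:E)%E.
    transitivity (\int[mu2]_z (v (lrad z) ^+ 2)%:E)%E.
      apply: ae_eq_integral => //.
      - by apply/measurable_EFinP; exact: measurable_funX.
      - apply/measurable_EFinP; apply: measurable_funX; exact: radial_measurable.
      - by apply: (filterS (F := almost_everywhere mu2)) uv => z -> _.
    rewrite (radial_integral (G := fun t => v t ^+ 2)).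
    - rewrite -intZ.
      + by apply: eq_integral => t _; congr EFin; ring.
      + by rewrite mulr_ge0// pi_ge0.
      + by apply: measurable_funM; [exact: measurable_funX|exact: measurable_expR2].
      + by move=> t; rewrite mulr_ge0 ?sqr_ge0 ?expR_ge0.
    - exact: measurable_funX.
    - by move=> t; exact: sqr_ge0.
  move=> E; move: u2'; rewrite E; apply: contraPT; rewrite -leNgt leye_eq => /eqP ->.
  by rewrite gt0_muley ?ltxx// lte_fin mulr_gt0// pi_gt0.
have iv := weighted_loc_int mv v2.
have [G G2 Gl] := flux_riesz h1 h2.
(* By [flux_test], [G] is [- 2 * pi] times the weak derivative of [v]; the summand 0 fits the shape
   of [L2_lin]. *)
pose g t := - (2 * pi)^-1 * G t + 0.
have gL2 : g \in Lfun mu 2%:E := L2_lin _ G2 (L2_0 mu).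
have p0 : 2 * pi != 0 :> R by rewrite mulf_neq0// gt_eqF// pi_gt0.
have [|w [wg vw]] := dubois_reymond iv gL2.
  move=> chi tc; have := flux_test u2 h1 h2 ug1 ug2 iv uv tc.
  have c2 := test1_L2 tc; rewrite Gl// => E.
  have := ipl (- (2 * pi)^-1) G2 (L2_0 mu) c2; rewrite /ip -/(ip mu G chi) => ->.
  rewrite E; under [in X in _ + X]eq_Rintegral do rewrite mul0r.
  by rewrite /Rintegral integral0/= addr0 mulNr opprK mulKf.
exists w, g; split => //.
- by apply: (filterS2 (F := almost_everywhere mu2)) uv (ae_radial vw) => z -> ->.
- apply: le_lt_trans v2; rewrite le_eqVlt; apply/orP; left; apply/eqP.
  have mw : measurable_fun [set: RR] w.
    by apply: continuous_measurable_fun; exact: primitive_continuous gL2 wg.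
  apply: ae_eq_integral => //.
  + apply/measurable_EFinP; apply: measurable_funM; [exact: measurable_funX|exact: measurable_expR2].
  + apply/measurable_EFinP; apply: measurable_funM; [exact: measurable_funX|exact: measurable_expR2].
  + by apply: (filterS (F := almost_everywhere mu)) vw => t -> _.
Qed.

End RadialFields.

(** * Estimates of the Orlicz norm *)

Section Strauss.
Context {R : realType}.
Local Notation RR := (measurableTypeR R).
Notation mu := (@leb1 R).
Notation mu2 := (@leb2 R).

(** [v s] is compared with [v t] for [t] in an interval of length [h = expR s] to the left of [s].
    There the weight is at least [h ^ -2], so the mean of [v ^ 2] is at most [h * N], while the
    squared oscillation is also at most [h * N]: this balance fixes [h]. *)
Lemma strauss (v g : R -> R) (N : R) : g \in Lfun mu 2%:E -> primitive v g ->
  ip mu g g <= N -> (\int[mu]_t (v t ^+ 2 * expR (- 2 * t))%:E <= N%:E)%E ->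
  forall s, s <= 0 -> v s ^+ 2 <= 4 * N * expR s.
Proof.
move=> g2 vg gN vN s s0.
have mv : measurable_fun [set: RR] v.
  by apply: continuous_measurable_fun; exact: primitive_continuous g2 vg.
have N0 : 0 <= N by exact: le_trans (ip_ge0 _ _) gN.
pose h := expR s; have h0 : 0 < h by exact: expR_gt0.
have h1 : h <= 1 by rewrite -expR0 ler_expR.
pose A := `](s - h), s]%classic; have mA : measurable (A : set RR) by exact: measurable_itv.
have muA : mu A = h%:E.
  rewrite leb1E lebesgue_measure_itv/= lte_fin ifT; last by lra.
  by rewrite -EFinB; congr EFin; ring.
have m1 : measurable_fun [set: RR] (\1_A : RR -> R) by exact: measurable_indic.
have mve : measurable_fun [set: RR] (fun t => v t ^+ 2 * expR (- 2 * t)).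
  by apply: measurable_funM; [exact: measurable_funX|exact: measurable_expR2].
have : (\int[mu]_t (v s ^+ 2 * \1_A t)%:E <=
    \int[mu]_t (2 * h ^+ 2 * (v t ^+ 2 * expR (- 2 * t)) + 2 * h * N * \1_A t)%:E)%E.
  apply: int_le.
  - exact: measurable_funM.
  - by apply: measurable_funD; exact: measurable_funM.
  - by move=> t; rewrite mulr_ge0 ?sqr_ge0// indicE.
  - move=> t; rewrite indicE; case: (boolP (t \in A)) => [|_]; last first.
      rewrite !mulr0 addr0; apply: mulr_ge0; first by rewrite mulr_ge0// sqr_ge0.
      by rewrite mulr_ge0 ?sqr_ge0 ?expR_ge0.
    rewrite inE /A /= in_itv/= => /andP[t1 t2]; rewrite !mulr1.
    have := primitive_holderT t s g2 vg; rewrite ger0_norm ?subr_ge0// => H.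
    have H1 : (s - t) * ip mu g g <= h * N.
      apply: le_trans (_ : (s - t) * N <= _); first by rewrite ler_wpM2l// subr_ge0.
      by rewrite ler_wpM2r//; lra.
    have e1 : 1 <= h ^+ 2 * expR (- 2 * t).
      rewrite /h expr2 -!expRD -[leLHS]expR0 ler_expR; lra.
    have := ler_wpM2l (sqr_ge0 (v t)) e1; rewrite mulr1 => e2.
    have := sqr_ge0 (2 * v t - v s) => e3.
    have : v s ^+ 2 <= 2 * v t ^+ 2 + 2 * (v s - v t) ^+ 2 by nra.
    by move: e2; rewrite mulrCA; lra.
have n1 t : 0 <= v t ^+ 2 * expR (- 2 * t) by rewrite mulr_ge0 ?sqr_ge0 ?expR_ge0.
have n2 t : 0 <= (\1_A t : R) by rewrite indicE.
rewrite intZ ?sqr_ge0// integral_indic// setIT muA.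
rewrite intD//; [|exact: measurable_funM|exact: measurable_funM
  |by move=> t; rewrite mulr_ge0// mulr_ge0// sqr_ge0|by move=> t; rewrite !mulr_ge0// ltW].
rewrite intZ//; last by rewrite mulr_ge0// sqr_ge0.
rewrite intZ//; last by rewrite !mulr_ge0// ltW.
rewrite integral_indic// setIT muA -!EFinM => H.
have : ((v s ^+ 2 * h)%:E <= (2 * h ^+ 2 * N + 2 * h * N * h)%:E)%E.
  apply: le_trans H _; rewrite EFinD; apply: leeD => //.
  by rewrite (EFinM (2 * h ^+ 2)) lee_wpmul2l// lee_fin mulr_ge0// sqr_ge0.
rewrite lee_fin -/h => H2; rewrite -(ler_pM2r h0); apply: le_trans H2 _.
by rewrite le_eqVlt; apply/orP; left; apply/eqP; ring.
Qed.

Lemma phi_partial (p : nat) (y : R) : 0 <= y -> \sum_(k < p) y ^+ k / k`!%:R <= expR y.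
Proof.
move=> y0; have H := @nondecreasing_cvgn_le R (series (exp_coeff y)).
have -> : expR y = limn (series (exp_coeff y)) by [].
have := H _ (is_cvg_series_exp_coeff y) p.
rewrite /series /= big_mkord; apply.
by apply: nondecreasing_series => n _ _; rewrite /exp_coeff/= divr_ge0// exprn_ge0.
Qed.

Lemma phi_ge0 (p : nat) (y : R) : 0 <= phi_ p y.
Proof.
rewrite /phi_ subr_ge0; have := phi_partial p (sqr_ge0 y).
by under eq_bigr do rewrite -exprM.
Qed.

Lemma phi_anti (p q : nat) (y : R) : (p <= q)%N -> phi_ q y <= phi_ p y.
Proof.
move=> pq; rewrite /phi_ lerB// -[leLHS](big_mkord xpredT (fun k => y ^+ (2 * k) / k`!%:R)).
rewrite -(big_mkord xpredT (fun k => y ^+ (2 * k) / k`!%:R)) [leRHS](big_cat_nat (n := p))//=.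
by rewrite lerDl sumr_ge0// => k _; rewrite divr_ge0// mulnC exprM exprn_even_ge0.
Qed.

Lemma phi_le_exp (p : nat) (y : R) : phi_ p y <= expR (y ^+ 2).
Proof.
have := phi_anti y (leq0n p); rewrite /phi_ [X in _ <= _ - X]big_ord0 subr0.
exact.
Qed.

(** As [phi_ p] decreases in [p], the case [p = 2] is enough: with [t = y ^ 2], multiplying
    [expR t * (1 - t) <= 1] by [1 + t] gives the claim for [t <= 1], and for [t > 1] it follows from
    [expR t <= t ^ 2 * expR t]. For [p = 1] the bound fails near 0, where [expR t - 1] is of order
    [t]. *)
Lemma phi_le4 (p : nat) (y : R) : (1 < p)%N -> phi_ p y <= y ^+ 4 * expR (y ^+ 2).
Proof.
move=> p1; apply: le_trans (phi_anti y p1) _.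
rewrite /phi_ !big_ord_recl big_ord0 /= !(expr0, fact0, divr1, addr0) muln1.
have -> : y ^+ 4 = (y ^+ 2) ^+ 2 by rewrite -exprM.
move: (sqr_ge0 y); move: (y ^+ 2) => t t0.
have e := expR_ge1Dx (- t); have E0 := expR_gt0 t.
have e1 : expR t * (1 - t) <= 1.
  by rewrite -[leRHS](expR0) -(subrr t) expRD ler_wpM2l// expR_ge0.
have [t1|t1] := leP t 1.
  have := ler_wpM2r (_ : 0 <= 1 + t) e1 => /(_ _)/[!mul1r] H.
  have : expR t * (1 - t) * (1 + t) <= 1 + t by apply: H; lra.
  by nra.
have : expR t <= t ^+ 2 * expR t by rewrite ler_peMl ?expR_ge0// -(expr1n _ 2) ler_pXn2r ?nnegrE ?(ltW t1)// ltW.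
by lra.
Qed.

Lemma measurable_phi (p : nat) : measurable_fun [set: RR] (phi_ p : R -> R).
Proof.
rewrite /phi_; apply: measurable_funB.
  by apply: (measurableT_comp (@measurable_expR R)); exact: measurable_funX.
by apply: measurable_sum => k; apply: measurable_funM => //; exact: measurable_funX.
Qed.

(** Up to the factor [2 * pi], the integral of [expR (- 2 * t)] over a half line [[b, +oo[] is
    bounded by the area of a disk; the substitution [t = 3 / 4 * s] changes the rate to [3 / 2]. *)
Lemma integrable_tail (a : R) :
  mu.-integrable setT (EFin \o (fun s : R => expR (- (3 / 2) * s) * \1_(`[a, +oo[%classic) s)).
Proof.
have mI : measurable (`[a, +oo[%classic : set RR) by exact: measurable_itv.
pose b := 3 / 4 * a.
have mb : measurable (`[b, +oo[%classic : set RR) by exact: measurable_itv.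
pose f (t : R) := expR (- 2 * t) * \1_(`[b, +oo[%classic) t.
have mf : measurable_fun [set: RR] f.
  by apply: measurable_funM; [exact: measurable_expR2|exact: measurable_indic].
have fE s : f (3 / 4 * s + 0) = expR (- (3 / 2) * s) * \1_(`[a, +oo[%classic) s.
  rewrite /f addr0; congr (expR _ * _); first by field.
  rewrite !indicE; congr (nat_of_bool _)%:R; apply/idP/idP; rewrite /b !inE/= !in_itv/= !andbT; lra.
have f0 t : 0 <= f t by rewrite mulr_ge0 ?expR_ge0// indicE.
have ff : (\int[mu]_t (f t)%:E < +oo)%E.
  have E : (\int[mu2]_z (\1_(`[b, +oo[%classic : set R) (lrad z))%:E = (2 * pi)%:E * \int[mu]_t (f t)%:E)%E.
    rewrite radial_integral//.
    rewrite -intZ//; last by rewrite mulr_ge0// pi_ge0.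
    by apply: eq_integral => t _; congr EFin; rewrite /f; ring.
  have fin : (\int[mu2]_z (\1_(`[b, +oo[%classic : set R) (lrad z))%:E < +oo)%E.
    apply: le_lt_trans (disk_fin (expR (- b) + 1)).
    rewrite -[disk (_ + _)](setIT) -integral_indic//; last exact: measurable_disk.
    apply: int_le.
    - apply: (@radial_measurable _ (\1_(`[b, +oo[%classic))); exact: measurable_indic.
    - by apply: measurable_indic; exact: measurable_disk.
    - by move=> z; rewrite indicE.
    - move=> z; rewrite !indicE ler_nat; case: (boolP (lrad z \in _)) => // h.
      rewrite mem_set// /disk /=; have [->|z0] := eqVneq z (0, 0).
        by rewrite /enorm/= expr0n addr0 sqrtr0 addr_gt0// expR_gt0.
      rewrite enorm_lrad//; move: h; rewrite inE/= in_itv/= andbT => h.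
      by rewrite ltr_pwDr// ler_expR lerN2.
  move: fin; rewrite E; apply: contraPT; rewrite -leNgt leye_eq => /eqP ->.
  by rewrite gt0_muley ?ltxx// lte_fin mulr_gt0// pi_gt0.
have q0 : (0 : R) < 3 / 4 by lra.
apply/integrableP; split.
  by apply/measurable_EFinP; apply: measurable_funM; [exact: measurable_expR2|exact: measurable_indic].
move: ff; rewrite (ge0_integral_affine 0 q0)//=.
under eq_integral do rewrite fE.
move=> H; rewrite (_ : (fun x => _) = fun s => (expR (- (3 / 2) * s) * \1_(`[a, +oo[%classic) s)%:E); last first.
  by apply/funext => s; rewrite /= ger0_norm// mulr_ge0 ?expR_ge0// indicE.
move: H; apply: contraPT; rewrite -leNgt leye_eq => /eqP ->.
by rewrite gt0_muley ?ltxx// lte_fin.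
Qed.

Lemma rad_lin (a : R) (u1 u2 : R * R -> R) (v1 v2 g1 g2 : R -> R) :
  rad u1 v1 g1 -> rad u2 v2 g2 ->
  rad (fun z => a * u1 z + u2 z) (fun t => a * v1 t + v2 t) (fun t => a * g1 t + g2 t).
Proof.
move=> [mu1 uv1 p1 l1 w1] [mu2' uv2 p2 l2 w2].
have mv1 : measurable_fun [set: RR] v1.
  by apply: continuous_measurable_fun; exact: primitive_continuous l1 p1.
have mv2 : measurable_fun [set: RR] v2.
  by apply: continuous_measurable_fun; exact: primitive_continuous l2 p2.
have me := @measurable_expR2 R (- 2).
split.
- by apply: measurable_funD => //; exact: measurable_funM.
- by apply: (filterS2 (F := almost_everywhere mu2)) uv1 uv2 => z -> ->.
- move=> s t st; have i1 := loc_int_oc s t (L2_loc_int l1); have i2 := loc_int_oc s t (L2_loc_int l2).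
  have mI : measurable (`]s, t]%classic : set RR) by exact: measurable_itv.
  rewrite RintegralD//; last first.
    have := integrableZl mI a i1.
    by move=> i; apply: eq_integrable i.
  by rewrite RintegralZl// -p1// -p2//; ring.
- exact: L2_lin.
- apply: (@le_lt_trans _ _ (\int[mu]_t (2 * a ^+ 2 * (v1 t ^+ 2 * expR (- 2 * t)) +
      2 * (v2 t ^+ 2 * expR (- 2 * t)))%:E)%E).
    apply: int_le.
    + apply: measurable_funM => //; apply: measurable_funX; apply: measurable_funD => //.
      exact: measurable_funM.
    + by apply: measurable_funD; apply: measurable_funM => //; apply: measurable_funM => //; exact: measurable_funX.
    + by move=> t; rewrite mulr_ge0 ?sqr_ge0 ?expR_ge0.
    + move=> t; have := expR_ge0 (- 2 * t); move: (expR _) => X X0.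
      have := mulr_ge0 (sqr_ge0 (a * v1 t - v2 t)) X0; nra.
  have n1 t : 0 <= v1 t ^+ 2 * expR (- 2 * t) by rewrite mulr_ge0 ?sqr_ge0 ?expR_ge0.
  have n2 t : 0 <= v2 t ^+ 2 * expR (- 2 * t) by rewrite mulr_ge0 ?sqr_ge0 ?expR_ge0.
  have a2 : 0 <= 2 * a ^+ 2 by rewrite mulr_ge0// sqr_ge0.
  have q1 : measurable_fun [set: RR] (fun t => v1 t ^+ 2 * expR (- 2 * t)).
    by apply: measurable_funM => //; exact: measurable_funX.
  have q2 : measurable_fun [set: RR] (fun t => v2 t ^+ 2 * expR (- 2 * t)).
    by apply: measurable_funM => //; exact: measurable_funX.
  rewrite intD//; [|exact: measurable_funM|exact: measurable_funM
    |by move=> t; rewrite mulr_ge0|by move=> t; rewrite mulr_ge0].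
  by rewrite !intZ// lte_add_pinfty// lte_mul_pinfty.
Qed.

Lemma rad0 : rad (fun=> 0 : R) (fun=> 0) (fun=> 0).
Proof.
split => //.
- exact: aeW.
- by move=> a b ab; rewrite /Rintegral integral0 subrr.
- exact: L2_0.
- by under eq_integral do rewrite expr0n mul0r; rewrite integral0 ltry.
Qed.

Lemma rad_scale (a : R) (u : R * R -> R) (v g : R -> R) : rad u v g ->
  rad (fun z => a * u z + 0) (fun t => a * v t + 0) (fun t => a * g t + 0).
Proof. by move=> r; exact: rad_lin r rad0. Qed.

Lemma bounded_weighted (v : R -> R) (B : R) : measurable_fun [set: RR] v ->
  (forall s, s <= 0 -> v s = 0) -> (forall s, 0 <= s -> v s ^+ 2 <= B * expR (s / 2)) ->
  (\int[mu]_t (v t ^+ 2 * expR (- 2 * t))%:E < +oo)%E.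
Proof.
move=> mv v0 vB; have B0 : 0 <= B.
  by have := vB 0 (lexx _); rewrite mul0r expR0 mulr1; apply: le_trans; exact: sqr_ge0.
have := integrableZl measurableT B (integrable_tail 0).
move=> /integrableP[_]; apply: le_lt_trans.
have mI : measurable (`[(0 : R), +oo[%classic : set RR) by exact: measurable_itv.
apply: (@le_trans _ _ (\int[mu]_t (B * (expR (- (3 / 2) * t) * \1_(`[(0 : R), +oo[%classic) t))%:E)%E).
  apply: int_le.
  - by apply: measurable_funM; [exact: measurable_funX|exact: measurable_expR2].
  - apply: measurable_funM => //; apply: measurable_funM; [exact: measurable_expR2|exact: measurable_indic].
  - by move=> t; rewrite mulr_ge0 ?sqr_ge0 ?expR_ge0.
  - move=> t; have [t0|t0] := leP t 0.
      by rewrite v0// expr0n mul0r !mulr_ge0 ?expR_ge0// indicE.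
    rewrite indicE mem_set/= ?in_itv/= ?(ltW t0)// mulr1.
    apply: le_trans (_ : B * expR (t / 2) * expR (- 2 * t) <= _).
      by rewrite ler_wpM2r ?expR_ge0// vB// ltW.
    rewrite -mulrA -expRD ler_wpM2l// ler_expR; lra.
rewrite le_eqVlt; apply/orP; left; apply/eqP; apply: eq_integral => t _.
by rewrite /= ger0_norm// !mulr_ge0 ?expR_ge0// indicE.
Qed.

Lemma antideriv_half (g : R -> R) : L2half g -> forall s, s <= 0 -> antideriv g s = 0.
Proof.
move=> [g2 g0] s s0.
have K : \int[mu]_(t in `]s, 0]) g t = 0.
  have io := loc_int_oo s 0 (L2_loc_int g2).
  rewrite -(Rintegral_itv_bndo_bndc io) Rint_indic.
  transitivity (\int[mu]_x (0 : R)); last by rewrite /Rintegral integral0.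
  apply: eq_Rintegral => x _; rewrite indicE.
  case: (boolP (x \in `]s, 0[%classic)) => [|_]; last by rewrite mulr0.
  rewrite inE/= in_itv/= => /andP[_ x0]; rewrite g0 ?mul0r//.
  by rewrite /halfline/= => /(lt_le_trans x0); rewrite ltxx.
rewrite /antideriv; case: ifPn => [s0'|_]; last by rewrite K oppr0.
have -> : s = 0 by apply/eqP; rewrite eq_le s0 s0'.
by rewrite set_itv_ge ?bnd_simp ?ltxx// Rintegral_set0.
Qed.

Lemma antideriv_half_le (g : R -> R) : L2half g -> forall s, 0 <= s ->
  antideriv g s ^+ 2 <= s * ip mu g g.
Proof.
move=> gh s s0; have [g2 _] := gh; have vg := primitive_antideriv (L2_loc_int g2).
have := primitive_holderT 0 s g2 vg.
by rewrite (antideriv_half gh (lexx _)) !subr0 ger0_norm.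
Qed.

Lemma rad_half (g : R -> R) : L2half g ->
  rad (fun z => antideriv g (lrad z)) (antideriv g) g.
Proof.
move=> gh; have [g2 _] := gh; have vg := primitive_antideriv (L2_loc_int g2).
have mv : measurable_fun [set: RR] (antideriv g).
  by apply: continuous_measurable_fun; exact: primitive_continuous g2 vg.
split => //; [exact: radial_measurable|exact: aeW|].
apply: (bounded_weighted (B := 2 * ip mu g g)) => //; first exact: antideriv_half.
move=> s s0; apply: le_trans (antideriv_half_le gh s0) _.
rewrite mulrC [2 * _]mulrC -mulrA ler_wpM2l ?ip_ge0//.
have := expR_ge1Dx (s / 2); lra.
Qed.

(** A fixed nonzero radial function, scaled into the unit ball of [H1], bounds the supremum below by
    its squared norm in [L^2], because [expR x - 1 >= x] and [4 * pi >= 1]. *)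
Lemma kappa_gt0 : exists2 k : R, 0 < k & (k%:E <= @kappa R)%E.
Proof.
pose g : R -> R := \1_(`]0, 1]%classic).
have gh : L2half g.
  split; first exact: indic_oc_L2.
  move=> x; rewrite /halfline/= => /negP x0; rewrite /g indicE memNset//= in_itv/= => /andP[h _].
  by move: x0; rewrite ltW.
have ru := rad_half gh; set v := antideriv g in ru; set u := (fun z => _) in ru.
have [u2 Eu] := rad_L2 ru; have [Hu _] := rad_H1 ru; case: (ru) => mu_ _ vg g2 v2.
have mv : measurable_fun [set: RR] v.
  by apply: continuous_measurable_fun; exact: primitive_continuous g2 vg.
pose J := ip mu2 u u.
have JE : (\int[mu2]_z (u z ^+ 2)%:E = J%:E)%E by rewrite L2_integral_sqr.
have J0 : 0 < J.
  have v1 s : 1 <= s -> v s = 1.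
    move=> s1; rewrite /v /antideriv ifT; last by lra.
    rewrite /g Rint_indic -[RHS](subr0 1) -(ip_indic_oc (a := 0) (b := 1))//.
    apply: eq_Rintegral => x _; rewrite !indicE.
    case: (boolP (x \in (`]0, 1]%classic : set R))) => [|_]; last by rewrite !mul0r.
    rewrite inE/= in_itv/= => /andP[x0 x1]; rewrite mem_set//= in_itv/= x0.
    exact: le_trans x1 s1.
  rewrite -lte_fin -JE Eu.
  have mI : measurable (`]1, 2]%classic : set RR) by exact: measurable_itv.
  apply: mule_gt0; first by rewrite lte_fin mulr_gt0// pi_gt0.
  apply: (@lt_le_trans _ _ (\int[mu]_t (expR (- 4) * \1_(`]1, 2]%classic) t)%:E)%E).
    rewrite intZ ?expR_ge0// ?integral_indic// ?setIT ?leb1E ?lebesgue_measure_itv/=.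
    rewrite lte_fin ifT; last by lra.
    by rewrite -EFinB -EFinM lte_fin mulr_gt0 ?expR_gt0//; lra.
  apply: int_le.
  - by apply: measurable_funM => //; exact: measurable_indic.
  - by apply: measurable_funM; [exact: measurable_funX|exact: measurable_expR2].
  - by move=> t; rewrite mulr_ge0 ?expR_ge0// indicE.
  - move=> t; rewrite indicE; case: (boolP (t \in _)) => [|_]; last first.
      by rewrite mulr0 mulr_ge0 ?sqr_ge0 ?expR_ge0.
    rewrite inE/= in_itv/= => /andP[t1 t2]; rewrite v1 ?(ltW t1)// expr1n mul1r mulr1 ler_expR; lra.
pose K := J + 2 * pi * ip mu g g.
have K0 : 0 <= K by rewrite addr_ge0 ?(ltW J0)// mulr_ge0 ?ip_ge0// mulr_ge0// pi_ge0.
(* [K] is the square of the [H1] norm of [u], and [c ^ 2 * K <= 1]. *)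
pose c := (1 + K)^-1; have c0 : 0 < c by rewrite invr_gt0; lra.
have rc := rad_scale c ru; have [uc2 _] := rad_L2 rc; have [Hc gc] := rad_H1 rc.
set uc := (fun z => c * u z + 0) in rc uc2 Hc gc.
have ipc : ip mu2 uc uc = c ^+ 2 * J.
  have E : (\int[mu2]_z (uc z ^+ 2)%:E = (c ^+ 2 * J)%:E)%E.
    rewrite EFinM -JE -intZ ?sqr_ge0//; [|exact: measurable_funX|by move=> z; exact: sqr_ge0].
    by apply: eq_integral => z _; congr EFin; rewrite /uc addr0 exprMn.
  by move: E; rewrite L2_integral_sqr// => -[].
have ipgc : ip mu (fun t => c * g t + 0) (fun t => c * g t + 0) = c ^+ 2 * ip mu g g.
  have g0 := L2_0 mu; have gc2 := L2_lin c g2 g0.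
  rewrite ipl// [ip mu _ (fun t => c * g t + 0)]ipC ipl//.
  rewrite [X in _ + X](_ : ip mu (fun=> 0) _ = 0); last first.
    by rewrite /ip; under eq_Rintegral do rewrite mul0r; rewrite /Rintegral integral0.
  rewrite (_ : ip mu (fun=> 0) g = 0); last first.
    by rewrite /ip; under eq_Rintegral do rewrite mul0r; rewrite /Rintegral integral0.
  by rewrite !addr0 mulrA expr2.
exists (c ^+ 2 * J); first by rewrite mulr_gt0// exprn_gt0.
apply: (@le_trans _ _ (\int[mu2]_z (expR (4 * pi * `|uc z| ^+ 2) - 1)%:E)%E); last first.
  apply: ereal_sup_ubound; exists uc => //; split => //.
  rewrite /H1norm L2norm_sqr// gc ipgc ipc -[leRHS]sqrtr1 ler_wsqrtr//.
  have -> : c ^+ 2 * J + 2 * pi * (c ^+ 2 * ip mu g g) = c ^+ 2 * K by rewrite /K; ring.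
  rewrite /c exprVn mulrC ler_pdivrMr ?exprn_gt0 ?mul1r//; [|lra].
  by have := sqr_ge0 K; nra.
rewrite -ipc -L2_integral_sqr//.
have muc := Lfun2_measurable uc2.
apply: int_le.
- exact: measurable_funX.
- apply: measurable_funB => //; apply: (measurableT_comp (@measurable_expR R)).
  by apply: measurable_funM => //; apply: measurable_funX; exact: measurableT_comp.
- by move=> z; exact: sqr_ge0.
- move=> z; rewrite real_normK ?num_real//.
  have := expR_ge1Dx (4 * pi * uc z ^+ 2); have := sqr_ge0 (uc z); have := @pi_ge2 R; nra.
Qed.

(** The line is cut at some [T <= 0] fixed before [n] tends to infinity: left of [T] the integral is
    small uniformly in [n], right of [T] it tends to 0. Each side receives half of a positive lower
    bound [k] of [kappa]. *)
Lemma orlicz_criterion (p : nat) (v g w gw : nat -> R -> R) (r : nat -> R * R -> R) (N eps : R) :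
  (1 < p)%N -> 0 < eps -> (forall n, g n \in Lfun mu 2%:E) -> (forall n, primitive (v n) (g n)) ->
  (forall n, ip mu (g n) (g n) <= N) ->
  (forall n, (\int[mu]_t (v n t ^+ 2 * expR (- 2 * t))%:E <= N%:E)%E) ->
  (forall n, rad (r n) (w n) (gw n)) -> (forall n s, s <= 0 -> w n s = v n s) ->
  (forall s, w n s @[n --> \oo] --> (0 : R)) ->
  (forall S, exists B, forall n s, 0 <= s <= S -> `|w n s| <= B) ->
  (exists M S, forall n s, (M <= n)%N -> S <= s -> `|w n s - w n 0| <= eps * Num.sqrt s) ->
  \forall n \near \oo, (orlicz_norm p (r n) <= (2 * eps)%:E)%E.
Proof.
move=> p1 e0 g2 vg gN vN rw wv w0 wB [M [S0 wS]].
have N0 : 0 <= N by exact: le_trans (ip_ge0 _ _) (gN 0%N).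
have [k k0 kk] := kappa_gt0.
pose lam := 2 * eps; have l0 : 0 < lam by rewrite mulr_gt0.
have mw n : measurable_fun [set: RR] (w n).
  have [_ _ ww gw2 _] := rw n.
  by apply: continuous_measurable_fun; exact: primitive_continuous gw2 ww.
pose F n s := phi_ p (`|w n s| / lam) * (2 * pi * expR (- 2 * s)).
have mF n : measurable_fun [set: RR] (F n).
  apply: measurable_funM; last by apply: measurable_funM => //; exact: measurable_expR2.
  apply: (measurableT_comp (@measurable_phi p)); apply: measurable_funM => //.
  exact: measurableT_comp.
have F0 n s : 0 <= F n s by rewrite /F !mulr_ge0 ?phi_ge0 ?expR_ge0 ?pi_ge0.
have FE n : (\int[mu2]_z (phi_ p (`|r n z| / lam))%:E = \int[mu]_s (F n s)%:E)%E.
  have [mr rwn _ _ _] := rw n.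
  pose G t := phi_ p (`|w n t| / lam).
  have mG : measurable_fun [set: RR] G.
    apply: (measurableT_comp (@measurable_phi p)); apply: measurable_funM => //.
    exact: measurableT_comp.
  rewrite -(radial_integral mG); last by move=> t; exact: phi_ge0.
  apply: int_ae.
  - apply: (measurableT_comp (@measurable_phi p)); apply: measurable_funM => //.
    exact: measurableT_comp.
  - exact: radial_measurable.
  - by move=> z; exact: phi_ge0.
  - by move=> z; exact: phi_ge0.
  - by apply: (filterS (F := almost_everywhere mu2)) rwn => z ->.
suff [T T0 HT] : exists2 T : R, T <= 0 & forall n, (\int[mu]_s (F n s * \1_(`]-oo, T[%classic) s)%:E <= (k / 2)%:E)%E.
  have mI : measurable (`[T, +oo[%classic : set RR) by exact: measurable_itv.
  have mJ : measurable (`]-oo, T[%classic : set RR) by exact: measurable_itv.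
  have : \forall n \near \oo, (\int[mu]_s (F n s * \1_(`[T, +oo[%classic) s)%:E <= (k / 2)%:E)%E.
    pose S1 := Num.max S0 0; have [B wB1] := wB S1.
    have B0 : 0 <= B.
      by apply: le_trans (wB1 0%N 0 _); rewrite ?lexx ?le_max ?lexx ?orbT.
    (* [E] collects the bounds on [(w / lam) ^ 2]: [4 * N] covers [s <= 0], [B ^ 2] covers
       [0 <= s <= S1], and beyond [S1] the inequality [w ^ 2 <= 2 * w(0) ^ 2 + 2 * eps ^ 2 * s],
       divided by [lam ^ 2 = 4 * eps ^ 2], gives [2 * N / eps ^ 2 + s / 2]. *)
    pose E := (4 * N + B ^+ 2) / lam ^+ 2 + 2 * N / eps ^+ 2.
    have w2 n s : s <= 0 -> w n s ^+ 2 <= 4 * N.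
      move=> s0; rewrite wv//; apply: le_trans (strauss (g2 n) (vg n) (gN n) (vN n) s0) _.
      by rewrite ler_piMr ?mulr_ge0// -[leRHS]expR0 ler_expR.
    have E1 : 0 <= 2 * N / eps ^+ 2 by apply: divr_ge0; [rewrite mulr_ge0|exact: sqr_ge0].
    have E2 : 0 <= (4 * N + B ^+ 2) / lam ^+ 2.
      by apply: divr_ge0; [rewrite addr_ge0 ?mulr_ge0 ?sqr_ge0|exact: sqr_ge0].
    have bound n s : (M <= n)%N -> T <= s -> (`|w n s| / lam) ^+ 2 <= E + (s - T) / 2.
      move=> Mn Ts; have sT : 0 <= (s - T) / 2 by lra.
      rewrite expr_div_n real_normK ?num_real//.
      have [S1s|sS1] := leP S1 s; last first.
        apply: (@le_trans _ _ ((4 * N + B ^+ 2) / lam ^+ 2)); last by rewrite /E; lra.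
        rewrite ler_pM2r ?invr_gt0 ?exprn_gt0//.
        have [s0|s0] := leP s 0; first by rewrite (le_trans (w2 n s s0))// lerDl sqr_ge0.
        apply: (@le_trans _ _ (B ^+ 2)); last by rewrite lerDr mulr_ge0.
        rewrite -[w n s ^+ 2]real_normK ?num_real// ler_pXn2r ?nnegrE//.
        by apply: wB1; rewrite !ltW.
      have [S0s s0] : S0 <= s /\ 0 <= s by move: S1s; rewrite /S1 ge_max => /andP[].
      have h1 := wS n s Mn S0s; have h2 := w2 n 0 (lexx _).
      have h3 : (w n s - w n 0) ^+ 2 <= eps ^+ 2 * s.
        rewrite -[X in eps ^+ 2 * X](sqr_sqrtr s0) -exprMn -[leLHS]real_normK ?num_real//.
        by rewrite ler_pXn2r ?nnegrE ?normr_ge0 ?mulr_ge0 ?sqrtr_ge0 ?(ltW e0).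
      have h4 : w n s ^+ 2 <= 8 * N + 2 * (eps ^+ 2 * s).
        have := sqr_ge0 (w n s - 2 * w n 0); nra.
      apply: (@le_trans _ _ (2 * N / eps ^+ 2 + s / 2)); last by rewrite /E; lra.
      rewrite ler_pdivrMr ?exprn_gt0// /lam.
      have -> : (2 * N / eps ^+ 2 + s / 2) * (2 * eps) ^+ 2 = 8 * N + 2 * (eps ^+ 2 * s).
        by field; rewrite gt_eqF.
      exact: h4.
    (* The growth [s / 2] of the exponent against the weight [expR (- 2 * s)] leaves the rate
       [3 / 2]. *)
    pose dom (s : R) := (2 * pi * expR (E - T / 2)) * (expR (- (3 / 2) * s) * \1_(`[T, +oo[%classic) s).
    (* The index is shifted by [M] because the bound holds for [n >= M] only. *)
    pose fn (n : nat) (s : RR) : \bar R := (F (n + M)%N s * \1_(`[T, +oo[%classic) s)%:E.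
    have mfn n : measurable_fun [set: RR] (fn n).
      by apply/measurable_EFinP; apply: measurable_funM => //; exact: measurable_indic.
    have idom : mu.-integrable setT (EFin \o dom).
      have i := integrableZl measurableT (2 * pi * expR (E - T / 2)) (integrable_tail T).
      exact: eq_integrable i.
    have fdom n (s : RR) : (`|fn n s| <= (dom s)%:E)%E.
      rewrite /fn /dom lee_fin ger0_norm; last by rewrite mulr_ge0// indicE.
      rewrite mulrA indicE; case: (boolP (s \in _)) => [|_]; last by rewrite !mulr0.
      rewrite inE/= in_itv/= andbT !mulr1 => Ts; rewrite /F.
      apply: (@le_trans _ _ (expR (E + (s - T) / 2) * (2 * pi * expR (- 2 * s)))).
        rewrite ler_wpM2r ?mulr_ge0 ?pi_ge0 ?expR_ge0//.
        apply: le_trans (phi_le_exp _ _) _; rewrite ler_expR.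
        by apply: bound => //; rewrite leq_addl.
      rewrite mulrCA -[leRHS]mulrA -!expRD ler_wpM2l ?mulr_ge0 ?pi_ge0// ler_expR; lra.
    have fn0 (s : RR) : fn n s @[n --> \oo] --> 0%E.
      apply: cvg_EFin; first exact: nearW.
      rewrite -[X in _ --> X](mul0r (\1_(`[T, +oo[%classic) s : R)); apply: cvgM; last exact: cvg_cst.
      rewrite -[X in _ --> X](mul0r (2 * pi * expR (- 2 * s))); apply: cvgM; last exact: cvg_cst.
      have wM : w (n + M)%N s @[n --> \oo] --> (0 : R).
        by apply: (cvg_comp (fun n => (n + M)%N) (fun n => w n s) _ (w0 s)); exact: cvg_addnr.
      have yM : `|w (n + M)%N s| / lam @[n --> \oo] --> (0 : R).
        rewrite -[X in _ --> X](mul0r lam^-1) -(normr0 R); apply: cvgM; last exact: cvg_cst.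
        exact: cvg_norm.
      have cX j : (`|w (n + M)%N s| / lam) ^+ j @[n --> \oo] --> (0 ^+ j : R).
        apply: (@cvg_comp _ _ _ (fun n : nat => `|w (n + M)%N s| / lam : R) (fun x => x ^+ j) _ (nbhs (0 : R))) => //.
        exact: exprn_continuous.
      have upper : (`|w (n + M)%N s| / lam) ^+ 4 * expR ((`|w (n + M)%N s| / lam) ^+ 2)
          @[n --> \oo] --> (0 : R).
        rewrite -[X in _ --> X](mul0r (expR (0 ^+ 2))) -[X in X * _](expr0n _ 4); apply: cvgM.
          exact: cX.
        apply: (@cvg_comp _ _ _ (fun n : nat => (`|w (n + M)%N s| / lam) ^+ 2 : R) (@expR R) _ (nbhs (0 ^+ 2 : R))).
          exact: cX.
        exact: continuous_expR.
      apply: squeeze_cvgr upper; last exact: cvg_cst.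
      by apply: nearW => n; rewrite phi_ge0 phi_le4.
    have [_ _] := @dominated_convergence _ RR R mu setT measurableT fn (cst 0%E) (EFin \o dom)
      mfn (measurable_cst _) (aeW _ (fun s _ => fn0 s)) idom (aeW _ (fun s n _ => fdom n s)).
    rewrite integral0 => lim.
    have k2 : 0 < k / 2 by lra.
    have : \forall n \near \oo, (\int[mu]_s fn n s <= (k / 2)%:E)%E.
      move/fine_cvgP : lim => [fin /cvgrPdist_le /(_ _ k2) H].
      apply: filterS2 fin H => n /= fin_n; rewrite sub0r normrN => H.
      by rewrite -(fineK fin_n) lee_fin (le_trans (ler_norm _)).
    move=> [N1 _ HN1]; exists (N1 + M)%N => // n /= Nn.
    have Mn : (M <= n)%N by apply: leq_trans Nn; rewrite leq_addl.
    have := HN1 (n - M)%N; rewrite /= leq_subRL// addnC => /(_ Nn).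
    by rewrite /fn subnK.
  apply: filterS => n Hn; apply: ereal_inf_lbound; exists lam => //; split => //.
  apply: le_trans kk; rewrite FE.
  apply: (@le_trans _ _ (\int[mu]_s (F n s * \1_(`]-oo, T[%classic) s + F n s * \1_(`[T, +oo[%classic) s)%:E)%E).
    apply: int_le => //.
    - by apply: measurable_funD; apply: measurable_funM => //; exact: measurable_indic.
    - move=> s; rewrite -mulrDr ler_peMr// !indicE.
      have [sT|sT] := ltP s T; first by rewrite mem_set/= ?in_itv//= lerDl.
      by rewrite addrC mem_set/= ?in_itv/= ?sT// lerDl.
  rewrite intD//.
  - by rewrite [k]splitr EFinD; exact: leeD.
  - by apply: measurable_funM => //; exact: measurable_indic.
  - by apply: measurable_funM => //; exact: measurable_indic.
  - by move=> s; rewrite mulr_ge0// indicE.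
  - by move=> s; rewrite mulr_ge0// indicE.
(* In [y ^ 4 * expR (y ^ 2)] the exponential and one factor [v ^ 2] are bounded by Strauss'
   estimate, the latter with the gain [expR (- x)]; the other factor [v ^ 2] is integrated against
   the weight. The choice of [x] gives [C0 * N * expR (- x) <= k / 2], because
   [x * expR (- x) <= 1]. *)
pose C0 := 4 * N / lam ^+ 4 * expR (4 * N / lam ^+ 2) * (2 * pi).
have C00 : 0 <= C0.
  rewrite /C0; apply: mulr_ge0; last by rewrite mulr_ge0// pi_ge0.
  apply: mulr_ge0; last exact: expR_ge0.
  by apply: divr_ge0; [rewrite mulr_ge0|rewrite exprn_ge0// ltW].
pose x := 2 * C0 * N / k; have x0 : 0 <= x by exact: divr_ge0 (mulr_ge0 (mulr_ge0 (ler0n R 2) C00) N0) (ltW k0).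
exists (- x); first by lra.
move=> n; have me := @measurable_expR2 R (- 2).
have mv : measurable_fun [set: RR] (v n).
  by apply: continuous_measurable_fun; exact: primitive_continuous (g2 n) (vg n).
have mJ : measurable (`]-oo, (- x)[%classic : set RR) by exact: measurable_itv.
apply: (@le_trans _ _ (\int[mu]_t (C0 * expR (- x) * (v n t ^+ 2 * expR (- 2 * t)))%:E)%E).
  apply: int_le.
  - by apply: measurable_funM => //; exact: measurable_indic.
  - by apply: measurable_funM => //; apply: measurable_funM => //; exact: measurable_funX.
  - by move=> s; rewrite mulr_ge0// indicE.
  - move=> s; rewrite indicE; case: (boolP (s \in _)) => [|_]; last first.
      rewrite mulr0; apply: mulr_ge0; first exact: mulr_ge0 C00 (expR_ge0 _).
      by rewrite mulr_ge0 ?sqr_ge0 ?expR_ge0.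
    rewrite inE/= in_itv/= mulr1 => sx; have s0 : s <= 0 by lra.
    rewrite /F wv//.
    have st := strauss (g2 n) (vg n) (gN n) (vN n) s0.
    have st1 : v n s ^+ 2 <= 4 * N * expR (- x).
      by apply: le_trans st _; rewrite ler_wpM2l ?mulr_ge0// ler_expR ltW.
    have st2 : v n s ^+ 2 <= 4 * N.
      by apply: le_trans st _; rewrite ler_piMr ?mulr_ge0// -[leRHS]expR0 ler_expR.
    have b : phi_ p (`|v n s| / lam) <= 4 * N / lam ^+ 4 * expR (4 * N / lam ^+ 2) * expR (- x) * v n s ^+ 2.
      apply: le_trans (phi_le4 _ p1) _.
      rewrite expr_div_n [(_ / _) ^+ 2]expr_div_n real_normK ?num_real//.
      have -> : `|v n s| ^+ 4 = v n s ^+ 2 * v n s ^+ 2.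
        by rewrite -(real_normK (num_real (v n s))) -exprD.
      have e1 : expR (v n s ^+ 2 / lam ^+ 2) <= expR (4 * N / lam ^+ 2).
        by rewrite ler_expR ler_pM2r ?invr_gt0 ?exprn_gt0.
      apply: (@le_trans _ _ (4 * N * expR (- x) * v n s ^+ 2 / lam ^+ 4 * expR (4 * N / lam ^+ 2))).
        apply: ler_pM => //.
        - by apply: divr_ge0; [rewrite mulr_ge0 ?sqr_ge0|apply: exprn_ge0; exact: ltW].
        - rewrite ler_pM2r ?invr_gt0 ?exprn_gt0//.
          by rewrite ler_wpM2r ?sqr_ge0.
      rewrite le_eqVlt; apply/orP; left; apply/eqP; ring.
    apply: le_trans (ler_wpM2r _ b) _; first by rewrite !mulr_ge0 ?pi_ge0 ?expR_ge0.
    by rewrite /C0 le_eqVlt; apply/orP; left; apply/eqP; ring.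
rewrite intZ//; first last.
- by move=> t; rewrite mulr_ge0 ?sqr_ge0 ?expR_ge0.
- by apply: measurable_funM => //; exact: measurable_funX.
- by rewrite mulr_ge0 ?expR_ge0.
apply: (@le_trans _ _ ((C0 * expR (- x) * N)%:E)).
  by rewrite [leRHS]EFinM lee_wpmul2l// lee_fin mulr_ge0 ?expR_ge0.
rewrite lee_fin.
have e : expR (- x) * (1 + x) <= 1.
  by rewrite -[leRHS](expR0) -(addNr x) expRD ler_wpM2l ?expR_ge0// expR_ge1Dx.
have E0 := expR_gt0 (- x).
have kx : k * x = 2 * C0 * N by rewrite /x; field; rewrite gt_eqF.
have ex : expR (- x) * x <= 1 by lra.
have : k * (expR (- x) * x) <= k by rewrite -[leRHS]mulr1; apply: ler_wpM2l ex; exact: ltW.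
by rewrite mulrCA kx; lra.
Qed.

End Strauss.

(** * Concentrations as dilations of derivatives *)

Section Assembly.
Context {R : realType}.
Local Notation RR := (measurableTypeR R).
Notation mu := (@leb1 R).
Notation mu2 := (@leb2 R).

Lemma primitive_ip (v g : R -> R) (a b : R) : primitive v g -> a <= b ->
  v b - v a = ip mu g (\1_(`]a, b]%classic) : R -> R).
Proof. by move=> vg ab; rewrite vg// Rint_indic. Qed.

Lemma antideriv_ip (g : R -> R) (s : R) : L2half g -> 0 <= s ->
  antideriv g s = ip mu g (\1_(`]0, s]%classic) : R -> R).
Proof. by move=> gh s0; rewrite /antideriv s0 Rint_indic. Qed.

Lemma dil_half (a : R) (G : R -> R) : 0 < a -> L2half G -> L2half (dil a G).
Proof. by move=> a0; exact: (dlP L2half_dilation). Qed.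

Lemma dil_indic (a b : R) : 0 < a ->
  dil a (\1_(`]0, b]%classic) : R -> R) = fun t => Num.sqrt a * \1_(`]0, b / a]%classic) t.
Proof.
move=> a0; apply/funext => t; rewrite /dil; congr (_ * _); rewrite !indicE; congr (nat_of_bool _)%:R.
apply/idP/idP; rewrite !inE/= !in_itv/= pmulr_rgt0// => /andP[-> h] /=.
  by rewrite ler_pdivlMr// mulrC.
by rewrite mulrC -ler_pdivlMr.
Qed.

Lemma ip_dil_indic (a b : R) (G : R -> R) : 0 < a -> G \in Lfun mu 2%:E ->
  ip mu G (\1_(`]0, b]%classic) : R -> R) =
  Num.sqrt a * ip mu (dil a G) (\1_(`]0, b / a]%classic) : R -> R).
Proof.
move=> a0 G2; rewrite -(ip_dil a0 G2 (indic_oc_L2 _ _)) dil_indic// [LHS]ipC [X in _ = _ * X]ipC.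
have := ipl (Num.sqrt a) (indic_oc_L2 0 (b / a)) (L2_0 mu) (dil_L2 a0 G2).
rewrite [X in _ + X](_ : _ = 0) ?addr0; last first.
  by rewrite /ip /Rintegral; under eq_integral do rewrite mul0r; rewrite integral0.
by move=> <-; congr (ip mu _ _); apply/funext => t; rewrite addr0.
Qed.

Lemma antideriv_dil (a : R) (G : R -> R) (s : R) : 0 < a -> L2half G ->
  antideriv (dil a^-1 G) s = Num.sqrt a * antideriv G (s / a).
Proof.
move=> a0 Gh; have ia0 : 0 < a^-1 by rewrite invr_gt0.
have [s0|s0] := leP s 0.
  rewrite (antideriv_half (dil_half ia0 Gh))// (antideriv_half Gh) ?mulr0//.
  by rewrite ler_pdivrMr// mul0r.
have sa : 0 <= s / a by rewrite divr_ge0 ?ltW.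
rewrite !antideriv_ip ?(ltW s0)//; last exact: dil_half.
have [G2 _] := Gh.
rewrite [X in _ = _ * X](ip_dil_indic _ ia0 G2) mulrA -sqrtrM ?ltW// divff ?gt_eqF// sqrtr1 mul1r.
by rewrite invrK divfK// gt_eqF.
Qed.

(** For fixed [s > 0] the value is the pairing of the dilated [G] with the fixed indicator of []0,
    s]], which tends to 0 as the scale escapes to infinity. *)
Lemma antideriv_dil_cvg (a : nat -> R) (G : R -> R) (s : R) : L2half G ->
  (forall n, 0 < a n) -> a @ \oo --> +oo ->
  antideriv (dil (a n)^-1 G) s @[n --> \oo] --> (0 : R).
Proof.
move=> Gh a0 aoo; have [s0|s0] := leP s 0.
  rewrite (_ : (fun n => _) = (fun=> 0)); first exact: cvg_cst.
  by apply/funext => n; rewrite (antideriv_half (dil_half _ Gh))// invr_gt0.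
have [G2 G0] := Gh.
apply/cvgrPdist_le => eps eps0.
have [x|K HK] := dil_asymptotic G2 (indic_oc_L2 0 s) eps0 G0.
  rewrite /halfline/= => /negP; rewrite -ltNge => x0.
  by rewrite indicE memNset//= in_itv/= => /andP[/ltW]; rewrite leNgt x0.
move/cvgryPge : aoo => /(_ (expR `|K|)); apply: filterS => n Kn.
have ia0 : 0 < (a n)^-1 by rewrite invr_gt0.
rewrite sub0r normrN antideriv_ip ?(ltW s0)//; last exact: dil_half.
apply: HK => //; rewrite lnV ?posrE// normrN.
apply: le_trans (ler_norm K) _; apply: le_trans (ler_norm _).
by rewrite -ler_expR lnK ?posrE.
Qed.

(** The factor cancels the [1 / (2 * pi)] in [concentration], and it multiplies the energy of [G] by
    [2 * pi], the normalisation of the gradient in the plane. *)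
Definition profile_of (G : R -> R) (t : R) : R := Num.sqrt (2 * pi) * antideriv G t.

Lemma concentration_profile_of (a : R) (G : R -> R) (z : R * R) : 0 < a -> L2half G ->
  concentration a (profile_of G) z = antideriv (dil a^-1 G) (lrad z).
Proof.
move=> a0 Gh; rewrite antideriv_dil// /concentration /profile_of mulrA; congr (_ * _).
have p0 : 0 < 2 * pi :> R by rewrite mulr_gt0 ?pi_gt0.
by rewrite -sqrtrM ?divr_ge0 ?(ltW p0) ?(ltW a0)// divfK// gt_eqF.
Qed.

Lemma profile_ofP (G : R -> R) : L2half G -> profile (profile_of G) /\
  L2norm mu (weak_deriv (profile_of G)) ^+ 2 = 2 * pi * ip mu G G.
Proof.
move=> Gh; have [G2 _] := Gh; have p0 : 0 <= 2 * pi :> R by rewrite mulr_ge0 ?pi_ge0.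
have := rad_scale (Num.sqrt (2 * pi)) (rad_half Gh).
under [X in rad _ X _]eq_fun do rewrite addr0.
move=> [_ _ pp pg pw]; split; last first.
  rewrite (L2norm_weak_deriv pg pp).
  rewrite (ipl _ G2 (L2_0 mu) pg) ipC (ipl _ G2 (L2_0 mu) G2).
  have i0 (f : R -> R) : ip mu (fun=> 0) f = 0.
    by rewrite /ip /Rintegral; under eq_integral do rewrite mul0r; rewrite integral0.
  by rewrite !i0 !addr0 mulrA -expr2 sqr_sqrtr.
split => //.
- by apply: continuous_measurable_fun; exact: primitive_continuous pg pp.
- by exists (fun t => Num.sqrt (2 * pi) * G t + 0); split => //; exact: primitive_weak_deriv.
- by move=> s s0; rewrite /profile_of (antideriv_half Gh)// mulr0.
Qed.

Lemma rad_remainder (a : nat -> R) (G : nat -> R -> R) (u : R * R -> R) (v g : R -> R) l :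
  (forall j, 0 < a j) -> (forall j, L2half (G j)) -> rad u v g ->
  rad (fun z => u z - \sum_(j < l) concentration (a j) (profile_of (G j)) z)
      (fun t => v t - \sum_(j < l) antideriv (dil (a j)^-1 (G j)) t)
      (fun t => g t - \sum_(j < l) dil (a j)^-1 (G j) t).
Proof.
move=> a0 Gh r; elim: l => [|l IH].
  by under eq_fun do rewrite big_ord0 subr0; under [X in rad _ X _]eq_fun do rewrite big_ord0 subr0;
    under [X in rad _ _ X]eq_fun do rewrite big_ord0 subr0.
have ia0 : 0 < (a l)^-1 by rewrite invr_gt0.
have := rad_lin (- 1) (rad_half (dil_half ia0 (Gh l))) IH.
have E (A B C : R) : - 1 * C + (A - B) = A - (B + C) by ring.
congr rad; apply/funext => x; rewrite E big_ord_recr//=.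
by rewrite concentration_profile_of.
Qed.

(** The profiles act on [s >= 0] only: the negative half of [g] passes to the remainder unchanged,
    and cancels when energies are compared. *)
Lemma ip_halves (g h : R -> R) : g \in Lfun mu 2%:E -> L2half h ->
  ip mu (fun t => g t - h t) (fun t => g t - h t) =
  ip mu (g \_ (~` halfline)) (g \_ (~` halfline)) +
  ip mu (fun t => (g \_ halfline) t - h t) (fun t => (g \_ halfline) t - h t).
Proof.
move=> g2 [h2 h0].
have mC : measurable (~` halfline : set RR) by apply: measurableC; exact: measurable_halfline.
have n2 := L2_restrict mC g2; have p2 := L2_restrict (measurable_halfline (R := R)) g2.
have q2 : (fun t => (g \_ halfline) t - h t) \in Lfun mu 2%:E.
  rewrite (_ : (fun t => _) = (fun t : R => - 1 * h t + (g \_ halfline) t)); first exact: L2_lin.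
  by apply/funext => t; rewrite mulN1r addrC.
rewrite /ip -RintegralD//; [|exact: L2_integrable_prod|exact: L2_integrable_prod].
apply: eq_Rintegral => t _; rewrite !patchE.
have [t0|t0] := pselect (halfline t).
  have nt : ~ (~` halfline) t by move/(_ t0).
  rewrite (mem_set t0) (memNset nt).
  by change ((g t - h t) * (g t - h t) = 0 * 0 + (g t - h t) * (g t - h t)); rewrite mulr0 add0r.
rewrite (memNset t0) mem_set// h0//.
by change ((g t - 0) * (g t - 0) = g t * g t + (0 - 0) * (0 - 0)); ring.
Qed.

Lemma ip_dil_unit (b : R) (h : R -> R) : 0 < b -> h \in Lfun mu 2%:E ->
  ip mu h (\1_(`]0, b]%classic) : R -> R) = Num.sqrt b * ip mu (dil b h) unit_step.
Proof.
move=> b0 h2; have -> := ip_dil_indic b b0 h2; rewrite divff ?gt_eqF//; congr (_ * _).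
have i := loc_int_cc 0 1 (L2_loc_int (dil_L2 b0 h2)).
rewrite /ip /unit_step -!Rint_indic.
by rewrite -(Rintegral_itv_obnd_cbnd (loc_int_oc 0 1 (L2_loc_int (dil_L2 b0 h2)))).
Qed.

(** An annulus has finite area, so its indicator is square-integrable and the pairing is already
    bounded in the [L^2] norm. *)
Lemma annulus_functional (a b : R) :
  H1_functional (fun u => ip mu2 u (fun z => \1_(`]a, b]%classic : set R) (lrad z))).
Proof.
have w2 : (fun z : R * R => \1_(`]a, b]%classic : set R) (lrad z)) \in Lfun mu2 2%:E.
  have mA : measurable (lrad @^-1` `]a, b]%classic : set (RR * RR)).
    by rewrite -[X in measurable X]setTI; apply: measurable_lrad => //; exact: measurable_itv.
  apply: (indic_L2 mA).
  apply: le_lt_trans (disk_fin (expR (- a))).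
  apply: le_measure; rewrite ?inE//; first exact: measurable_disk.
  move=> z; rewrite /= in_itv/= => /andP[az _].
  have [->|z0] := eqVneq z (0, 0).
    by rewrite /disk/= (_ : enorm _ = 0) ?expR_gt0//; apply/eqP; rewrite enorm_eq0.
  by rewrite /disk/= ltNge -lrad_le// -ltNge.
split=> [c u v [u2 _] [v2 _]|]; first exact: ipl.
exists (Num.sqrt (ip mu2 (fun z => \1_(`]a, b]%classic : set R) (lrad z))
    (fun z => \1_(`]a, b]%classic : set R) (lrad z)))) => u [u2 _].
rewrite /H1norm -sqrtrM ?ip_ge0// -sqrtr_sqr ler_sqrt ?mulr_ge0 ?ip_ge0 ?addr_ge0 ?sqr_ge0//.
apply: le_trans (plane_CS u2 w2) _; rewrite mulrC ler_wpM2l ?ip_ge0//.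
by rewrite -(L2norm_sqr u2) lerDl sqr_ge0.
Qed.

Lemma annulus_ip (u : R * R -> R) (v g : R -> R) (a b : R) : rad u v g ->
  ip mu2 u (fun z => \1_(`]a, b]%classic : set R) (lrad z)) =
  \int[mu]_(t in `]a, b]) (v t * (2 * pi * expR (- 2 * t))).
Proof.
move=> [mu_ uv vg g2 v2]; have cv := primitive_continuous g2 vg.
have mv : measurable_fun [set: RR] v by exact: continuous_measurable_fun.
have cf : continuous (fun t : R => v t * (2 * pi * expR (- 2 * t))).
  move=> t; apply: cvgM; first exact: cv.
  apply: cvgM; first exact: cvg_cst.
  apply: (continuous_comp (f := fun t : R => - 2 * t) (g := @expR R)); last exact: continuous_expR.
  exact: mulrl_continuous.
have i := loc_int_oc a b (continuous_loc_int cf).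
have mI : measurable (`]a, b]%classic : set RR) by exact: measurable_itv.
have mG : measurable_fun [set: RR] (fun t => v t * (\1_(`]a, b]%classic : set R) t)).
  by apply: measurable_funM => //; exact: measurable_indic.
rewrite Rint_indic; transitivity (\int[mu2]_z (v (lrad z) * (\1_(`]a, b]%classic : set R) (lrad z)))).
  apply: ae_eq_Rint.
  - apply: measurable_funM => //; apply: (radial_measurable (g := \1_(`]a, b]%classic : set R))).
    exact: measurable_indic.
  - exact: (radial_measurable mG).
  by apply: (filterS (F := almost_everywhere mu2)) uv => z ->.
rewrite (Rradial_integral mG).
  by apply: eq_Rintegral => t _; rewrite mulrAC.
have := integrable_indic_prod mI i.
by apply: eq_integrable => // t _ /=; rewrite mulrAC.
Qed.

(* Testing against indicators of annuli gives the convergence of the means of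
   [v n] over short intervals, and [v n] oscillates little on them. *)
Lemma weak_pointwise (u : nat -> R * R -> R) (v g : nat -> R -> R) (N : R) :
  (forall n, rad (u n) (v n) (g n)) -> (forall n, ip mu (g n) (g n) <= N) ->
  H1_weakly_cvg u (cst 0) -> forall s, v n s @[n --> \oo] --> (0 : R).
Proof.
move=> r gN uw s; apply/cvgrPdist_le => eps e0.
have N0 : 0 <= N by exact: le_trans (ip_ge0 _ _) (gN 0%N).
(* By the Hoelder bound, [v n] oscillates by at most [eps / 2] on an interval of this length. *)
pose d := (eps / 2) ^+ 2 / (N + 1).
have d0 : 0 < d by rewrite divr_gt0 ?exprn_gt0 ?divr_gt0//; lra.
have dN : d * N <= (eps / 2) ^+ 2.
  rewrite /d mulrAC ler_pdivrMr; last lra.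
  by rewrite ler_wpM2l ?sqr_ge0//; lra.
pose h (t : R) := 2 * pi * expR (- 2 * t).
have h0 t : 0 <= h t by rewrite !mulr_ge0 ?pi_ge0 ?expR_ge0.
have ch : continuous h.
  move=> t; apply: cvgM; first exact: cvg_cst.
  apply: (continuous_comp (f := fun t : R => - 2 * t) (g := @expR R)); last exact: continuous_expR.
  exact: mulrl_continuous.
have ih := loc_int_oc s (s + d) (continuous_loc_int ch).
pose I := \int[mu]_(t in `]s, s + d]) h t.
have mI : measurable (`]s, s + d]%classic : set RR) by exact: measurable_itv.
have sd : s <= s + d by rewrite lerDl ltW.
have I0 : 0 < I.
  have dF (x : R) : is_derive (x : R) (1 : R) (fun t : R => - pi * expR (- 2 * t)) (h x).
    have := is_deriveZ (- pi) (is_derive_expM (- 2) x).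
    by rewrite /h /GRing.scale/=; congr is_derive; ring.
  rewrite /I (R_FTC dF ch sd) !mulNr opprK addrC -mulrBr mulr_gt0 ?pi_gt0// subr_gt0.
  by rewrite ltr_expR; lra.
have cvh n : continuous (fun t : R => v n t * h t).
  have [_ _ vg g2 _] := r n.
  by move=> t; apply: cvgM; [exact: primitive_continuous g2 vg t|exact: ch].
have ivh n := loc_int_oc s (s + d) (continuous_loc_int (cvh n)).
have key n : `|v n s * I| <= `|\int[mu]_(t in `]s, s + d]) (v n t * h t)| + eps / 2 * I.
  have [_ _ vg g2 _] := r n.
  have ivs : mu.-integrable `]s, s + d]%classic (EFin \o (fun t => v n s * h t)).
    by have := integrableZl mI (v n s) ih; move=> i; apply: eq_integrable i.
  have ies : mu.-integrable `]s, s + d]%classic (EFin \o (fun t => eps / 2 * h t)).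
    by have := integrableZl mI (eps / 2) ih; move=> i; apply: eq_integrable i.
  have osc t : `]s, s + d]%classic t -> `|v n s - v n t| <= eps / 2.
    rewrite /= in_itv/= => /andP[st td].
    rewrite -(@ler_pXn2r _ 2) ?nnegrE ?divr_ge0 ?(ltW e0)// real_normK ?num_real//.
    apply: le_trans (primitive_holderT t s g2 vg) _; apply: le_trans dN.
    by apply: ler_pM; rewrite ?ip_ge0// distrC ger0_norm; lra.
  have i1 := integrableB mI ivs (ivh n).
  have i2 := integrableD mI (ivh n) ies.
  have i3 := integrableB mI (ivh n) ies.
  have E1 : \int[mu]_(t in `]s, s + d]) (v n s * h t) = v n s * I by rewrite RintegralZl.
  have E2 : \int[mu]_(t in `]s, s + d]) (eps / 2 * h t) = eps / 2 * I by rewrite RintegralZl.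
  have up : v n s * I <= \int[mu]_(t in `]s, s + d]) (v n t * h t) + eps / 2 * I.
    rewrite -E1 -E2 -RintegralD//; apply: le_Rintegral => //.
    move=> t /osc; rewrite ler_norml => /andP[v1 v2]; rewrite -mulrDl ler_wpM2r//; lra.
  have lo : \int[mu]_(t in `]s, s + d]) (v n t * h t) - eps / 2 * I <= v n s * I.
    rewrite -E1 -E2 -RintegralB//; apply: le_Rintegral => //.
    move=> t /osc; rewrite ler_norml => /andP[v1 v2]; rewrite -mulrBl ler_wpM2r//; lra.
  move: up lo; move: (\int[mu]_(t in _) _) => X; move: (v n s * I) => Y up lo.
  rewrite ler_norml; have := ler_norm X; have := ler_norm (- X); rewrite normrN => ? ?.
  by apply/andP; split; lra.
have := uw _ (annulus_functional s (s + d)).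
rewrite [X in _ --> X](_ : _ = 0); last first.
  by rewrite /ip /Rintegral; under eq_integral do rewrite mul0r; rewrite integral0.
have eI : 0 < eps / 2 * I by rewrite mulr_gt0 ?divr_gt0.
move/cvgrPdist_le => /(_ _ eI); apply: filterS => n.
rewrite !sub0r !normrN (annulus_ip _ _ (r n)) => H.
have := le_trans (key n) (lerD H (lexx _)).
rewrite -mulrDl -splitr normrM (gtr0_norm I0) ler_pM2r//.
Qed.

Lemma strict_inverse (s : nat -> nat) : {homo s : m n / (m < n)%N} ->
  exists2 q : nat -> nat, cancel s q & q @ \oo --> \oo.
Proof.
move=> sm; have sn n : (n <= s n)%N.
  by elim: n => // n IH; apply: leq_ltn_trans IH (sm _ _ _).
have sle m n : (s m <= s n)%N -> (m <= n)%N.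
  by move=> h; rewrite leqNgt; apply/negP => /sm; rewrite ltnNge h.
have ex m : exists n, (m <= s n)%N by exists m.
exists (fun m => ex_minn (ex m)).
  move=> n; case: ex_minnP => m nm mmin; apply/eqP; rewrite eqn_leq mmin//=.
  exact: sle nm.
move=> A [K _ AK]; exists (s K) => // m /= Km; apply: AK => /=.
case: ex_minnP => k mk _; exact: sle (leq_trans Km mk).
Qed.

Lemma limn_esup_le (f : nat -> \bar R) (c : \bar R) :
  (\forall n \near \oo, f n <= c)%E -> (limn_esup f <= c)%E.
Proof.
move=> [N _ Nf]; rewrite limn_esup_lim.
apply: lime_le; first exact: is_cvg_esups.
exists N => // n /= Nn; apply: ub_ereal_sup => y [m /= nm <-].
exact: Nf (leq_trans Nn nm).
Qed.

Lemma limn_esup_nonneg (f : nat -> \bar R) : (forall n, 0 <= f n)%E -> (0 <= limn_esup f)%E.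
Proof.
move=> f0; rewrite limn_esup_lim; apply: lime_ge; first exact: is_cvg_esups.
apply: nearW => n; apply: le_trans (f0 n) _; apply: ereal_sup_ubound.
by exists n => /=.
Qed.

Lemma orlicz_norm_ge0 (p : nat) (f : R * R -> R) : (0 <= orlicz_norm p f)%E.
Proof. by apply: le_ereal_inf_tmp => _ [lam [l0 _] <-]; rewrite lee_fin ltW. Qed.

Lemma cvg_ereal_squeeze (f : nat -> \bar R) : (forall n, 0 <= f n)%E ->
  (forall eps : R, 0 < eps -> \forall n \near \oo, (f n <= eps%:E)%E) -> f @ \oo --> 0%:E.
Proof.
move=> f0 fe; apply/fine_cvgP; split.
  apply: filterS (fe 1 ltr01) => n f1; rewrite ge0_fin_numE//.
  exact: le_lt_trans f1 (ltry _).
apply/cvgrPdist_le => eps e0; apply: filterS (fe eps e0) => n fn /=.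
rewrite sub0r normrN ger0_norm ?fine_ge0// -lee_fin fineK//.
by rewrite ge0_fin_numE// (le_lt_trans fn (ltry _)).
Qed.

(** The factors [2 * pi >= 1] are dropped, so that one constant serves for both quantities. *)
Lemma H1norm_bounds (u : R * R -> R) (v g : R -> R) (M : R) : rad u v g -> H1norm u <= M ->
  ip mu g g <= M ^+ 2 /\ (\int[mu]_t (v t ^+ 2 * expR (- 2 * t))%:E <= (M ^+ 2)%:E)%E.
Proof.
move=> r uM; have [u2 uE] := rad_L2 r; have [_ gE] := rad_H1 r.
have pi2 : 1 <= 2 * pi :> R by have := pi_ge2 R; lra.
have h : ip mu2 u u + 2 * pi * ip mu g g <= M ^+ 2.
  rewrite -gE -(L2norm_sqr u2) -[leLHS]sqr_sqrtr ?addr_ge0 ?sqr_ge0//.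
  by rewrite ler_pXn2r ?nnegrE ?sqrtr_ge0// (le_trans _ uM)// sqrtr_ge0.
have g0 := ip_ge0 mu g; have u0 := ip_ge0 mu2 u.
split; first by nra.
apply: (@le_trans _ _ (ip mu2 u u)%:E); last by rewrite lee_fin; nra.
rewrite -L2_integral_sqr// uE lee_pemull ?lee_fin//.
by apply: integral_ge0 => t _; rewrite lee_fin mulr_ge0 ?sqr_ge0 ?expR_ge0.
Qed.

Lemma dil_sum_half (a : nat -> R) (G : nat -> R -> R) l : (forall j, 0 < a j) ->
  (forall j, L2half (G j)) -> L2half (fun t => \sum_(j < l) dil (a j)^-1 (G j) t).
Proof.
move=> a0 Gh; elim: l => [|l IH].
  by under eq_fun do rewrite big_ord0; exact: (ph0 L2half_preHilbert).
have ia0 : 0 < (a l)^-1 by rewrite invr_gt0.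
have := phL L2half_preHilbert 1 (dil_half ia0 (Gh l)) IH.
congr L2half; apply/funext => t; rewrite big_ord_recr/= [RHS]addrC.
by change (1 * dil (a l)^-1 (G l) t + \sum_(j < l) dil (a j)^-1 (G j) t =
  dil (a l)^-1 (G l) t + \sum_(j < l) dil (a j)^-1 (G j) t); rewrite mul1r.
Qed.

Lemma halfline_half (g : R -> R) : g \in Lfun mu 2%:E -> L2half (g \_ halfline).
Proof.
move=> g2; split; first exact: L2_restrict (@measurable_halfline R) g2.
by move=> t nt; rewrite patchE memNset.
Qed.

(** Links the extraction to [orlicz_criterion]: the quantity that the scales nearly maximise is the
    increment of [w] over [[0, b]] divided by [sqrt b]. *)
Lemma increment_unit (w g h : R -> R) (b : R) : 0 < b -> primitive w (fun t => g t - h t) ->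
  g \in Lfun mu 2%:E -> L2half h ->
  w b - w 0 = Num.sqrt b * ip mu (dil b (fun t => (g \_ halfline) t - h t)) unit_step.
Proof.
move=> b0 pw g2 [h2 h0]; rewrite (primitive_ip pw (ltW b0)) -ip_dil_unit//; last first.
  rewrite (_ : (fun t => _) = (fun t : R => - 1 * h t + (g \_ halfline) t)).
    by apply: L2_lin => //; exact: L2_restrict (@measurable_halfline R) g2.
  by apply/funext => t; rewrite mulN1r addrC.
apply: eq_Rintegral => t _; rewrite patchE !indicE.
case: (boolP (t \in _)) => [|_]; last by rewrite !mulr0.
by rewrite inE/= in_itv/= => /andP[t0 _]; rewrite mem_set//; exact: ltW.
Qed.

Lemma remainder_orlicz (p : nat) (u : nat -> R * R -> R) (v g : nat -> R -> R)
    (a : nat -> nat -> R) (G : nat -> R -> R) (l : nat) (N eps : R) :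
  (1 < p)%N -> 0 < eps -> (forall n, rad (u n) (v n) (g n)) ->
  (forall n, ip mu (g n) (g n) <= N) ->
  (forall n, (\int[mu]_t (v n t ^+ 2 * expR (- 2 * t))%:E <= N%:E)%E) ->
  (forall s, v n s @[n --> \oo] --> (0 : R)) ->
  (forall j n, 0 < a j n) -> (forall j, a j n @[n --> \oo] --> +oo) ->
  (forall j, L2half (G j)) ->
  (exists (S : R) M, forall n b, (M <= n)%N -> 0 < b -> S <= b ->
    `|ip mu (dil b (fun t => (g n \_ halfline) t - \sum_(j < l) dil (a j n)^-1 (G j) t)) unit_step| <= eps) ->
  \forall n \near \oo, (orlicz_norm p (fun z => (u n z -
    \sum_(j < l) concentration (a j n) (profile_of (G j)) z)%R) <= (2 * eps)%:E)%E.
Proof.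
move=> p1 e0 r gN vN v0 a0 aoo Gh [S [M cap]].
have ia0 j n : 0 < (a j n)^-1 by rewrite invr_gt0.
have g2 n : g n \in Lfun mu 2%:E by have [_ _ _ ? _] := r n.
have vg n : primitive (v n) (g n) by have [_ _ ? _ _] := r n.
have N0 : 0 <= N by exact: le_trans (ip_ge0 _ _) (gN 0%N).
pose w n t := v n t - \sum_(j < l) antideriv (dil (a j n)^-1 (G j)) t.
have rw n := rad_remainder l (fun j => a0 j n) Gh (r n).
have wv n s : s <= 0 -> w n s = v n s.
  move=> s0; rewrite /w big1 ?subr0// => j _.
  exact: (antideriv_half (dil_half (ia0 j n) (Gh j))).
apply: (orlicz_criterion p1 e0 g2 vg gN vN (w := w) rw wv).
- move=> s; rewrite -[X in _ --> X](subr0 (0 : R)); apply: cvgB; first exact: v0.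
  elim: (l) => [|k IH]; first by under eq_fun do rewrite big_ord0; exact: cvg_cst.
  rewrite (_ : (fun n => _) = (fun n : nat => \sum_(j < k) antideriv (dil (a j n)^-1 (G j)) s +
    antideriv (dil (a k n)^-1 (G k)) s)); last by apply/funext => n; rewrite big_ord_recr.
  rewrite -[X in _ --> X](addr0 (0 : R)).
  by apply: cvgD IH _; exact: antideriv_dil_cvg.
(* The bound is uniform in [n]: the Hoelder bound on [v n] starts from Strauss' estimate at 0,
   dilations preserve the norm of [G j], and [|x| <= x ^ 2 + 1] removes the squares. *)
- move=> T; exists (8 * N + 2 * (T * N) + 1 + \sum_(j < l) (T * ip mu (G j) (G j) + 1)).
  move=> n s /andP[s0 sT].
  have sq (x : R) : `|x| <= x ^+ 2 + 1.
    by rewrite -real_normK ?num_real//; have := sqr_ge0 (`|x| - 1); nra.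
  have T0 : 0 <= T by exact: le_trans sT.
  apply: le_trans (ler_normB _ _) _; apply: lerD.
    apply: le_trans (sq _) _; rewrite lerD2r.
    have h0 := strauss (g2 n) (vg n) (gN n) (vN n) (lexx 0); rewrite expR0 mulr1 in h0.
    have h1 := primitive_holderT 0 s (g2 n) (vg n); rewrite subr0 (ger0_norm s0) in h1.
    have h2 : s * ip mu (g n) (g n) <= T * N by apply: ler_pM; rewrite ?ip_ge0.
    have := sqr_ge0 (v n s - 2 * v n 0); nra.
  apply: le_trans (ler_norm_sum _ _ _) _; apply: ler_sum => j _.
  apply: le_trans (sq _) _; rewrite lerD2r.
  apply: le_trans (antideriv_half_le (dil_half (ia0 j n) (Gh j)) s0) _.
  by have [G2 _] := Gh j; rewrite ip_dil// ler_wpM2r ?ip_ge0.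
- exists M, (Num.max S 1) => n s Mn; rewrite ge_max => /andP[Ss s1].
  have s0 : 0 < s by lra.
  have [_ _ pw _ _] := rw n.
  rewrite (increment_unit s0 pw (g2 n) (dil_sum_half l (fun j => a0 j n) Gh)).
  by rewrite normrM ger0_norm ?sqrtr_ge0// mulrC ler_wpM2r ?sqrtr_ge0// cap.
Qed.

End Assembly.

Theorem theorem1p10 (R : realType) (p : nat) (hp : (1 < p)%N)
    (u : nat -> R * R -> R) (A0 : R)
    (hu : forall n, H1rad (u n))
    (hbounded : exists M : R, forall n, H1norm (u n) <= M)
    (hweak : H1_weakly_cvg u (cst 0))
    (hlimsup : limn_esup (fun n => orlicz_norm p (u n)) = A0%:E)
    (hA0 : 0 < A0) :
  exists (alpha : nat -> nat -> R) (psi : nat -> R -> R),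
    [/\ forall j, scale (alpha j),
        forall j k, j <> k -> orthogonal_scales (alpha j) (alpha k),
        forall j, profile (psi j) &
        exists s : nat -> nat, {homo s : m n / (m < n)%N} /\
        exists r : nat -> nat -> R * R -> R,
          [/\ forall l n, (1 <= l)%N -> H1 (r l n),
              forall l n, (1 <= l)%N -> {ae leb2, forall x,
                u (s n) x =
                  \sum_(j < l) concentration (alpha j (s n)) (psi j) x + r l n x},
              (fun l => limn_esup (fun n => orlicz_norm p (r l n))) @ \oo
                --> 0%:E &
              forall l, (1 <= l)%N ->
                (fun n => grad_norm (u (s n)) ^+ 2
                          - \sum_(j < l) L2norm leb1 (weak_deriv (psi j)) ^+ 2
                          - grad_norm (r l n) ^+ 2) @ \oo --> (0 : R)]].
Proof.
have /choice[v /choice[g r]] : forall n, exists v g, rad (u n) v g by move=> n; exact: H1rad_rad.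
have [M HM] := hbounded; pose N := M ^+ 2.
have gN n : ip leb1 (g n) (g n) <= N by case: (H1norm_bounds (r n) (HM n)).
have vN n : (\int[leb1]_t (v n t ^+ 2 * expR (- 2 * t))%:E <= N%:E)%E.
  by case: (H1norm_bounds (r n) (HM n)).
have v0 := weak_pointwise r gN hweak.
have g2 n : g n \in Lfun leb1 2%:E by have [_ _ _ ? _] := r n.
(* Only this half of the derivative is decomposed; [ip_halves] restores the other half in the energy
   identity. *)
pose x n : R -> R^o := g n \_ halfline.
have xh n : L2half (x n) := halfline_half (g2 n).
have xN n : ip leb1 (x n) (x n) <= N.
  exact: le_trans (ip_restrict_le (@measurable_halfline R) (g2 n)) (gN n).
have [a [G [s [sm Gh [a0 aoo] orth [energy cap]]]]] :=
  profile_decomposition (@L2half_preHilbert R) (@L2half_dilation R) xh xN.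
(* The scales are known along [s] only; [q] extends them to all indices. *)
have [q qK qoo] := strict_inverse sm.
have soo : s @ \oo --> \oo.
  move=> A [K _ AK]; exists K => // m /= Km; apply: AK => /=.
  apply: leq_trans Km _; elim: m => // m IH; exact: leq_ltn_trans IH (sm _ _ _).
pose alpha j n := a j (s (q n)).
have alphas j n : alpha j (s n) = a j (s n) by rewrite /alpha qK.
pose rho l n : R -> R^o := fun t => \sum_(j < l) dil (a j n)^-1 (G j) t.
have rhoE l n : x n - \sum_(j < l) dil (a j n)^-1 (G j) = (fun t => x n t - rho l n t).
  by apply/funext => t; rewrite fctE fct_sumE.
have orth' j k : j <> k -> (fun n => `|ln (a k (s n) / a j (s n))|) @ \oo --> +oo.
  move=> /eqP; rewrite neq_ltn => /orP[|kj]; first exact: orth.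
  rewrite (_ : (fun n => _) = (fun n => `|ln (a j (s n) / a k (s n))|)); first exact: orth.
  by apply/funext => n; rewrite -[in RHS]invf_div lnV ?normrN// posrE divr_gt0.
exists alpha, (fun j => profile_of (G j)); split.
- move=> j; split; first by move=> n; exact: a0.
  by apply: (cvg_comp q (fun n => a j (s n)) qoo); exact: aoo.
- move=> j k jk.
  by apply: (cvg_comp q (fun n => `|ln (a k (s n) / a j (s n))|) qoo); exact: orth'.
- by move=> j; case: (profile_ofP (Gh j)).
exists s; split => //.
pose rem l n z := u (s n) z - \sum_(j < l) concentration (a j (s n)) (profile_of (G j)) z.
exists rem.
have rr l n := rad_remainder l (fun j => a0 j (s n)) Gh (r (s n)).
split.
- by move=> l n _; case: (rad_H1 (rr l n)).
- move=> l n _; apply: aeW => z; rewrite /rem; under eq_bigr do rewrite alphas.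
  by rewrite addrCA subrr addr0.
- apply: cvg_ereal_squeeze => [l|eps e0].
    by apply: limn_esup_nonneg => n; exact: orlicz_norm_ge0.
  (* [remainder_orlicz] loses a factor 2. *)
  have e2 : 0 < eps / 2 by rewrite divr_gt0.
  have [L HL] := cap _ e2; exists L => // l /= Ll.
  have [S [K HK]] := HL l Ll.
  apply: limn_esup_le; rewrite (_ : eps = 2 * (eps / 2)); last by rewrite mulrC divfK.
  apply: (remainder_orlicz (p := p) (u := fun n => u (s n)) (v := fun n => v (s n)) (g := fun n => g (s n))
    (a := fun j n => a j (s n)) (l := l) (N := N) hp e2) => //.
  + by move=> t; apply: (cvg_comp s (fun n => v n t) soo); exact: v0.
  + by exists S, K => n b Kn b0 Sb; have := HK n b Kn b0 Sb; rewrite rhoE.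
- move=> l _.
  (* The part of [g (s n)] on the negative half line occurs in both gradients and cancels. *)
  have E n : grad_norm (u (s n)) ^+ 2 - \sum_(j < l) L2norm leb1 (weak_deriv (profile_of (G j))) ^+ 2
      - grad_norm (rem l n) ^+ 2 = 2 * pi * (ip leb1 (x (s n)) (x (s n)) -
      \sum_(j < l) ip leb1 (G j) (G j) -
      ip leb1 (fun t => x (s n) t - rho l (s n) t) (fun t => x (s n) t - rho l (s n) t)).
    rewrite (rad_H1 (r (s n))).2 (rad_H1 (rr l n)).2.
    under eq_bigr do rewrite (profile_ofP (Gh _)).2.
    rewrite -mulr_sumr (ip_halves (g2 _) (dil_sum_half l (fun j => a0 j (s n)) Gh)).
    have := ip_halves (g2 (s n)) (ph0 (@L2half_preHilbert R)).
    have z (f : R -> R) : (fun t => f t - (0 : R -> R^o) t) = f by apply/funext => t; exact: subr0.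
    by rewrite !z => ->; rewrite /x /rho; ring.
  rewrite (funext E).
  rewrite -[X in _ --> X](mulr0 (2 * pi)); apply: cvgM; first exact: cvg_cst.
  by have := energy l; under eq_fun do rewrite rhoE.
Qed.
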